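(* Let $X$ be a non-empty connected coarse space that can be covered by countably many bounded sets, and let $\mu$ be a uniformly bounded measure on $X$ for which a gordo set exists. If $X$ is bounded, then it is amenable and has geometric property (T). If $X$ is unbounded, then it has geometric property (T) if and only if it is not amenable.
   Context: Coarse spaces. A coarse structure on a set $X$ is a collection of subsets of $X\times X$ (the controlled sets) containing the diagonal and closed under subsets, finite unions, inverses $E^{-1}=\{(x,y)\mid (y,x)\in E\}$ and compositions $E\circ F=\{(x,z)\mid \exists y:(x,y)\in E,(y,z)\in F\}$. $E$ is symmetric if $E=E^{-1}$. Write $E_x=\{y\mid (y,x)\in E\}$ and $E_U=\bigcup_{x\in U}E_x$. A set $U\subseteq X$ is bounded if $U\times U$ is controlled, and $E$-bounded if $U\times U\subseteq E$. $X$ is connected if $\{(x,y)\}$ is controlled for all $x,y\in X$. Measures. Measures $\mu$ on $X$ are defined on any $\sigma$-algebra containing all singletons. A controlled set $E$ is measurable if $E_U$ is measurable for every measurable $U$. $\mu$ is uniformly bounded if for each controlled $E$ there is $C>0$ such that every $E$-bounded measurable set has measure at most $C$. A gordo set is a symmetric measurable controlled set $E$ with $\inf_{x\in X}\mu(E_x)>0$. Blocks. For $E$ controlled and $\epsilon>0$, a collection $(A_i)$ of measurable sets is $(E,\epsilon)$-blocking if the $A_i$ are pairwise disjoint, $A_i\times A_i\subseteq E$ and $\mu(A_i)\ge\epsilon$ for all $i$; it is blocking if it is $(E,\epsilon)$-blocking for some $E,\epsilon$. Amenability. $X$ (with $\mu$) is amenable if the following equivalent conditions hold: (i) there is a positive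 unital linear map $\phi:L^\infty X\to\mathbb C$ such that $\phi(f)=0$ whenever $(A_i)$ is a blocking collection and $f\in L^\infty X$ satisfies $\int_{A_i}f\,d\mu=0$ for all $i$ and $f=0$ outside $\bigsqcup_iA_i$; (ii) for each controlled measurable $E\subseteq X\times X$ and each $\epsilon>0$ there is a non-empty bounded measurable $U\subseteq X$ with $\mu(E_U)\le(1+\epsilon)\mu(U)$. Algebra. $T\in B(L^2(X,\mu))$ is supported on a measurable controlled set $E$ if for all measurable $U$, all $\xi\in L^2X$ supported on $U$ and all $\eta\in L^2X$, $\langle \xi,T\eta\rangle=\langle\xi,T(\eta|_{E_U})\rangle$ (with $\eta|_{E_U}$ extended by zero). $\mathbb C_{cs}[X]$ is the unital $*$-algebra of operators supported on some measurable controlled set. An operator in $(E,\epsilon)$-blocks is an element of $\mathbb C_{cs}[X]$ supported on $\bigsqcup_iA_i\times A_i$ for some $(E,\epsilon)$-blocking collection $(A_i)$. Let $LL^2X$ be the measurable functions that are square integrable on bounded measurable sets; each $T\in\mathbb C_{cs}[X]$ acts on $LL^2X$ by $\langle T\phi,\xi\rangle=\langle\phi,T^*\xi\rangle$ for all $\xi\in L^2X$ with bounded support. Put $\Phi(T)=T(1_X)\in LL^2X$. $M_f$ denotes multiplication by $f\in L^\infty X$. Geometric property (T). A representation of $\mathbb C_{cs}[X]$ is a unital $*$-homomorphism $\rho:\mathbb C_{cs}[X]\to B(\mathcal H)$, $\mathcal H$ a Hilbert space (no continuity required; $\rho$ is omitted from notation). A vector $v\in\mathcal H$ is constant if $Tv=M_{\Phi(T)}v$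 for all $T\in\mathbb C_{cs}[X]$ with $\Phi(T)$ bounded; $\mathcal H_c$ is the closed subspace of constant vectors. $(X,\mu)$ has geometric property (T) if there are a controlled set $E$ and constants $\epsilon,\gamma>0$ such that for every representation $\mathcal H$ and every unit vector $v\in\mathcal H_c^\perp$ there is a non-zero operator $T$ in $(E,\epsilon)$-blocks with $\Phi(T)$ bounded and $\|(T-M_{\Phi(T)})v\|\ge\gamma\|T\|$ (norm of $T$ in $B(L^2X)$). *)

(* Defs.v *)
From HB Require Import structures.
From mathcomp Require Import all_boot all_order all_algebra.
From mathcomp Require Import complex.
From mathcomp Require Import all_classical all_reals all_analysis.
From mathcomp Require Import measurable_realfun lra ring.

Set Implicit Arguments.
Unset Strict Implicit.
Unset Printing Implicit Defensive.
Import Order.TTheory GRing.Theory Num.Theory Num.Def.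
Import numFieldNormedType.Exports.

Local Open Scope classical_set_scope.
Local Open Scope ring_scope.
Local Open Scope complex_scope.

Section InnerProduct.
Context {R : realType}.

Definition hnorm {V : lmodType R[i]} (form : V -> V -> R[i]) (u : V) : R :=
  Num.sqrt (complex.Re (form u u)).

Definition bounded_op {V : lmodType R[i]} (form : V -> V -> R[i])
    (T : V -> V) : Prop :=
  linear T /\ exists M : R, forall u, hnorm form (T u) <= M * hnorm form u.

Definition opnorm {V : lmodType R[i]} (form : V -> V -> R[i])
    (T : V -> V) : R :=
  sup [set hnorm form (T u) | u in [set u | hnorm form u <= 1]].

Definition is_adjoint {V : lmodType R[i]} (form : V -> V -> R[i])
    (T S : V -> V) : Prop :=
  forall u v, form (T u) v = form u (S v).

Definition complete_form {V : lmodType R[i]} (form : V -> V -> R[i]) : Prop :=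
  forall u : nat -> V,
    (forall e : R, 0 < e -> exists N, forall m n, (N <= m)%N -> (N <= n)%N ->
       hnorm form (u m - u n) < e) ->
    exists l, (fun n => hnorm form (u n - l)) @ \oo --> (0 : R).

End InnerProduct.

Record hilbertSpace (R : realType) := HilbertSpace {
  hilbert_sort :> lmodType R[i];
  hdot : {dot hilbert_sort for conjC};
  hdot_complete : complete_form hdot }.

Record coarseStructure (X : Type) := CoarseStructure {
  controlled : set (set (X * X));
  controlled_diagonal : controlled diagonal;
  controlled_subset : forall E F, F `<=` E -> controlled E -> controlled F;
  controlled_setU : forall E F,
    controlled E -> controlled F -> controlled (E `|` F);
  controlled_inverse : forall E, controlled E -> controlled E^-1%relation;
  controlled_comp : forall E F,
    controlled E -> controlled F ->
    controlled [set xz | exists y, E (xz.1, y) /\ F (y, xz.2)] }.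

Section Coarse.
Context {X : Type} (cs : coarseStructure X).

(* [fibre E U] is E_U; the set U indexes the second coordinate. *)
Definition fibre (E : set (X * X)) (U : set X) : set X :=
  [set y | exists2 x, U x & E (y, x)].

Definition coarse_bounded (U : set X) : Prop := controlled cs (U `*` U).

Definition coarse_connected : Prop := forall x y, controlled cs [set (x, y)].

Definition countably_covered : Prop :=
  exists B : nat -> set X,
    (forall n, coarse_bounded (B n)) /\ \bigcup_n B n = setT.

End Coarse.

Section CoarseMeasure.
Context {R : realType} {d : measure_display} {X : measurableType d}.
Variables (cs : coarseStructure X) (mu : {measure set X -> \bar R}).

Definition measurable_rel (E : set (X * X)) : Prop :=
  forall U, measurable U -> measurable (fibre E U).

Definition uniformly_bounded : Prop :=
  forall E, controlled cs E -> exists2 C : R, 0 < C &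
    forall U, measurable U -> U `*` U `<=` E -> (mu U <= C%:E)%E.

Definition gordo (E : set (X * X)) : Prop :=
  [/\ controlled cs E, E = E^-1%relation, measurable_rel E &
      (0 < ereal_inf [set mu (fibre E [set x]) | x in [set: X]])%E].

Definition block_collection (E : set (X * X)) (eps : R)
    (A : set (set X)) : Prop :=
  trivIset A id /\
  forall U, A U -> [/\ measurable U, U `*` U `<=` E & (eps%:E <= mu U)%E].

Definition blocking (A : set (set X)) : Prop :=
  exists E (eps : R), [/\ controlled cs E, 0 < eps & block_collection E eps A].

Definition cmeasurable (f : X -> R[i]) : Prop :=
  measurable_fun setT (fun x => complex.Re (f x)) /\
  measurable_fun setT (fun x => complex.Im (f x)).

Definition cintegral (D : set X) (f : X -> R[i]) : R[i] :=
  (\int[mu]_(x in D) complex.Re (f x)) +i* (\int[mu]_(x in D) complex.Im (f x)).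

Definition sqr_integral (D : set X) (f : X -> R[i]) : \bar R :=
  (\int[mu]_(x in D) (Normc.normc (f x) ^+ 2)%:E)%E.

Definition Linfty (f : X -> R[i]) : Prop :=
  cmeasurable f /\
  exists M : R, \forall x \ae mu, Normc.normc (f x) <= M.

Definition LL2 (f : X -> R[i]) : Prop :=
  cmeasurable f /\
  forall U, measurable U -> coarse_bounded cs U -> (sqr_integral U f < +oo)%E.

Definition sqr_integrable (f : X -> R[i]) : Prop :=
  cmeasurable f /\ (sqr_integral setT f < +oo)%E.

End CoarseMeasure.

Section L2_theory.
Context {R : realType} {d : measure_display} {X : measurableType d}.
Variable mu : {measure set X -> \bar R}.
Implicit Types (f g : X -> R[i]) (a : R[i]).

Lemma normc_sqr (z : R[i]) :
  Normc.normc z ^+ 2 = complex.Re z ^+ 2 + complex.Im z ^+ 2.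
Proof. by case: z => x y /=; rewrite sqr_sqrtr// addr_ge0 ?sqr_ge0. Qed.

Lemma cmeasurableZD a f g :
  cmeasurable f -> cmeasurable g -> cmeasurable (a *: f + g).
Proof.
move=> [mf1 mf2] [mg1 mg2]; split.
- have -> : (fun x => complex.Re ((a *: f + g) x)) =
      (fun x => complex.Re a * complex.Re (f x) - complex.Im a * complex.Im (f x)
         + complex.Re (g x)).
    by apply/funext => x; rewrite !fctE/=; case: a (f x) (g x) => ? ? [? ?] [? ?].
  by apply: measurable_funD => //; apply: measurable_funB; apply: measurable_funM.
- have -> : (fun x => complex.Im ((a *: f + g) x)) =
      (fun x => complex.Re a * complex.Im (f x) + complex.Im a * complex.Re (f x)
         + complex.Im (g x)).
    by apply/funext => x; rewrite !fctE/=; case: a (f x) (g x) => ? ? [? ?] [? ?].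
  by apply: measurable_funD => //; apply: measurable_funD; apply: measurable_funM.
Qed.

Lemma measurable_normc_sqr f : cmeasurable f ->
  measurable_fun setT (fun x => Normc.normc (f x) ^+ 2).
Proof.
move=> [m1 m2]; under eq_fun do rewrite normc_sqr.
by apply: measurable_funD; apply: measurable_funX.
Qed.

Lemma sqr_integrableP f : sqr_integrable mu f <-> cmeasurable f /\
  mu.-integrable setT (fun x => (Normc.normc (f x) ^+ 2)%:E).
Proof.
split=> -[mf h]; split=> //.
- apply/integrableP; split.
    by apply/measurable_EFinP; exact: measurable_normc_sqr.
  rewrite (eq_integral (fun x => (Normc.normc (f x) ^+ 2)%:E))//.
  by move=> x _; rewrite gee0_abs// lee_fin sqr_ge0.
- move/integrableP : h => [_].
  rewrite (eq_integral (fun x => (Normc.normc (f x) ^+ 2)%:E))//.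
  by move=> x _; rewrite gee0_abs// lee_fin sqr_ge0.
Qed.

Lemma sqr_integrableZD a f g : sqr_integrable mu f -> sqr_integrable mu g ->
  sqr_integrable mu (a *: f + g).
Proof.
move=> /sqr_integrableP[mf hf] /sqr_integrableP[mg hg].
apply/sqr_integrableP; split; first exact: cmeasurableZD.
pose h x := (2 * Normc.normc a ^+ 2) * Normc.normc (f x) ^+ 2
            + 2 * Normc.normc (g x) ^+ 2.
apply: (@le_integrable _ _ _ _ _ _ _ (EFin \o h)) => //.
- by apply/measurable_EFinP; apply: measurable_normc_sqr; exact: cmeasurableZD.
- move=> x _; rewrite /h /= lee_fin !ger0_norm ?sqr_ge0//; last first.
    have := sqr_ge0 (Normc.normc a * Normc.normc (f x)).
    by have := sqr_ge0 (Normc.normc (g x)); rewrite exprMn; lra.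
  rewrite !normc_sqr !fctE; clear h; case: a (f x) (g x) => a1 a2 [f1 f2] [g1 g2] /=.
  have := sqr_ge0 (a1 * f1 - a2 * f2 - g1).
  have := sqr_ge0 (a1 * f2 + a2 * f1 - g2).
  nra.
- rewrite (_ : EFin \o h = ((fun x => (2 * Normc.normc a ^+ 2)%:E * (Normc.normc (f x) ^+ 2)%:E)
     \+ (fun x => 2%:E * (Normc.normc (g x) ^+ 2)%:E))%E); last by apply/funext.
  by apply: integrableD => //; apply: integrableZl.
Qed.

Lemma sqr_integrable0 : sqr_integrable mu (0 : X -> R[i]).
Proof.
split; first by split; exact: measurable_cst.
rewrite /sqr_integral (eq_integral (cst 0%E)) ?integral0// => x _.
by rewrite fctE Normc.normc0 expr0n.
Qed.

Definition L2pred : {pred X -> R[i]} := fun f => `[< sqr_integrable mu f >].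

Lemma L2pred_submod_closed : submod_closed L2pred.
Proof.
split; first exact/asboolP/sqr_integrable0.
by move=> a f g /asboolP hf /asboolP hg; exact/asboolP/sqr_integrableZD.
Qed.

HB.instance Definition _ :=
  GRing.isSubmodClosed.Build _ _ L2pred L2pred_submod_closed.

Record L2fun := MkL2fun { L2fun_val :> X -> R[i]; _ : L2fun_val \in L2pred }.
HB.instance Definition _ := [isSub for L2fun_val].
HB.instance Definition _ := [Choice of L2fun by <:].
HB.instance Definition _ := [SubChoice_isSubLmodule of L2fun by <:].


Definition L2null : {pred L2fun} :=
  fun u => `[< \forall x \ae mu, L2fun_val u x = 0 >].

Lemma L2null_submod_closed : submod_closed L2null.
Proof.
split; first by apply/asboolP; exact: aeW.
move=> a u v /asboolP hu /asboolP hv; apply/asboolP.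
by apply: filterS2 hu hv => x ux vx; rewrite /= !fctE ux vx addr0 scaler0.
Qed.

HB.instance Definition _ :=
  GRing.isSubmodClosed.Build _ _ L2null L2null_submod_closed.

(* [L2] is the space of a.e. classes; [L2repr] picks a representative and
   [toL2] is the class of a square integrable function (0 for other ones). *)
Definition L2 : Type := Quotient.quot L2null.
HB.instance Definition _ := Choice.on L2.
HB.instance Definition _ := GRing.Zmodule.on L2.

Definition L2repr (u : L2) : X -> R[i] := L2fun_val (repr (u : Quotient.quot L2null)).
Definition toL2 (f : X -> R[i]) : L2 :=
  \pi_(Quotient.quot L2null)%qT (insubd (0 : L2fun) f).

Lemma L2repr_sqr_integrable u : sqr_integrable mu (L2repr u).
Proof. by apply/asboolP; exact: (valP (repr (u : Quotient.quot L2null))). Qed.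

Lemma toL2_eq f g : sqr_integrable mu f -> sqr_integrable mu g ->
  (\forall x \ae mu, f x = g x) -> toL2 f = toL2 g.
Proof.
move=> /asboolP hf /asboolP hg fg; apply/eqP.
rewrite /toL2 -Quotient.idealrBE; apply/asboolP.
apply: filterS fg => x fgx /=.
by rewrite !fctE /= !insubdK// fgx subrr.
Qed.

Lemma toL2K f : sqr_integrable mu f ->
  \forall x \ae mu, L2repr (toL2 f) x = f x.
Proof.
move=> /asboolP hf.
have : (repr (toL2 f : Quotient.quot L2null) - insubd 0 f) \in L2null.
  by rewrite Quotient.idealrBE reprK.
move=> /asboolP; apply: filterS => x /=.
by rewrite !fctE /= insubdK// => /eqP; rewrite subr_eq0 => /eqP.
Qed.

Lemma L2reprK u : toL2 (L2repr u) = u.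
Proof. by rewrite /toL2 /L2repr valKd reprK. Qed.

Lemma L2_eqP u v : (\forall x \ae mu, L2repr u x = L2repr v x) -> u = v.
Proof.
by move=> uv; rewrite -(L2reprK u) -(L2reprK v); apply: toL2_eq => //;
  exact: L2repr_sqr_integrable.
Qed.

Lemma L2reprD u v :
  \forall x \ae mu, L2repr (u + v) x = L2repr u x + L2repr v x.
Proof.
have : (repr (u + v : Quotient.quot L2null) - (repr (u : Quotient.quot L2null) + repr (v : Quotient.quot L2null))) \in L2null.
  by rewrite Quotient.idealrBE reprK raddfD /= !reprK.
move=> /asboolP; apply: filterS => x /=.
by rewrite !fctE /= => /eqP; rewrite subr_eq0 => /eqP.
Qed.

Definition L2scale (a : R[i]) (u : L2) : L2 := toL2 (a *: L2repr u).

Lemma sqr_integrableZ a f : sqr_integrable mu f -> sqr_integrable mu (a *: f).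
Proof.
by move=> hf; rewrite -[_ *: _]addr0; apply: sqr_integrableZD => //;
  exact: sqr_integrable0.
Qed.

Lemma L2scaleE a u :
  \forall x \ae mu, L2repr (L2scale a u) x = a * L2repr u x.
Proof. by apply: toL2K; apply: sqr_integrableZ; exact: L2repr_sqr_integrable. Qed.

Lemma L2scaleA a b u : L2scale a (L2scale b u) = L2scale (a * b) u.
Proof.
apply: L2_eqP; have := L2scaleE a (L2scale b u).
apply: filterS3 (L2scaleE b u) (L2scaleE (a * b) u) => x -> -> ->.
by rewrite mulrA.
Qed.

Lemma L2scale1 : left_id 1 L2scale.
Proof. by move=> u; apply: L2_eqP; apply: filterS (L2scaleE 1 u) => x ->; rewrite mul1r. Qed.

Lemma L2scaleDr : right_distributive L2scale +%R.
Proof.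
move=> a u v; apply: L2_eqP.
near=> x.
rewrite (near (L2scaleE a (u + v)) x)// (near (L2reprD u v) x)//.
rewrite (near (L2reprD (L2scale a u) (L2scale a v)) x)//.
by rewrite (near (L2scaleE a u) x)// (near (L2scaleE a v) x)// mulrDr.
Unshelve. all: by end_near. Qed.

Lemma L2scaleDl u : {morph L2scale^~ u : a b / a + b}.
Proof.
move=> a b; apply: L2_eqP.
near=> x.
rewrite (near (L2scaleE (a + b) u) x)//.
rewrite (near (L2reprD (L2scale a u) (L2scale b u)) x)//.
by rewrite (near (L2scaleE a u) x)// (near (L2scaleE b u) x)// mulrDl.
Unshelve. all: by end_near. Qed.

HB.instance Definition _ := GRing.Zmodule_isLmodule.Build R[i] L2
  L2scaleA L2scale1 L2scaleDr L2scaleDl.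

Definition L2dot (u v : L2) : R[i] :=
  cintegral mu setT (fun x => L2repr u x * conjC (L2repr v x)).

Definition cintegrable (f : X -> R[i]) : Prop :=
  mu.-integrable setT (fun x => (complex.Re (f x))%:E) /\
  mu.-integrable setT (fun x => (complex.Im (f x))%:E).

Lemma cmeasurableMJ f g : cmeasurable f -> cmeasurable g ->
  cmeasurable (fun x => f x * conjC (g x)).
Proof.
move=> [mf1 mf2] [mg1 mg2]; split.
- rewrite (_ : (fun _ => _) = (fun x => complex.Re (f x) * complex.Re (g x)
      + complex.Im (f x) * complex.Im (g x))); last first.
    by apply/funext => x; case: (f x) (g x) => ? ? [? ?] /=; ring.
  by apply: measurable_funD; apply: measurable_funM.
- rewrite (_ : (fun _ => _) = (fun x => complex.Im (f x) * complex.Re (g x)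
      - complex.Re (f x) * complex.Im (g x))); last first.
    by apply/funext => x; case: (f x) (g x) => ? ? [? ?] /=; ring.
  by apply: measurable_funB; apply: measurable_funM.
Qed.

Lemma cintegrable_mul f g : sqr_integrable mu f -> sqr_integrable mu g ->
  cintegrable (fun x => f x * conjC (g x)).
Proof.
move=> /sqr_integrableP[mf hf] /sqr_integrableP[mg hg].
pose h x := Normc.normc (f x) ^+ 2 + Normc.normc (g x) ^+ 2.
have ih : mu.-integrable setT (EFin \o h).
  rewrite (_ : EFin \o h = ((fun x => (Normc.normc (f x) ^+ 2)%:E)
     \+ (fun x => (Normc.normc (g x) ^+ 2)%:E))%E); last by apply/funext.
  by apply: integrableD.
have [mre mim] := cmeasurableMJ mf mg.
split; apply: (@le_integrable _ _ _ _ _ _ _ (EFin \o h)) => //.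
- exact/measurable_EFinP.
- move=> x _; rewrite /h /= lee_fin [leRHS]ger0_norm ?addr_ge0 ?sqr_ge0//.
  rewrite !normc_sqr ler_norml; case: (f x) (g x) => f1 f2 [g1 g2] /=.
  have := sqr_ge0 (f1 - g1); have := sqr_ge0 (f1 + g1).
  have := sqr_ge0 (f2 - g2); have := sqr_ge0 (f2 + g2).
  by move=> *; apply/andP; split; nra.
- exact/measurable_EFinP.
- move=> x _; rewrite /h /= lee_fin [leRHS]ger0_norm ?addr_ge0 ?sqr_ge0//.
  rewrite !normc_sqr ler_norml; case: (f x) (g x) => f1 f2 [g1 g2] /=.
  have := sqr_ge0 (f1 - g2); have := sqr_ge0 (f1 + g2).
  have := sqr_ge0 (f2 - g1); have := sqr_ge0 (f2 + g1).
  by move=> *; apply/andP; split; nra.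
Qed.


Lemma ae_eq_cintegral f g : cmeasurable f -> cmeasurable g ->
  (\forall x \ae mu, f x = g x) -> cintegral mu setT f = cintegral mu setT g.
Proof.
move=> [mf1 mf2] [mg1 mg2] fg; rewrite /cintegral /Rintegral.
by congr (fine _ +i* fine _); apply: ae_eq_integral => //;
  (try exact/measurable_EFinP); apply: filterS fg => x ->.
Qed.

Lemma cintegralZD a f g : cintegrable f -> cintegrable g ->
  cintegral mu setT (fun x => a * f x + g x) =
  a * cintegral mu setT f + cintegral mu setT g.
Proof.
move=> [f1 f2] [g1 g2]; case: a => a1 a2; rewrite /cintegral.
rewrite (_ : (fun _ => complex.Re _) = (fun x => (a1 * complex.Re (f x) + (- a2) * complex.Im (f x))
   + complex.Re (g x))); last first.
  by apply/funext => x; case: (f x) (g x) => ? ? [? ?] /=; ring.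
rewrite (_ : (fun _ => complex.Im _) = (fun x => (a1 * complex.Im (f x) + a2 * complex.Re (f x))
   + complex.Im (g x))); last first.
  by apply/funext => x; case: (f x) (g x) => ? ? [? ?] /=; ring.
have Z r h : mu.-integrable setT (EFin \o h) -> mu.-integrable setT (EFin \o (fun x => r * h x)).
  by move=> ih; apply: (@integrableZl _ _ _ mu setT measurableT r (EFin \o h)).
have D h k : mu.-integrable setT (EFin \o h) -> mu.-integrable setT (EFin \o k) ->
    mu.-integrable setT (EFin \o (fun x => h x + k x)).
  by move=> ih ik; exact: (integrableD measurableT ih ik).
rewrite !RintegralD ?RintegralZl//; do ?[exact: Z|apply: D => //; exact: Z].
by rewrite /= mulNr; congr (_ +i* _).
Qed.

Lemma L2dot_linearl w : GRing.linear_for *%R (L2dot^~ w).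
Proof.
move=> a u v; rewrite /L2dot.
have hu := L2repr_sqr_integrable u; have hv := L2repr_sqr_integrable v.
have hw := L2repr_sqr_integrable w.
have [mu' mv] := (hu.1, hv.1); have mw := hw.1.
rewrite -cintegralZD; try exact: cintegrable_mul.
apply: ae_eq_cintegral.
- exact: cmeasurableMJ (L2repr_sqr_integrable _).1 mw.
- rewrite (_ : (fun _ => _) = a *: (fun x => L2repr u x * conjC (L2repr w x)) +
      (fun x => L2repr v x * conjC (L2repr w x))); last exact/funext.
  by apply: cmeasurableZD; exact: cmeasurableMJ.
- apply: filterS2 (L2reprD (a *: u) v) (L2scaleE a u) => x -> ->.
  by rewrite mulrDl mulrA.
Qed.

Lemma L2dotC u v : L2dot u v = conjC (L2dot v u).
Proof.
rewrite /L2dot /cintegral; pose w1 := L2repr u.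
have iw := cintegrable_mul (L2repr_sqr_integrable v) (L2repr_sqr_integrable u).
have eR : (fun x => complex.Re (w1 x * conjC (L2repr v x))) =
          (fun x => complex.Re (L2repr v x * conjC (w1 x))).
  by apply/funext => x; case: (w1 x) (L2repr v x) => ? ? [? ?] /=; ring.
have eI : (fun x => complex.Im (w1 x * conjC (L2repr v x))) =
          (fun x => (-1) * complex.Im (L2repr v x * conjC (w1 x))).
  by apply/funext => x; case: (w1 x) (L2repr v x) => ? ? [? ?] /=; ring.
rewrite -/w1 eR eI RintegralZl//; last exact: iw.2.
by rewrite mulN1r.
Qed.


Lemma L2dot_linearr u : GRing.linear_for (conjC \; *%R) (L2dot u).
Proof.
move=> a v w; rewrite L2dotC (L2dot_linearl u a v w) rmorphD rmorphM /=.
by rewrite -!L2dotC.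
Qed.

Lemma L2dot_herm u v : L2dot u v = (-1) ^+ false * conjC (L2dot v u).
Proof. by rewrite mul1r -L2dotC. Qed.

Lemma L2dot_self u :
  L2dot u u = (fine (sqr_integral mu setT (L2repr u)))%:C.
Proof.
rewrite /L2dot /cintegral; congr (_ +i* _).
- congr fine; apply: eq_integral => x _; congr EFin; rewrite normc_sqr.
  by case: (L2repr u x) => ? ? /=; ring.
- rewrite /Rintegral (eq_integral (cst 0%E)) ?integral0// => x _.
  by congr EFin; case: (L2repr u x) => ? ? /=; ring.
Qed.

Lemma L2dot_gt0 u : u != 0 -> 0 < L2dot u u.
Proof.
have /sqr_integrableP[mu' iu] := L2repr_sqr_integrable u.
have fin : sqr_integral mu setT (L2repr u) \is a fin_num.
  exact: integrable_fin_num.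
move=> u0; rewrite L2dot_self ltcR lt_neqAle; apply/andP; split; last first.
  by rewrite fine_ge0//; apply: integral_ge0 => x _; rewrite lee_fin sqr_ge0.
rewrite eq_sym fine_eq0//; apply: contra u0 => /eqP i0; apply/eqP.
have m2 : measurable_fun setT (fun x => (Normc.normc (L2repr u x) ^+ 2)%:E).
  by apply/measurable_EFinP; exact: measurable_normc_sqr.
have /(ae_eq_integral_abs mu measurableT m2) h :
    (\int[mu]_x `|(Normc.normc (L2repr u x) ^+ 2)%:E| = 0)%E.
  rewrite -i0; apply: eq_integral => x _.
  by rewrite gee0_abs// lee_fin sqr_ge0.
apply: L2_eqP; apply: filterS2 h (L2scaleE 0 0) => x /(_ I)/= [] h0.
have -> : L2scale 0 0 = 0 by exact: scale0r.
move=> ->; rewrite mul0r; apply: Normc.eq0_normc.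
by apply/eqP; rewrite -sqrf_eq0 h0.
Qed.

HB.instance Definition _ :=
  bilinear_isBilinear.Build R[i] L2 L2 R[i] *%R (conjC \; *%R) L2dot
    (L2dot_linearl, L2dot_linearr).
HB.instance Definition _ :=
  isHermitianSesquilinear.Build R[i] L2 false conjC L2dot L2dot_herm.
HB.instance Definition _ := isDotProduct.Build R[i] L2 L2dot L2dot_gt0.

End L2_theory.

Section CsAlgebra.
Context {R : realType} {d : measure_display} {X : measurableType d}.
Variables (cs : coarseStructure X) (mu : {measure set X -> \bar R}).
Local Notation L2 := (L2 mu).
Local Notation L2dot := (@L2dot R d X mu).

Definition multop (f : X -> R[i]) (u : L2) : L2 :=
  toL2 mu (fun x => f x * L2repr u x).

Definition L2restrict (A : set X) : L2 -> L2 := multop \1_A.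

Definition supported_in (U : set X) (u : L2) : Prop :=
  \forall x \ae mu, ~ U x -> L2repr u x = 0.

Definition supported_on (E : set (X * X)) (T : L2 -> L2) : Prop :=
  [/\ controlled cs E, measurable_rel E &
      forall U xi eta, measurable U -> supported_in U xi ->
        L2dot xi (T eta) = L2dot xi (T (L2restrict (fibre E U) eta))].

Definition Ccs (T : L2 -> L2) : Prop :=
  bounded_op L2dot T /\ exists E, supported_on E T.

Definition in_blocks (E : set (X * X)) (eps : R) (T : L2 -> L2) : Prop :=
  Ccs T /\ exists2 A, block_collection mu E eps A &
    supported_on (\bigcup_(U in A) (U `*` U)) T.

(* [LL2_act T phi psi] means that psi = T phi in LL^2. Below S is T^*, which
   exists for every bounded T. *)
Definition LL2_act (T : L2 -> L2) (phi psi : X -> R[i]) : Prop :=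
  LL2 cs mu psi /\
  exists2 S, is_adjoint L2dot T S &
    forall U xi, measurable U -> coarse_bounded cs U -> supported_in U xi ->
      cintegral mu setT (fun x => psi x * conjC (L2repr xi x)) =
      cintegral mu setT (fun x => phi x * conjC (L2repr (S xi) x)).

(* [is_Phi T f] means that f is a representative of Phi(T), which is only
   determined up to a.e. equality. *)
Definition is_Phi (T : L2 -> L2) (f : X -> R[i]) : Prop :=
  LL2_act T (cst 1) f.

Record mean (phi : (X -> R[i]) -> R[i]) : Prop := {
  mean_ae : forall f g, Linfty mu f -> Linfty mu g ->
    (\forall x \ae mu, f x = g x) -> phi f = phi g;
  mean_linear : forall a f g, Linfty mu f -> Linfty mu g ->
    phi (a *: f + g) = a * phi f + phi g;
  mean_ge0 : forall f, Linfty mu f -> (\forall x \ae mu, 0 <= f x) ->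
    0 <= phi f;
  mean1 : phi (cst 1) = 1 }.

Definition amenable_mean : Prop :=
  exists2 phi, mean phi &
    forall A f, blocking cs mu A -> Linfty mu f ->
      (forall U, A U -> cintegral mu U f = 0) ->
      (\forall x \ae mu, ~ (\bigcup_(U in A) U) x -> f x = 0) ->
      phi f = 0.

Definition amenable_folner : Prop :=
  forall E (eps : R), controlled cs E -> measurable_rel E -> 0 < eps ->
    exists U, [/\ U !=set0, measurable U, coarse_bounded cs U &
      (mu (fibre E U) <= (1 + eps)%:E * mu U)%E].

(* Representations are functions on all maps L^2 -> L^2; their values outside
   the algebra [Ccs] are unconstrained and never used. *)
Record representation (H : hilbertSpace R) (rho : (L2 -> L2) -> (H -> H)) :
    Prop := {
  rep_bounded : forall T, Ccs T -> bounded_op (hdot H) (rho T);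
  rep_id : rho idfun = idfun;
  rep_linear : forall a S T, Ccs S -> Ccs T ->
    rho (a *: S + T) = a *: rho S + rho T;
  rep_comp : forall S T, Ccs S -> Ccs T -> rho (S \o T) = rho S \o rho T;
  rep_adjoint : forall S T, Ccs S -> Ccs T ->
    is_adjoint L2dot S T -> is_adjoint (hdot H) (rho S) (rho T) }.

Definition constant_vector (H : hilbertSpace R)
    (rho : (L2 -> L2) -> (H -> H)) (v : H) : Prop :=
  forall T f, Ccs T -> is_Phi T f -> Linfty mu f -> rho T v = rho (multop f) v.

Definition geometric_property_T : Prop :=
  exists E (eps gamma : R),
    [/\ controlled cs E, 0 < eps, 0 < gamma &
      forall (H : hilbertSpace R) (rho : (L2 -> L2) -> (H -> H)),
        representation rho ->
        forall v : H, hnorm (hdot H) v = 1 ->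
          (forall w, constant_vector rho w -> hdot H v w = 0) ->
          exists T f, [/\ in_blocks E eps T, T <> 0, is_Phi T f, Linfty mu f &
            gamma * opnorm L2dot T
              <= hnorm (hdot H) (rho T v - rho (multop f) v)]].

End CsAlgebra.

(* Main.v *)
Require Import Defs.
From mathcomp Require Import all_boot all_order all_algebra.
From mathcomp Require Import complex.
From mathcomp Require Import all_classical all_reals all_analysis.
From mathcomp Require Import measurable_realfun lra ring.

(** The proof is a cycle of three implications for unbounded [X]: a mean gives
Folner sets, Folner sets contradict property (T), and the failure of property (T)
gives a mean.  They all use the averaging operator [avg A] of a blocking
collection [A], which replaces a function on each block by its mean value.  It is
a self-adjoint projection in blocks, and [Phi (avg A)] is the indicator of the
union of the blocks.

A maximal family of points whose fibres under a gordo set are disjoint yields a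
countable partition of [X] into measurable cells that are uniformly bounded and
have measure between two positive constants ([measured_partition]).

Failure of (T) gives a mean ([amenable_of_not_T]).  There are then unit vectors
[v], in suitable representations, that are almost fixed by [avg A] for all
[(E, eps)]-blocking [A].  The state [f |-> <M_f v, v>] is a mean.  If [f] lives on
the blocks and has integral zero on each of them, then [avg A o M_f o avg A = 0], so
the state is almost zero at [f] ([vector_state_blocking]).  An ultrafilter limit of
these states is an invariant mean ([amenable_of_approximate_means]).

Folner sets contradict (T) ([not_T_of_folner]).  The identity representation on
square integrable functions has no nonzero constant vector, because [X] has
infinite measure.  If [U] is a Folner set and [T] is in blocks, then [T 1_U] and
[Phi (T) 1_U] differ only on the blocks that cross the boundary of [U]
([block_operator_almost_constant]), so the normalised indicators of Folner sets are
almost constant.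

A mean gives Folner sets ([folner_of_mean]).  Suppose that there are none.  Join
cells that are close to each other.  The edges split into finitely many matchings
([cell_matchings]), and every finite set of cells has a boundary proportional to its
measure ([cell_isoperimetric]).  By a min-cut argument there is a bounded flow along
the edges whose divergence at each cell is the measure of the cell ([exact_flow]).
The flow is found by minimising a square error over a compact box; the first order
condition at a minimum and the coarea form of the isoperimetric inequality force
the error to be zero.  One matching at a time, the flow writes the constant
function 1 as a finite sum of functions with integral zero on the pairs of matched
cells.  A mean vanishes at all of them, but not at 1 ([no_mean_of_flow]).

If [X] is bounded, the constant functions are square integrable.  The state of the
normalised constant function is the required mean, and the projection onto the
constants maps every vector of a representation to a constant vector, which is
property (T) with [gamma = 1] ([T_of_bounded]). *)

Set Implicit Arguments.
Unset Strict Implicit.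
Unset Printing Implicit Defensive.
Import Order.TTheory GRing.Theory Num.Theory Num.Def.
Import numFieldNormedType.Exports.

Local Open Scope classical_set_scope.
Local Open Scope ring_scope.
Local Open Scope complex_scope.

(** * Inner product spaces over the complex numbers *)

Notation normc := Normc.normc.

Section complex_facts.
Context {R : realType}.
Implicit Types (z w : R[i]).

Lemma normrE z : `|z| = (normc z)%:C.
Proof. by rewrite normc_def; case: z. Qed.

Lemma normc_ge0 z : 0 <= normc z.
Proof. by case: z => x y /=; exact: sqrtr_ge0. Qed.

Lemma mulcJ z : z * conjC z = (normc z ^+ 2)%:C.
Proof. by rewrite -normCK normrE rmorphXn. Qed.

Lemma ReD z w : complex.Re (z + w) = complex.Re z + complex.Re w.
Proof. by case: z w => ? ? []. Qed.

Lemma ReN z : complex.Re (- z) = - complex.Re z.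
Proof. by case: z. Qed.

Lemma ReJ z : complex.Re (conjC z) = complex.Re z.
Proof. by case: z. Qed.

Lemma Re_le_normc z : complex.Re z <= normc z.
Proof.
have := normc_ge_Re z; rewrite normrE lecR; apply: le_trans.
exact: ler_norm.
Qed.

Lemma normcJ z : normc (conjC z) = normc z.
Proof. by apply: complexI; rewrite -!normrE norm_conjC. Qed.

Lemma normc_real (x : R) : 0 <= x -> normc x%:C = x.
Proof. by move=> x0; apply: complexI; rewrite -normrE ger0_norm// ler0c. Qed.

Lemma normc_div_real z (x : R) : 0 < x -> normc (z / x%:C) = normc z / x.
Proof.
by move=> x0; rewrite Normc.normcM Normc.normcV (normc_real (ltW x0)).
Qed.

Lemma gt0_complex_neq0 (x : R) : 0 < x -> x%:C != 0.
Proof. by move=> x0; rewrite eq_complex /= eqxx andbT gt_eqF. Qed.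

Lemma ge0_complexE z : 0 <= z -> z = (complex.Re z)%:C.
Proof. by case: z => x y; rewrite lecE /= => /andP[/eqP -> _]. Qed.

End complex_facts.

Section linear_facts.
Context {K : pzRingType} {V : lmodType K} (T : V -> V).
Hypothesis linT : linear T.

Lemma lin0 : T 0 = 0.
Proof. by have := linT (-1) 0 0; rewrite scaler0 add0r scaleN1r addNr. Qed.

Lemma linZ a u : T (a *: u) = a *: T u.
Proof. by rewrite -[a *: u]addr0 linT lin0 addr0. Qed.

Lemma linB u v : T (u - v) = T u - T v.
Proof. by rewrite addrC -scaleN1r linT scaleN1r addrC. Qed.

End linear_facts.

Section form_facts.
Context {R : realType} {V : lmodType R[i]} (form : {dot V for conjC}).
Implicit Types (u v w : V) (a : R[i]) (T S : V -> V).

Local Notation "''[' u , v ]" := (form u%R v%R) : ring_scope.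
Local Notation "`|[ u ]|" := (hnorm form u%R) (at level 0, u at level 99).

Lemma hnorm_ge0 u : 0 <= `|[u]|.
Proof. exact: sqrtr_ge0. Qed.

Lemma formC u v : '[u, v] = conjC '[v, u].
Proof. by rewrite hermC expr0 mul1r. Qed.

Lemma form_self u : '[u, u] = (`|[u]| ^+ 2)%:C.
Proof.
have u0 := dnorm_ge0 form u.
rewrite [LHS](ge0_complexE u0) /hnorm sqr_sqrtr//.
by move: u0; rewrite lecE => /andP[].
Qed.

Lemma hnorm_sqr u : `|[u]| ^+ 2 = complex.Re '[u, u].
Proof. by rewrite form_self. Qed.

Lemma hnorm_eq0 u : `|[u]| = 0 -> u = 0.
Proof.
move=> u0; apply/eqP; rewrite -(dnorm_eq0 form); apply/eqP.
by rewrite form_self u0 expr0n.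
Qed.

Lemma hnorm0 : `|[0 : V]| = 0.
Proof. by rewrite /hnorm linear0r sqrtr0. Qed.

Lemma hnormZ a u : `|[a *: u]| = normc a * `|[u]|.
Proof.
apply/eqP; rewrite -(@eqrXn2 _ 2)// ?mulr_ge0 ?normc_ge0 ?hnorm_ge0//.
apply/eqP/complexI; rewrite -form_self dnormZ normrE form_self.
by rewrite -rmorphXn -rmorphM -exprMn.
Qed.

Lemma hnorm_normalize u : 0 < `|[u]| -> `|[(`|[u]|^-1)%:C *: u]| = 1.
Proof.
by move=> u0; rewrite hnormZ normc_real ?invr_ge0 ?hnorm_ge0// mulVf ?gt_eqF.
Qed.

Lemma hnormN u : `|[- u]| = `|[u]|.
Proof. by rewrite -scaleN1r hnormZ normcN Normc.normc1 mul1r. Qed.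

Lemma hnormBC u v : `|[u - v]| = `|[v - u]|.
Proof. by rewrite -hnormN opprB. Qed.

(** Expand the square of the norm of [<v, v> u - <u, v> v]. *)
Lemma cauchy_schwarz u v : normc '[u, v] <= `|[u]| * `|[v]|.
Proof.
have [->|v0] := eqVneq v 0; first by rewrite linear0r hnorm0 mulr0 Normc.normc0.
have vv : 0 < `|[v]|.
  rewrite lt_neqAle hnorm_ge0 andbT eq_sym; apply: contra v0 => /eqP.
  by move/hnorm_eq0 => ->.
have := dnorm_ge0 form ('[v, v] *: u - '[u, v] *: v).
rewrite linearBl !linearBr /= !linearZl_LR !linearZr_LR /= -!/(conjC _).
rewrite -(formC v v) (formC v u).
set z := '[u, v]; rewrite !form_self.
rewrite (_ : _ - _ = (`|[v]| ^+ 2 * (`|[u]| ^+ 2 * `|[v]| ^+ 2 - normc z ^+ 2))%:C); last first.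
  have := mulcJ z; move: (conjC z) (_ ^+ 2) (_ ^+ 2) (_ ^+ 2) => zc a b c zzc.
  by rewrite rmorphM rmorphB rmorphM /= -zzc /GRing.scale /=; ring.
rewrite ler0c pmulr_rge0 ?exprn_gt0// subr_ge0 -exprMn.
by rewrite ler_sqr ?nnegrE ?mulr_ge0 ?normc_ge0 ?hnorm_ge0.
Qed.

Lemma hnormD u v : `|[u + v]| <= `|[u]| + `|[v]|.
Proof.
rewrite -ler_sqr ?nnegrE ?addr_ge0 ?hnorm_ge0// hnorm_sqr dnormD !form_self.
rewrite !ReD ReJ /=; have := le_trans (Re_le_normc _) (cauchy_schwarz u v).
by move=> ?; rewrite sqrrD; lra.
Qed.

Lemma hnormB u v : `|[u - v]| <= `|[u]| + `|[v]|.
Proof. by rewrite -(hnormN v); exact: hnormD. Qed.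

(** In a Hilbert space a contractive idempotent is an orthogonal projection:
if [P w = w] and [P k = 0], then [|w| <= |w + a k|] for every scalar [a], and
minimising over [a] forces [w] and [k] to be orthogonal. *)
Lemma contractive_idempotent_selfadjoint T :
  linear T -> (forall u, `|[T u]| <= `|[u]|) -> (forall u, T (T u) = T u) ->
  is_adjoint form T T.
Proof.
move=> linT contr idem.
have orth w k : T w = w -> T k = 0 -> '[w, k] = 0.
  move=> Tw Tk.
  have [->|k0] := eqVneq k 0; first by rewrite linear0r.
  have kk : 0 < `|[k]|.
    rewrite lt_neqAle hnorm_ge0 andbT eq_sym; apply: contra k0 => /eqP.
    by move/hnorm_eq0 => ->.
  pose a := - ('[w, k] / '[k, k]).
  have := contr (a *: k + w); rewrite linT Tw Tk scaler0 add0r.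
  rewrite -ler_sqr ?nnegrE ?hnorm_ge0// [leRHS]hnorm_sqr dnormD.
  rewrite dnormZ linearZl_LR /= (formC k w) normrE !form_self.
  have -> : a * conjC '[w, k] = - ((normc '[w, k] ^+ 2) / `|[k]| ^+ 2)%:C.
    rewrite /a form_self; have := mulcJ '[w, k].
    move: (conjC _) (_ ^+ 2) (_ ^+ 2) => zc b c h.
    by rewrite rmorphM fmorphV /= -h; ring.
  have -> : normc a = normc '[w, k] / `|[k]| ^+ 2.
    by rewrite /a normcN Normc.normcM Normc.normcV form_self normc_real ?exprn_ge0 ?hnorm_ge0.
  rewrite -rmorphXn -rmorphM !ReD ReJ ReN /=.
  set n := normc _; set K := `|[k]| => h.
  have {}h : n ^+ 2 / K ^+ 2 <= 0.
    rewrite expr_div_n in h.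
    have e : n ^+ 2 / (K ^+ 2) ^+ 2 * K ^+ 2 = n ^+ 2 / K ^+ 2.
      by field; rewrite gt_eqF.
    by rewrite e in h; lra.
  have {}h : n ^+ 2 <= 0 by move: h; rewrite ler_pdivrMr ?mul0r ?exprn_gt0.
  apply: Normc.eq0_normc; apply/eqP; rewrite -sqrf_eq0 eq_le h/=.
  exact: sqr_ge0.
move=> u v; have TuT x : T (x - T x) = 0 by rewrite linB// idem subrr.
have o1 : '[T u, v - T v] = 0 by exact: orth.
have o2 : '[u - T u, T v] = 0 by rewrite formC (orth (T v)) ?rmorph0.
move: o1 o2; rewrite linearBr linearBl => /eqP; rewrite subr_eq0 => /eqP ->.
by move=> /eqP; rewrite subr_eq0 => /eqP ->.
Qed.

Lemma opnorm_le T (c : R) : 0 <= c ->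
  (forall u, `|[T u]| <= c * `|[u]|) -> opnorm form T <= c.
Proof.
move=> c0 Tc; apply: ge_sup.
  by exists `|[T 0]|; exists 0 => //=; rewrite hnorm0 ler01.
move=> _ [u /= u1 <-]; apply: le_trans (Tc u) _.
by rewrite ler_piMr.
Qed.

Lemma opnorm_has_ubound T : bounded_op form T ->
  has_ubound [set `|[T u]| | u in [set u | `|[u]| <= 1]].
Proof.
move=> [linT [M TM]]; exists (maxr M 0) => _ [x /= x1 <-]; apply: le_trans (TM x) _.
have x0 := hnorm_ge0 x; have [M0|M0] := leP 0 M; first exact: ler_piMr.
nra.
Qed.

Lemma opnorm_ge0 T : bounded_op form T -> 0 <= opnorm form T.
Proof.
move=> bT; apply: ub_le_sup; first exact: opnorm_has_ubound.
by exists 0; rewrite /= ?(lin0 bT.1) hnorm0 ?ler01.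
Qed.

Lemma opnorm_bound T u : bounded_op form T ->
  `|[T u]| <= opnorm form T * `|[u]|.
Proof.
move=> bT; have linT := bT.1.
have [->|u0] := eqVneq u 0.
  by rewrite lin0// hnorm0 mulr0.
have uu : 0 < `|[u]|.
  rewrite lt_neqAle hnorm_ge0 andbT eq_sym; apply: contra u0 => /eqP.
  by move/hnorm_eq0 => ->.
rewrite -ler_pdivrMr//.
have -> : `|[T u]| / `|[u]| = `|[T ((`|[u]|^-1)%:C *: u)]|.
  by rewrite linZ// hnormZ normc_real ?invr_ge0 ?hnorm_ge0// mulrC.
apply: ub_le_sup; first exact: opnorm_has_ubound.
by exists ((`|[u]|^-1)%:C *: u) => //=; rewrite hnorm_normalize.
Qed.

Lemma opnorm_gt0 T : bounded_op form T -> T <> (fun=> 0) -> 0 < opnorm form T.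
Proof.
move=> bT T0; have [u Tu] : exists u, T u != 0.
  by apply/not_existsP => h; apply: T0; apply/funext => u; apply/eqP/negP/negP;
    have := h u; case: eqP.
rewrite ltNge; apply/negP => h; have := opnorm_bound u bT.
have := hnorm_ge0 u => u0 Tu0.
have : `|[T u]| = 0 by apply/eqP; rewrite eq_le hnorm_ge0 andbT; nra.
by move/hnorm_eq0/eqP; rewrite (negbTE Tu).
Qed.

End form_facts.

(** * Complex functions and multiplication operators *)

Section complex_functions.
Context {R : realType} {d : measure_display} {X : measurableType d}.
Variable mu : {measure set X -> \bar R}.
Implicit Types (f g : X -> R[i]) (U V : set X).

Lemma cmeasurable_cst (a : R[i]) : cmeasurable (cst a : X -> R[i]).
Proof. by split; exact: measurable_cst. Qed.

Lemma cmeasurable_real (f : X -> R) :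
  measurable_fun setT f -> cmeasurable (fun x => (f x)%:C).
Proof. by move=> mf; split => //=; exact: measurable_cst. Qed.

Lemma cmeasurableJ f : cmeasurable f -> cmeasurable (fun x => conjC (f x)).
Proof.
move=> mf; have := cmeasurableMJ (cmeasurable_cst 1) mf.
by under eq_fun do rewrite mul1r.
Qed.

Lemma cmeasurableM f g :
  cmeasurable f -> cmeasurable g -> cmeasurable (fun x => f x * g x).
Proof.
move=> mf mg; have := cmeasurableMJ mf (cmeasurableJ mg).
by under eq_fun do rewrite conjCK.
Qed.

Lemma cmeasurable_indic U : measurable U -> cmeasurable (\1_U : X -> R[i]).
Proof.
move=> mU; have := cmeasurable_real (@measurable_indic _ _ R _ U mU).
congr cmeasurable; apply/funext => x.
by rewrite !indicE; case: (x \in U).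
Qed.

Lemma Linfty_bound f : Linfty mu f ->
  exists2 M : R, 0 <= M & \forall x \ae mu, normc (f x) <= M.
Proof.
move=> [_ [M fM]]; exists (Num.max M 0); first by rewrite le_max lexx orbT.
by apply: filterS fM => x xM; rewrite le_max xM.
Qed.

Lemma Linfty_bounded f (M : R) :
  cmeasurable f -> (forall x, normc (f x) <= M) -> Linfty mu f.
Proof. by move=> mf fM; split=> //; exists M; exact: aeW. Qed.

Lemma Linfty_cst a : Linfty mu (cst a).
Proof. exact: (Linfty_bounded (cmeasurable_cst a) (M := normc a)). Qed.

Lemma Linfty_indic U : measurable U -> Linfty mu (\1_U : X -> R[i]).
Proof.
move=> mU; apply: (@Linfty_bounded _ 1); first exact: cmeasurable_indic.
by move=> x; rewrite indicE; case: (_ \in _); rewrite ?Normc.normc1 ?Normc.normc0.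
Qed.

Lemma LinftyJ f : Linfty mu f -> Linfty mu (fun x => conjC (f x)).
Proof.
move=> [mf [M fM]]; split; first exact: cmeasurableJ.
by exists M; apply: filterS fM => x; rewrite normcJ.
Qed.

Lemma LinftyM f g : Linfty mu f -> Linfty mu g -> Linfty mu (fun x => f x * g x).
Proof.
move=> [mf [M fM]] [mg [N gN]]; split; first exact: cmeasurableM.
exists (M * N); apply: filterS2 fM gN => x fx gx.
by rewrite Normc.normcM ler_pM ?normc_ge0.
Qed.

Lemma LinftyZD a f g : Linfty mu f -> Linfty mu g -> Linfty mu (a *: f + g).
Proof.
move=> [mf [M fM]] [mg [N gN]]; split; first exact: cmeasurableZD.
exists (normc a * M + N); apply: filterS2 fM gN => x fx gx.
rewrite !fctE; apply: le_trans (le_normcD _ _) _.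
by rewrite Normc.normcM lerD// ler_wpM2l ?normc_ge0.
Qed.

Lemma sqr_integral_ge0 U f : (0 <= sqr_integral mu U f)%E.
Proof. by apply: integral_ge0 => x _; rewrite lee_fin sqr_ge0. Qed.

Lemma ae_eq_sqr_integral U f g : measurable U -> cmeasurable f -> cmeasurable g ->
  (\forall x \ae mu, U x -> f x = g x) -> sqr_integral mu U f = sqr_integral mu U g.
Proof.
move=> mU mf mg fg; rewrite /sqr_integral; apply: ge0_ae_eq_integral => //.
- by apply: measurable_funTS; apply/measurable_EFinP; exact: measurable_normc_sqr.
- by apply: measurable_funTS; apply/measurable_EFinP; exact: measurable_normc_sqr.
- by move=> x _; rewrite lee_fin sqr_ge0.
- by move=> x _; rewrite lee_fin sqr_ge0.
- by apply: filterS fg => x fgx Ux; rewrite fgx.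
Qed.

Lemma sqr_integral_indic U a : measurable U ->
  sqr_integral mu setT (fun x => a * \1_U x) = ((normc a ^+ 2)%:E * mu U)%E.
Proof.
move=> mU; rewrite /sqr_integral.
rewrite (eq_integral (fun x => (normc a ^+ 2)%:E * (\1_U x)%:E)%E).
  rewrite ge0_integralZl_EFin// ?sqr_ge0 ?integral_indic ?setIT//.
  by apply/measurable_EFinP; exact: measurable_indic.
move=> x _; rewrite -EFinM; congr EFin; rewrite !indicE.
by case: (_ \in _); rewrite ?mulr1 // ?mulr0 Normc.normc0 expr0n.
Qed.

Lemma sqr_integrable_indic U a : measurable U -> (mu U < +oo)%E ->
  sqr_integrable mu (fun x => a * \1_U x).
Proof.
move=> mU fU; split.
  exact: cmeasurableM (cmeasurable_cst a) (cmeasurable_indic mU).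
rewrite sqr_integral_indic//; apply: lte_mul_pinfty => //.
by rewrite lee_fin sqr_ge0.
Qed.

Lemma sqr_integrableM f g : Linfty mu f -> sqr_integrable mu g ->
  sqr_integrable mu (fun x => f x * g x).
Proof.
move=> hf [mg ig]; have [M M0 fM] := Linfty_bound hf.
have mf := hf.1; split; first exact: cmeasurableM.
apply: (@le_lt_trans _ _ ((M ^+ 2)%:E * sqr_integral mu setT g)%E); last first.
  by apply: lte_mul_pinfty => //; rewrite lee_fin sqr_ge0.
rewrite /sqr_integral -ge0_integralZl_EFin ?sqr_ge0//; last 2 first.
- by move=> x _; rewrite lee_fin sqr_ge0.
- by apply/measurable_EFinP; exact: measurable_normc_sqr.
apply: ae_ge0_le_integral => //.
- by move=> x _; rewrite lee_fin sqr_ge0.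
- by apply/measurable_EFinP/measurable_normc_sqr; exact: cmeasurableM.
- by move=> x _; rewrite -EFinM lee_fin mulr_ge0 ?sqr_ge0.
- apply: measurable_funeM; apply/measurable_EFinP; exact: measurable_normc_sqr.
- apply: filterS fM => x fx _; rewrite -EFinM lee_fin Normc.normcM exprMn.
  by rewrite ler_wpM2r ?sqr_ge0// lerXn2r ?nnegrE ?normc_ge0.
Qed.

End complex_functions.

Section L2_facts.
Context {R : realType} {d : measure_display} {X : measurableType d}.
Variable mu : {measure set X -> \bar R}.
Local Notation L2 := (L2 mu).
Local Notation L2dot := (@L2dot R d X mu).
Implicit Types (f g : X -> R[i]) (U V : set X) (u v : L2).

Lemma sqr_integral_L2repr u :
  sqr_integral mu setT (L2repr u) = (hnorm L2dot u ^+ 2)%:E.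
Proof.
have /sqr_integrableP[mu' iu] := L2repr_sqr_integrable u.
rewrite /hnorm L2dot_self /= sqr_sqrtr ?fine_ge0 ?sqr_integral_ge0// fineK//.
exact: integrable_fin_num.
Qed.

Lemma hnorm_toL2 f : sqr_integrable mu f ->
  (hnorm L2dot (toL2 mu f) ^+ 2)%:E = sqr_integral mu setT f.
Proof.
move=> hf; rewrite -sqr_integral_L2repr; apply: ae_eq_sqr_integral => //.
- exact: (L2repr_sqr_integrable _).1.
- exact: hf.1.
- by apply: filterS (toL2K hf) => x ->.
Qed.

Lemma L2dotE u v f : cmeasurable f ->
  (\forall x \ae mu, L2repr u x * conjC (L2repr v x) = f x) ->
  L2dot u v = cintegral mu setT f.
Proof.
move=> mf uvf; apply: ae_eq_cintegral => //.
by apply: cmeasurableMJ; exact: (L2repr_sqr_integrable _).1.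
Qed.

Lemma multopE f u : Linfty mu f ->
  \forall x \ae mu, L2repr (multop f u) x = f x * L2repr u x.
Proof.
by move=> hf; apply: toL2K; apply: sqr_integrableM => //;
  exact: L2repr_sqr_integrable.
Qed.

Lemma L2reprZD a u v :
  \forall x \ae mu, L2repr (a *: u + v) x = a * L2repr u x + L2repr v x.
Proof. by apply: filterS2 (L2reprD (a *: u) v) (L2scaleE a u) => x -> ->. Qed.

Lemma L2reprB u v :
  \forall x \ae mu, L2repr (u - v) x = L2repr u x - L2repr v x.
Proof.
by rewrite -scaleN1r addrC; apply: filterS (L2reprZD (-1) v u) => x ->;
  rewrite mulN1r addrC.
Qed.

Lemma L2repr0 : \forall x \ae mu, L2repr (0 : L2) x = 0.
Proof. by rewrite -(scale0r (0 : L2)); apply: filterS (L2scaleE 0 0) => x ->; rewrite mul0r. Qed.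

Lemma toL2ZD a f g : sqr_integrable mu f -> sqr_integrable mu g ->
  toL2 mu (a *: f + g) = a *: toL2 mu f + toL2 mu g.
Proof.
move=> hf hg; apply: L2_eqP; near=> x.
rewrite (near (toL2K (sqr_integrableZD a hf hg)) x)//.
rewrite (near (L2reprZD a (toL2 mu f) (toL2 mu g)) x)//.
by rewrite (near (toL2K hf) x)// (near (toL2K hg) x)//.
Unshelve. all: by end_near. Qed.

Lemma multop_linear f : Linfty mu f -> linear (@multop _ _ _ mu f).
Proof.
move=> hf a u v; apply: L2_eqP; near=> x.
rewrite (near (multopE (a *: u + v) hf) x)//.
rewrite (near (L2reprZD a u v) x)//.
rewrite (near (L2reprZD a (multop f u) (multop f v)) x)//.
rewrite (near (multopE u hf) x)// (near (multopE v hf) x)//.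
by rewrite mulrDr mulrCA.
Unshelve. all: by end_near. Qed.

Lemma multop_contr f M u : Linfty mu f -> 0 <= M ->
  (\forall x \ae mu, normc (f x) <= M) ->
  hnorm L2dot (multop f u) <= M * hnorm L2dot u.
Proof.
move=> hf M0 fM; rewrite -ler_sqr ?nnegrE ?mulr_ge0 ?hnorm_ge0//.
have hu := L2repr_sqr_integrable u.
rewrite exprMn -lee_fin (EFinM (M ^+ 2)) -!sqr_integral_L2repr /sqr_integral.
rewrite -ge0_integralZl_EFin ?sqr_ge0//; last 2 first.
- by move=> x _; rewrite lee_fin sqr_ge0.
- by apply/measurable_EFinP; exact: measurable_normc_sqr hu.1.
apply: ae_ge0_le_integral => //.
- by move=> x _; rewrite lee_fin sqr_ge0.
- by apply/measurable_EFinP/measurable_normc_sqr; exact: (L2repr_sqr_integrable _).1.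
- by move=> x _; rewrite -EFinM lee_fin mulr_ge0 ?sqr_ge0.
- by apply: measurable_funeM; apply/measurable_EFinP; exact: measurable_normc_sqr hu.1.
- apply: filterS2 (multopE u hf) fM => x -> fx _; rewrite -EFinM lee_fin Normc.normcM exprMn.
  by rewrite ler_wpM2r ?sqr_ge0// lerXn2r ?nnegrE ?normc_ge0.
Qed.

Lemma multop_bounded f : Linfty mu f -> bounded_op L2dot (multop f).
Proof.
move=> hf; split; first exact: multop_linear.
by have [M M0 fM] := Linfty_bound hf; exists M => u; exact: multop_contr.
Qed.

Lemma multop_adjoint f : Linfty mu f ->
  is_adjoint L2dot (multop f) (multop (fun x => conjC (f x))).
Proof.
move=> hf u v; apply: L2dotE.
  by apply: cmeasurableMJ; exact: (L2repr_sqr_integrable _).1.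
apply: filterS2 (multopE u hf) (multopE v (LinftyJ hf)) => x -> ->.
by rewrite rmorphM /= conjCK mulrA (mulrC (f x)).
Qed.

Lemma multop_comp f g : Linfty mu f -> Linfty mu g ->
  multop f \o multop g = multop (fun x => f x * g x) :> (L2 -> L2).
Proof.
move=> hf hg; apply/funext => u /=; apply: L2_eqP; near=> x.
rewrite (near (multopE (multop g u) hf) x)// (near (multopE u hg) x)//.
by rewrite (near (multopE u (LinftyM hf hg)) x)// mulrA.
Unshelve. all: by end_near. Qed.

Lemma multopZD a f g : Linfty mu f -> Linfty mu g ->
  multop (a *: f + g) = a *: multop f + multop g :> (L2 -> L2).
Proof.
move=> hf hg; apply/funext => u /=; apply: L2_eqP; near=> x.
rewrite (near (multopE u (LinftyZD a hf hg)) x)// !fctE.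
rewrite (near (L2reprZD a (multop f u) (multop g u)) x)//.
rewrite (near (multopE u hf) x)// (near (multopE u hg) x)//.
by rewrite mulrDl mulrA.
Unshelve. all: by end_near. Qed.

Lemma multop_ae f g : Linfty mu f -> Linfty mu g ->
  (\forall x \ae mu, f x = g x) -> multop f = multop g :> (L2 -> L2).
Proof.
move=> hf hg fg; apply/funext => u; apply: toL2_eq.
- exact: sqr_integrableM (L2repr_sqr_integrable u).
- exact: sqr_integrableM (L2repr_sqr_integrable u).
- by apply: filterS fg => x ->.
Qed.

Lemma multop1 : multop (cst 1) = idfun :> (L2 -> L2).
Proof.
apply/funext => u; rewrite /multop -[RHS]L2reprK; congr toL2.
by apply/funext => x; rewrite mul1r.
Qed.

End L2_facts.

(** * Completeness of the space of square integrable functions *)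

Section L2_complete.
Context {R : realType} {d : measure_display} {X : measurableType d}.
Variable mu : {measure set X -> \bar R}.
Local Notation L2dot := (@L2dot R d X mu).

Let q (k : nat) : R := (2 ^+ k.+1)^-1.

Let q_gt0 k : 0 < q k.
Proof. by rewrite invr_gt0 exprn_gt0. Qed.

Let qS k : q k.+1 = q k / 2.
Proof. by rewrite /q exprS invfM mulrC. Qed.

Let q_le1 k : q k <= 1.
Proof. by rewrite invf_le1 ?exprn_gt0// exprn_ege1// ler1n. Qed.

Let q_small (C e : R) : 0 <= C -> 0 < e -> exists k, C * q k < e.
Proof.
move=> C0 e0; exists (Num.truncn (C / e)).
rewrite /q ltr_pdivrMr ?exprn_gt0// mulrC -ltr_pdivrMr//.
apply: lt_le_trans (truncnS_gt _) _.
by rewrite -natrX ler_nat ltnW// ltn_expl.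
Qed.

Let geometric_cvg (r : nat -> R) (C : R) : 0 <= C ->
  (forall k m, (k <= m)%N -> `|r m - r k| <= C * q k) -> cvgn r.
Proof.
move=> C0 rC; apply/cauchy_cvgP/cauchyP => e e0.
have [k Ck] := q_small C0 e0; exists (r k), k => // m /= km.
by rewrite /ball /= distrC (le_lt_trans (rC _ _ km)).
Qed.

(** Pass to a subsequence whose increments [d_k] satisfy [|d_k| < q_k ^ 2] with
[q_k = 2 ^- (k+1)].  Then [h = sum_k q_k ^- 2 |d_k| ^ 2] is integrable, so at
almost every point [|d_k x| <= q_k sqrt (h x)]: the subsequence converges
pointwise, and the same function [h] controls the speed of convergence in
square mean. *)
Lemma L2_complete : complete_form L2dot.
Proof.
move=> u cu.
have /choice[N HN] : forall k, exists N, forall m n, (N <= m)%N -> (N <= n)%N ->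
    hnorm L2dot (u m - u n) < q k ^+ 2.
  by move=> k; apply: cu; rewrite exprn_gt0.
pose s k := (\sum_(i < k.+1) N i)%N.
have sS k : (s k <= s k.+1)%N by rewrite /s (big_ord_recr k.+1)/= leq_addr.
have Ns k : (N k <= s k)%N by rewrite /s big_ord_recr/= leq_addl.
pose z k := L2repr (u (s k)).
pose D k := L2repr (u (s k.+1) - u (s k)).
have mz k : cmeasurable (z k) by exact: (L2repr_sqr_integrable _).1.
have mD k : cmeasurable (D k) by exact: (L2repr_sqr_integrable _).1.
pose a k x := (((q k ^+ 2)^-1)%:E * (normc (D k x) ^+ 2)%:E)%E.
pose h x : \bar R := (\sum_(0 <= k <oo) a k x)%E.
have a0 k x : (0 <= a k x)%E.
  by rewrite mule_ge0// lee_fin ?sqr_ge0// invr_ge0 sqr_ge0.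
have h0 x : (0 <= h x)%E by apply: nneseries_ge0 => k _ _; exact: a0.
have ma k : measurable_fun setT (a k).
  by apply: measurable_funeM; apply/measurable_EFinP; exact: measurable_normc_sqr.
have mh : measurable_fun setT h.
  by apply: (@ge0_emeasurable_sum _ _ _ _ a xpredT) => [k x _ _|k _]; [exact: a0|exact: ma].
have ih : (\int[mu]_x h x <= 1%:E)%E.
  rewrite integral_nneseries//.
  apply: le_trans (@epsilon_trick0 R 1 xpredT ler01); apply: lee_nneseries => k _ .
    by move=> _; apply: integral_ge0 => x _; exact: a0.
  rewrite ge0_integralZl_EFin//; last 3 first.
  - by move=> x _; rewrite lee_fin sqr_ge0.
  - by apply/measurable_EFinP; exact: measurable_normc_sqr.
  - by rewrite invr_ge0 sqr_ge0.
  rewrite -/(sqr_integral mu setT (D k)) sqr_integral_L2repr -EFinM lee_fin.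
  have -> : 1 / (2 ^ k.+1)%:R = q k by rewrite div1r natrX.
  have := HN k (s k.+1) (s k) (leq_trans (Ns k) (sS k)) (Ns k).
  rewrite mulrC ler_pdivrMr ?exprn_gt0// => hk.
  apply: (@le_trans _ _ ((q k ^+ 2) ^+ 2)).
    by rewrite lerXn2r ?nnegrE ?hnorm_ge0 ?sqr_ge0// ltW.
  rewrite -exprM -exprS; apply: ler_wiXn2l => //; exact: ltW.
have inth : mu.-integrable setT h.
  apply/integrableP; split => //.
  under eq_integral do rewrite gee0_abs//.
  exact: le_lt_trans ih (ltry _).
have [Z [mZ Z0 HZ]] : {ae mu, forall x, h x \is a fin_num /\
    forall k, D k x = z k.+1 x - z k x}.
  apply: filterS2 (integrable_ae measurableT inth)
    (ae_foralln (fun k => L2reprB (u (s k.+1)) (u (s k)))) => x hx Dx.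
  by split; [exact: hx|exact: Dx].
have good x : ~ Z x -> h x \is a fin_num /\ forall k, D k x = z k.+1 x - z k x.
  by move=> nZ; apply: contrapT => /HZ.
pose c x := Num.sqrt (fine (h x)).
have c0 x : 0 <= c x by exact: sqrtr_ge0.
have Dc k x : ~ Z x -> normc (D k x) <= c x * q k.
  move=> /good[hx _].
  rewrite -ler_sqr ?nnegrE ?normc_ge0 ?mulr_ge0 ?c0 ?(ltW (q_gt0 _))//.
  rewrite exprMn sqr_sqrtr ?fine_ge0// -ler_pdivrMr ?exprn_gt0//.
  rewrite -lee_fin fineK// mulrC EFinM.
  have := @nneseries_lim_ge _ (a^~ x) xpredT 0 k.+1 (fun n _ _ => a0 n x).
  apply: le_trans; rewrite big_nat_recr//= leeDr//.
  by apply: sume_ge0 => i _; exact: a0.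
pose v k x := \1_(~` Z) x * z k x.
have mv k : cmeasurable (v k).
  by apply: cmeasurableM => //; apply: cmeasurable_indic; exact: measurableC.
have vE k x : ~ Z x -> v k x = z k x.
  by move=> nZ; rewrite /v indicE mem_set// mul1r.
have v0 k x : Z x -> v k x = 0.
  by move=> Zx; rewrite /v indicE memNset ?mul0r//; apply.
have vv k m x : (k <= m)%N -> normc (v m x - v k x) <= c x * 2 * q k.
  move=> km; have [Zx|nZ] := pselect (Z x).
    by rewrite !v0// subrr Normc.normc0 !mulr_ge0// ltW.
  suff : normc (v m x - v k x) <= c x * 2 * q k - c x * 2 * q m.
    by move=> /le_trans; apply; rewrite gerBl !mulr_ge0// ltW.
  rewrite -(subnK km); elim: (m - k)%N => [|n ih']; first by rewrite add0n !subrr Normc.normc0.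
  rewrite addSn -(subrK (v (n + k)%N x) (v (n + k).+1 x)) -addrA.
  apply: le_trans (le_normcD _ _) _; have [_ /(_ (n + k)%N) e] := good _ nZ.
  have := Dc (n + k)%N _ nZ; rewrite e !vE// in ih' *.
  by rewrite qS => *; lra.
have vre k m x : (k <= m)%N -> `|complex.Re (v m x) - complex.Re (v k x)| <= c x * 2 * q k.
  move=> /(vv _ _ x); apply: le_trans.
  have := normc_ge_Re (v m x - v k x); rewrite normrE lecR.
  by case: (v m x) (v k x) => ? ? [].
have vim k m x : (k <= m)%N -> `|complex.Im (v m x) - complex.Im (v k x)| <= c x * 2 * q k.
  move=> /(vv _ _ x); apply: le_trans.
  rewrite -ler_sqr ?nnegrE ?normc_ge0// normc_sqr real_normK ?num_real//.
  by case: (v m x) (v k x) => ? ? [? ?] /=; rewrite lerDr sqr_ge0.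
have c20 x : 0 <= c x * 2 by rewrite mulr_ge0.
have cre x := geometric_cvg (c20 x) (fun k m => @vre k m x).
have cim x := geometric_cvg (c20 x) (fun k m => @vim k m x).
pose f x := limn (fun k => complex.Re (v k x)) +i* limn (fun k => complex.Im (v k x)).
have mf : cmeasurable f.
  split.
  - by apply: (measurable_fun_cvg (fun k => (mv k).1)) => x _; exact: cre.
  - by apply: (measurable_fun_cvg (fun k => (mv k).2)) => x _; exact: cim.
have dist_lim (r : nat -> R) k (C : R) : cvgn r ->
    (forall m, (k <= m)%N -> `|r m - r k| <= C) -> `|limn r - r k| <= C.
  move=> cr rC; rewrite ler_distl; apply/andP; split.
    by apply: limr_ge => //; exists k => // m /rC /=; rewrite ler_distl => /andP[].
  by apply: limr_le => //; exists k => // m /rC /=; rewrite ler_distl => /andP[].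
have fv k x : normc (f x - v k x) ^+ 2 <= 8 * q k ^+ 2 * fine (h x).
  have h1 := dist_lim _ k _ (cre x) (fun m => @vre k m x).
  have h2 := dist_lim _ k _ (cim x) (fun m => @vim k m x).
  have -> : 8 * q k ^+ 2 * fine (h x) = (c x * 2 * q k) ^+ 2 + (c x * 2 * q k) ^+ 2.
    by rewrite !exprMn sqr_sqrtr ?fine_ge0//; ring.
  rewrite normc_sqr lerD//.
  - rewrite -[leLHS]real_normK ?num_real// lerXn2r ?nnegrE ?normr_ge0 ?mulr_ge0 ?(ltW (q_gt0 _))//.
    by move: h1; rewrite /f; case: (v k x).
  - rewrite -[leLHS]real_normK ?num_real// lerXn2r ?nnegrE ?normr_ge0 ?mulr_ge0 ?(ltW (q_gt0 _))//.
    by move: h2; rewrite /f; case: (v k x).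
have mfv k : cmeasurable (fun x => f x - v k x).
  have := cmeasurableZD (-1) (mv k) mf; congr cmeasurable.
  by apply/funext => x; rewrite !fctE scaleN1r addrC.
have ifv k : (sqr_integral mu setT (fun x => (f x - v k x)%R) <= (8 * q k ^+ 2)%:E)%E.
  rewrite -[leRHS]mule1; apply: (@le_trans _ _ ((8 * q k ^+ 2)%:E * \int[mu]_x h x)%E); last first.
    by apply: lee_wpmul2l => //; rewrite lee_fin mulr_ge0 ?sqr_ge0.
  have q2 : 0 <= 8 * q k ^+ 2 by rewrite mulr_ge0 ?sqr_ge0.
  rewrite -ge0_integralZl_EFin//.
  apply: ae_ge0_le_integral => //.
  - by move=> x _; rewrite lee_fin sqr_ge0.
  - by apply/measurable_EFinP; exact: measurable_normc_sqr.
  - by move=> x _; rewrite mule_ge0// lee_fin.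
  - exact: measurable_funeM.
  - exists Z; split => // x; apply: contra_notP => /good[hx _] _.
    by rewrite -(fineK hx) -EFinM lee_fin.
have zv k : \forall x \ae mu, z k x = v k x.
  by exists Z; split => // x; apply: contra_notP => nZ /=; rewrite vE.
have Lfv k : sqr_integrable mu (fun x => f x - v k x).
  by split => //; apply: le_lt_trans (ifv k) (ltry _).
have Lv k : sqr_integrable mu (v k).
  split => //; rewrite -(ae_eq_sqr_integral measurableT (mz k) (mv k)).
    exact: (L2repr_sqr_integrable _).2.
  by apply: filterS (zv k).
have Lf : sqr_integrable mu f.
  have := sqr_integrableZD 1 (Lfv 0%N) (Lv 0%N); congr (sqr_integrable mu).
  by apply/funext => x; rewrite !fctE scale1r subrK.
pose l := toL2 mu f.
have ul k : hnorm L2dot (u (s k) - l) <= 4 * q k.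
  have -> : u (s k) - l = - toL2 mu (fun x => f x - v k x).
    apply: L2_eqP; rewrite -(scaleN1r (toL2 mu (fun x => f x - v k x))); near=> x.
    rewrite (near (L2reprB (u (s k)) l) x)//.
    rewrite (near (L2scaleE (-1) (toL2 mu (fun x => f x - v k x))) x)//.
    rewrite (near (toL2K (Lfv k)) x)// (near (toL2K Lf) x)//.
    by rewrite -/(z k x) (near (zv k) x)// mulN1r opprB.
  rewrite hnormN -ler_sqr ?nnegrE ?hnorm_ge0 ?mulr_ge0 ?(ltW (q_gt0 _))//.
  rewrite -lee_fin hnorm_toL2//; apply: le_trans (ifv k) _.
  by rewrite lee_fin exprMn ler_wpM2r ?sqr_ge0//; lra.
exists l; apply/cvgrPdist_lt => e e0.
have [k ke] := @q_small 5 e (ler0n _ _) e0.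
exists (s k) => // n /= skn; rewrite sub0r normrN ger0_norm ?hnorm_ge0//.
apply: le_lt_trans ke.
rewrite -(subrK (u (s k)) (u n)) -addrA; apply: le_trans (hnormD _ _ _) _.
have := ltW (HN k _ _ (leq_trans (Ns k) skn) (Ns k)); have := ul k.
have : q k ^+ 2 <= q k by rewrite expr2 ler_piMr ?q_le1// ltW.
by move=> *; lra.
Unshelve. all: by end_near. Qed.

Definition L2space : hilbertSpace R := HilbertSpace L2_complete.

End L2_complete.

(** * Coarse geometry: blocks and cells *)

Section coarse_facts.
Context {X : Type} (cs : coarseStructure X).
Implicit Types (E F : set (X * X)) (U V : set X).

Definition rcomp E F : set (X * X) :=
  [set xz | exists y, E (xz.1, y) /\ F (y, xz.2)].

Lemma controlled_rcomp E F :
  controlled cs E -> controlled cs F -> controlled cs (rcomp E F).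
Proof. exact: controlled_comp. Qed.

Lemma coarse_boundedS U V : U `<=` V -> coarse_bounded cs V -> coarse_bounded cs U.
Proof.
by move=> UV; apply: controlled_subset => -[x y] [/= /UV ? /UV ?].
Qed.

Lemma coarse_bounded0 : coarse_bounded cs set0.
Proof.
by apply: controlled_subset (controlled_diagonal cs) => -[x y] [].
Qed.

Lemma coarse_bounded_fibre E U :
  controlled cs E -> coarse_bounded cs U -> coarse_bounded cs (fibre E U).
Proof.
move=> cE bU; apply: controlled_subset
  (controlled_rcomp (controlled_rcomp cE bU) (controlled_inverse cE)).
move=> -[y y'] [/= [x Ux Exy] [x' Ux' Exy']].
by exists x'; split => //; exists x.
Qed.

Lemma coarse_bounded1 x : coarse_bounded cs [set x].
Proof.
by apply: controlled_subset (controlled_diagonal cs) => -[y z] [/= -> ->].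
Qed.

Hypothesis connected : coarse_connected cs.

Lemma controlled_setX U V :
  coarse_bounded cs U -> coarse_bounded cs V -> controlled cs (U `*` V).
Proof.
move=> bU bV; have [[u Uu]|/nonemptyPn U0] := pselect (U !=set0); last first.
  by apply: controlled_subset bU => -[x y]; rewrite U0 => -[].
have [[v Vv]|/nonemptyPn V0] := pselect (V !=set0); last first.
  by apply: controlled_subset bU => -[x y]; rewrite V0 => -[].
apply: controlled_subset
  (controlled_rcomp (controlled_rcomp bU (connected u v)) bV).
by move=> -[x y] [/= Ux Vy]; exists v; split => //; exists u.
Qed.

Lemma coarse_boundedU U V :
  coarse_bounded cs U -> coarse_bounded cs V -> coarse_bounded cs (U `|` V).
Proof.
move=> bU bV; have bUV := controlled_setX bU bV.
have bVU := controlled_setX bV bU.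
apply: controlled_subset
  (controlled_setU (controlled_setU bU bV) (controlled_setU bUV bVU)).
by move=> -[x y] [/= [?|?] [?|?]]; [left; left|right; left|right; right|left; right].
Qed.

Lemma coarse_bounded_bigcup (I : choiceType) (D : set I) (U : I -> set X) :
  finite_set D -> (forall i, D i -> coarse_bounded cs (U i)) ->
  coarse_bounded cs (\bigcup_(i in D) U i).
Proof.
move=> fD bU; rewrite -bigsetU_fset_set// big_seq.
apply: big_ind => [||i]; [exact: coarse_bounded0|exact: coarse_boundedU|].
by rewrite in_fset_set// inE; exact: bU.
Qed.

End coarse_facts.

Lemma bounded_size_finite (T : choiceType) (A : set T) (N : nat) :
  (forall s : seq T, uniq s -> (forall x, x \in s -> A x) -> (size s <= N)%N) ->
  finite_set A.
Proof.
move=> AN; apply: contrapT => /(infinite_set_fset N.+1)[B BA].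
by rewrite ltnNge AN// => x xB; exact: BA.
Qed.

Lemma countable_enumeration (T : Type) (A : set T) (B : nat -> set T) :
  (forall n, finite_set (A `&` B n)) -> A `<=` \bigcup_n B n -> countable A.
Proof.
move=> fAB BT; rewrite (_ : A = \bigcup_n (A `&` B n)).
  by apply: bigcup_countable => // n _; exact: finite_set_countable.
by rewrite -setI_bigcupr; apply/esym/setIidPl.
Qed.

(** A countable disjoint family is enumerated along an injection of the family
into the integers, with empty sets at the indices that are not reached. *)
Lemma countable_trivIset_enum (T : Type) (A : set (set T)) :
  countable A -> trivIset A id ->
  exists V : nat -> set T, [/\ trivIset setT V,
    forall n, V n = set0 \/ A (V n) & forall U, A U -> exists n, V n = U].
Proof.
move=> /countable_injP[f finj] tA.
pose V n := \bigcup_(U in [set U | A U /\ f U = n]) U.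
have VE U : A U -> V (f U) = U.
  move=> AU; apply/seteqP; split => [x [W /= [AW fWU] Wx]|x Ux]; last by exists U.
  suff <- : W = U by [].
  by apply: finj => //; rewrite inE.
exists V; split.
- move=> m n _ _ [x [[U [/= AU fU] Ux] [W [/= AW fW] Wx]]].
  by rewrite -fU -fW (tA U W)//; exists x.
- move=> n; have [[U [AU fU]]|nU] := pselect (exists U, A U /\ f U = n).
    by right; rewrite -fU VE.
  left; apply/seteqP; split => // x [U /= [AU fU] Ux].
  by apply: nU; exists U.
- by move=> U AU; exists (f U); exact: VE.
Qed.

Section measured_coarse_space.
Context {R : realType} {d : measure_display} {X : measurableType d}.
Variables (cs : coarseStructure X) (mu : {measure set X -> \bar R}).
Implicit Types (E F : set (X * X)) (U V : set X).

Hypothesis ub : uniformly_bounded cs mu.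

Lemma bounded_fin U : measurable U -> coarse_bounded cs U -> (mu U < +oo)%E.
Proof.
move=> mU bU; have [C C0 UC] := ub bU.
exact: le_lt_trans (UC _ mU (@subset_refl _ _)) (ltry _).
Qed.

(** Disjoint sets of measure at least [eps] inside one bounded set of measure
at most [C] are at most [C / eps] many. *)
Lemma disjoint_family_size E (eps : R) : controlled cs E -> 0 < eps ->
  exists N : nat, forall (I : choiceType) (V : I -> set X) (s : seq I),
    uniq s -> (forall i, i \in s -> measurable (V i) /\ (eps%:E <= mu (V i))%E) ->
    (forall i j, i \in s -> j \in s -> V i `*` V j `<=` E) ->
    trivIset [set` s] V -> (size s <= N)%N.
Proof.
move=> cE eps0; have [C C0 EC] := ub cE.
exists (Num.truncn (C / eps)) => I V s us mV VE tV.
have mS : measurable (\bigcup_(i in [set` s]) V i).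
  by apply: fin_bigcup_measurable => // i /mV[].
have := EC _ mS; rewrite measure_fin_bigcup//; last by move=> i /mV[].
have SE : (\bigcup_(i in [set` s]) V i) `*` (\bigcup_(i in [set` s]) V i) `<=` E.
  by move=> [x y] [/= [i si Vx] [j sj Vy]]; apply: (VE i j).
move=> /(_ SE).
rewrite -fsbig_seq// => h.
have {}h : (((size s)%:R * eps)%:E <= C%:E)%E.
  apply: le_trans h; have {}VE i : i \in s -> (eps%:E <= mu (V i))%E by case/mV.
  elim: s VE {us mV tV mS SE} => [|i s IH] VE; first by rewrite mul0r big_nil.
  rewrite big_cons /= -add1n natrD mulrDl mul1r EFinD leeD//.
    by apply: VE; rewrite mem_head.
  by apply: IH => j js; apply: VE; rewrite inE js orbT.
rewrite -ltnS -(ltr_nat R); apply: le_lt_trans (truncnS_gt _).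
by rewrite ler_pdivlMr.
Qed.

Hypothesis covered : countably_covered cs.

(** The blocks that meet a bounded set are jointly bounded, hence finitely many. *)
Lemma countable_block_collection E (eps : R) (A : set (set X)) :
  controlled cs E -> 0 < eps -> block_collection mu E eps A -> countable A.
Proof.
move=> cE eps0 [tA bA]; have [B [bB BT]] := covered.
pose M n := [set U : set X | (U `&` B n) !=set0].
have A0 U : A U -> U !=set0.
  move=> /bA[_ _ h]; apply/set0P/eqP => U0.
  by move: h; rewrite U0 measure0 lee_fin leNgt eps0.
apply: (@countable_enumeration _ A M) => [n|U /A0[x Ux]]; last first.
  have [n _ Bx] : (\bigcup_n B n) x by rewrite BT.
  by exists n => //; exists x.
have [N HN] := disjoint_family_size
  (controlled_rcomp (controlled_rcomp cE (bB n)) cE) eps0.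
apply: (@bounded_size_finite _ _ N) => s us sAM.
apply: (HN (set X) id) => //.
- by move=> U /sAM[/bA[]].
- move=> U V /sAM[/bA[_ UE _] [u [Uu Bu]]] /sAM[/bA[_ VE _] [v [Vv Bv]]].
  move=> [x y] [/= Ux Vy]; exists v; split; last exact: VE.
  by exists u; split => //; apply: UE.
- by move=> U V /sAM[AU _] /sAM[AV _]; exact: tA.
Qed.

Variable F : set (X * X).
Hypothesis gF : gordo cs mu F.
Hypothesis m1 : forall x : X, measurable [set x].
Hypothesis connected : coarse_connected cs.

(** Take a maximal set of centres whose [F]-fibres are pairwise disjoint.  It is
countable because a bounded set contains finitely many centres, and infinite
because the [F o F]-fibres of the centres cover the unbounded space.  The cell
of a centre is its [F]-fibre together with those points of its [F o F]-fibre
that are in no [F]-fibre and in no earlier [F o F]-fibre. *)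
Lemma measured_partition : ~ coarse_bounded cs [set: X] ->
  exists P : nat -> set X, exists G (c C : R),
    [/\ controlled cs G, 0 < c, trivIset setT P, \bigcup_i P i = setT &
      forall i, [/\ measurable (P i), P i `*` P i `<=` G,
        (c%:E <= mu (P i))%E & (mu (P i) <= C%:E)%E]].
Proof.
move=> unb; have [cF Fsym mF Fpos] := gF.
pose B x := fibre F [set x].
have BE x y : B x y = F (y, x).
  by apply/propext; split => [[z /= -> //]|Fyx]; exists x.
have FC x y : F (x, y) -> F (y, x) by rewrite {1}Fsym.
have mB x : measurable (B x) by apply: mF; exact: m1.
have [c c0 cB] : exists2 c : R, 0 < c & forall x, (c%:E <= mu (B x))%E.
  have : forall x, (ereal_inf [set mu (fibre F [set x]) | x in [set: X]] <= mu (B x))%E.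
    by move=> x; apply: ereal_inf_lbound; exists x.
  move: Fpos; case: (ereal_inf _) => [r|_ h|]//.
  - by rewrite lte_fin => r0 h; exists r.
  - by exists 1 => // x; apply: le_trans (h x); rewrite leey.
have B0 x : B x !=set0.
  apply/set0P/eqP => Bx; have := cB x.
  by rewrite Bx measure0 lee_fin leNgt c0.
have [D [_ tD maxD]] := ex_maximal_disjoint_subcollection B setT.
pose B2 x := fibre F (B x).
have mB2 x : measurable (B2 x) by exact: mF.
have coverD : \bigcup_(x in D) B2 x = setT.
  apply/seteqP; split => // x _.
  suff [y Dy [z [Bxz Byz]]] : exists2 y, D y & (B x `&` B y) !=set0.
    exists y => //; exists z => //; apply: FC.
    by rewrite BE in Bxz.
  have [Dx|nDx] := pselect (D x).
    by exists x => //; rewrite setIid.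
  apply: contrapT => nex; apply: (maxD (D `|` [set x])) => //.
    by split; [left|move=> h; apply: nDx; apply: h; right].
  move=> y z [Dy|->] [Dz|->]; first exact: tD.
  - by rewrite setIC => h; exfalso; apply: nex; exists y.
  - by move=> h; exfalso; apply: nex; exists z.
  - by [].
have [K [bK KT]] := covered.
have bB x : coarse_bounded cs (B x).
  by apply: coarse_bounded_fibre => //; exact: coarse_bounded1.
have bB2 x : coarse_bounded cs (B2 x) by exact: coarse_bounded_fibre.
have cD : countable D.
  apply: (@countable_enumeration _ D K) => [n|]; last by rewrite KT.
  have [N HN] := disjoint_family_size
    (controlled_rcomp (controlled_rcomp cF (bK n)) cF) c0.
  apply: (@bounded_size_finite _ _ N) => s us sDK.
  apply: (HN X B) => //.
  - move=> x y /sDK[_ Kx] /sDK[_ Ky] [a b] [/=]; rewrite !BE => Fax Fby.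
    by exists y; split; [exists x|exact: FC].
  - by move=> x y /sDK[Dx _] /sDK[Dy _]; exact: tD.
have iD : infinite_set D.
  move=> fD; apply: unb; rewrite -coverD.
  by apply: coarse_bounded_bigcup.
have /card_set_bijP[f [fD finj fsurj]] : (D #= [set: nat])%card.
  rewrite card_eq_le; apply/andP; split => //.
  exact/infiniteP.
have /choice[x xP] : forall i, exists x, D x /\ f x = i.
  by move=> i; have [y Dy fy] := fsurj i I; exists y.
have xinj i j : x i = x j -> i = j.
  by move=> xij; rewrite -(xP i).2 -(xP j).2 xij.
have xsurj y : D y -> exists i, x i = y.
  move=> Dy; exists (f y); apply: finj; rewrite ?inE//.
    exact: (xP _).1.
  exact: (xP _).2.
pose U := \bigcup_i B (x i).
have mU : measurable U by exact: bigcup_measurable.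
(* Removing [U] keeps the fibres of the other centres out of the cell of [x i]. *)
pose P i := B (x i) `|` (B2 (x i) `\` (U `|` \big[setU/set0]_(j < i) B2 (x j))).
have mP i : measurable (P i).
  apply: measurableU => //; apply: measurableD => //.
  by apply: measurableU => //; exact: bigsetU_measurable.
pose F2 := F `|` rcomp F F.
have cF2 : controlled cs F2.
  by apply: controlled_setU => //; exact: controlled_rcomp.
have PF2 i y : P i y -> F2 (y, x i).
  case=> [|[]]; first by rewrite BE; left.
  by move=> [z]; rewrite BE => Fzx Fyz _; right; exists z.
have cG := controlled_rcomp cF2 (controlled_inverse cF2).
have PG i : P i `*` P i `<=` rcomp F2 (F2^-1)%relation.
  by move=> [y z] [/= /PF2 Py /PF2 Pz]; exists (x i).
have [C C0 GC] := ub cG.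
exists P, (rcomp F2 (F2^-1)%relation), c, C; split => //; last first.
- move=> i; split => //; last exact: GC.
  by apply: le_trans (cB (x i)) _; apply: le_measure; rewrite ?inE//; left.
- apply/seteqP; split => // y _.
  have [[i _ By]|nUy] := pselect (U y); first by exists i => //; left.
  have ex2 : exists i, `[< B2 (x i) y >].
    have [z Dz Bz] : (\bigcup_(x in D) B2 x) y by rewrite coverD.
    by have [i xi] := xsurj _ Dz; exists i; apply/asboolP; rewrite xi.
  case: (ex_minnP ex2) => i /asboolP B2i mini.
  exists i => //; right; split => // -[//|].
  rewrite -(bigcup_mkord i (fun j => B2 (x j))) => -[j /= ji B2j].
  by have := mini j; rewrite leqNgt ji => h; have := h (asboolT B2j).
- move=> i j _ _ [y [Pi Pj]].
  have key i' j' : B (x i') y -> P j' y -> i' = j'.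
    move=> Bi [Bj|[_ []]]; last by left; exists i'.
    by apply: xinj; apply: tD; [exact: (xP _).1|exact: (xP _).1|exists y].
  case: (Pi) => [Bi|[B2i nUi]]; first exact: key.
  case: (Pj) => [Bj|[B2j nUj]]; first exact/esym/(key _ _ Bj Pi).
  apply: contrapT => /eqP; rewrite neq_ltn => /orP[ij|ji].
    by apply: nUj; right; rewrite -(bigcup_mkord j (fun i => B2 (x i))); exists i.
  by apply: nUi; right; rewrite -(bigcup_mkord i (fun i => B2 (x i))); exists j.
Qed.

End measured_coarse_space.

Section partition_hull.
Context {R : realType} {d : measure_display} {X : measurableType d}.
Variables (cs : coarseStructure X).
Variables (P : nat -> set X) (G : set (X * X)).
Hypotheses (cG : controlled cs G) (mP : forall i, measurable (P i)).
Hypotheses (PT : \bigcup_i P i = setT) (PG : forall i, P i `*` P i `<=` G).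

Let memP x : exists i, P i x.
Proof.
have [i _ Pi] : (\bigcup_i P i) x by rewrite PT.
by exists i.
Qed.

(** The union of the rectangles [P i * P j] that meet [E] or the diagonal is
measurable because there are countably many of them. *)
Lemma measurable_hull E : controlled cs E ->
  exists E', [/\ controlled cs E', measurable_rel E', E `<=` E' &
    forall i, P i `*` P i `<=` E'].
Proof.
move=> cE; pose meets i j := exists x y, [/\ P i x, P j y & (E `|` diagonal) (x, y)].
exists [set z | exists i j, [/\ P i z.1, P j z.2 & meets i j]]; split.
- have cED := controlled_setU cE (controlled_diagonal cs).
  apply: controlled_subset (controlled_rcomp (controlled_rcomp cG cED) cG).
  move=> [x y] [i [j [/= Px Py [x' [y' [Px' Py' Exy]]]]]].
  exists y'; split; last exact: (@PG j).
  by exists x'; split => //; exact: (@PG i).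
- move=> U mU; rewrite (_ : fibre _ _ =
    \bigcup_(i in [set i | exists j, (U `&` P j) !=set0 /\ meets i j]) P i).
    by apply: bigcup_measurable.
  apply/seteqP; split => [y [x Ux [i [j [/= Pi Pj mij]]]]|y [i [j [[x [Ux Px]] mij]] Py]].
    by exists i => //; exists j; split => //; exists x.
  by exists x => //; exists i, j.
- move=> [x y] Exy; have [i Pi] := memP x; have [j Pj] := memP y.
  by exists i, j; split => //; exists x, y; split => //; left.
- move=> i [x y] [/= Px Py]; exists i, i; split => //.
  by exists x, x; split => //; right.
Qed.

End partition_hull.

(** * Averaging over blocks *)

Local Ltac ae_rewrite h x := rewrite (near h x); last by [].

Section indicator_vectors.
Context {R : realType} {d : measure_display} {X : measurableType d}.
Variable mu : {measure set X -> \bar R}.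
Local Notation L2 := (L2 mu).
Local Notation L2dot := (@L2dot R d X mu).
Implicit Types (U V : set X) (u v : L2).

Definition ind U : L2 := toL2 mu (\1_U : X -> R[i]).

Lemma indic_setI U V x : \1_(U `&` V) x = \1_U x * \1_V x :> R[i].
Proof. by rewrite !indicE in_setI -natrM mulnb. Qed.

Lemma sqr_integrable_ind U : measurable U -> (mu U < +oo)%E ->
  sqr_integrable mu (\1_U : X -> R[i]).
Proof.
move=> mU fU; have := sqr_integrable_indic 1 mU fU.
by congr sqr_integrable; apply/funext => x; rewrite mul1r.
Qed.

Lemma indE U : measurable U -> (mu U < +oo)%E ->
  \forall x \ae mu, L2repr (ind U) x = \1_U x.
Proof. by move=> mU fU; apply: toL2K; exact: sqr_integrable_ind. Qed.

Lemma hnorm_ind U : measurable U -> (mu U < +oo)%E ->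
  hnorm L2dot (ind U) ^+ 2 = fine (mu U).
Proof.
move=> mU fU; apply: EFin_inj; rewrite hnorm_toL2; last exact: sqr_integrable_ind.
rewrite fineK ?ge0_fin_numE//; have := sqr_integral_indic mu 1 mU.
rewrite Normc.normc1 expr1n mul1e => <-; apply: eq_integral => x _.
by rewrite mul1r.
Qed.

Lemma L2dot_ind U : measurable U -> (mu U < +oo)%E ->
  L2dot (ind U) (ind U) = (fine (mu U))%:C.
Proof. by move=> mU fU; rewrite (form_self L2dot) hnorm_ind. Qed.

Lemma multop_ind U V : measurable U -> measurable V -> (mu V < +oo)%E ->
  multop \1_U (ind V) = ind (U `&` V).
Proof.
move=> mU mV fV; have mUV : measurable (U `&` V) by exact: measurableI.
have fUV : (mu (U `&` V) < +oo)%E.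
  by apply: le_lt_trans fV; apply: le_measure; rewrite ?inE//; exact: subIsetr.
apply: L2_eqP; near=> x.
ae_rewrite (multopE (ind V) (Linfty_indic mu mU)) x.
ae_rewrite (indE mV fV) x. ae_rewrite (indE mUV fUV) x.
by rewrite indic_setI.
Unshelve. all: by end_near. Qed.

Lemma multop_indic_adj U u v : measurable U ->
  L2dot (multop \1_U u) v = L2dot u (multop \1_U v).
Proof.
move=> mU; rewrite (multop_adjoint (Linfty_indic mu mU)); congr L2dot.
congr multop; apply/funext => x; rewrite indicE.
by case: (_ \in _); rewrite ?rmorph1 ?rmorph0.
Qed.

Lemma L2dot_restrict u U : measurable U -> (mu U < +oo)%E ->
  L2dot u (ind U) = L2dot (multop \1_U u) (ind U).
Proof.
by move=> mU fU; rewrite (multop_indic_adj u (ind U) mU) (multop_ind mU mU fU) setIid.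
Qed.

Lemma sqr_integral_restrict u U : measurable U ->
  sqr_integral mu U (L2repr u) = (hnorm L2dot (multop \1_U u) ^+ 2)%:E.
Proof.
move=> mU; rewrite -sqr_integral_L2repr.
rewrite (@ae_eq_sqr_integral _ _ _ _ _ (L2repr (multop \1_U u))
   (fun x => \1_U x * L2repr u x))//; last 3 first.
- exact: (L2repr_sqr_integrable _).1.
- apply: cmeasurableM; first exact: cmeasurable_indic.
  exact: (L2repr_sqr_integrable _).1.
- by apply: filterS (multopE u (Linfty_indic mu mU)).
rewrite /sqr_integral integral_mkcond; apply: eq_integral => x _.
rewrite patchE indicE; case: (_ \in _); first by rewrite mul1r.
by rewrite mul0r Normc.normc0 expr0n.
Qed.

Lemma ind_set0 : ind set0 = 0.
Proof.
apply: (hnorm_eq0 (form := L2dot)); apply/eqP; rewrite -sqrf_eq0.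
by rewrite hnorm_ind ?measure0.
Qed.

End indicator_vectors.

Section averaging.
Context {R : realType} {d : measure_display} {X : measurableType d}.
Variables (cs : coarseStructure X) (mu : {measure set X -> \bar R}).
Local Notation L2 := (L2 mu).
Local Notation L2dot := (@L2dot R d X mu).
Local Notation ind := (ind mu).

Definition block (A : set (set X)) (x : X) : set X :=
  \bigcup_(U in [set U | A U /\ U x]) U.

Definition blocks_rel (A : set (set X)) : set (X * X) := \bigcup_(U in A) (U `*` U).

Definition blocks_union (A : set (set X)) : set X := \bigcup_(U in A) U.

(** Writing the integral over [V] as an inner product makes the mean value linear
and independent of the representative of [u]. *)
Definition mean_on (u : L2) (V : set X) : R[i] :=
  L2dot u (ind V) / (fine (mu V))%:C.

Definition avgf (A : set (set X)) (u : L2) (x : X) : R[i] := mean_on u (block A x).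

(** The conditional expectation onto the functions that are constant on each
block and vanish outside of the blocks. *)
Definition avg (A : set (set X)) (u : L2) : L2 := toL2 mu (avgf A u).

Hypotheses (ub : uniformly_bounded cs mu) (covered : countably_covered cs).
Variables (E : set (X * X)) (eps : R) (A : set (set X)).
Hypotheses (cE : controlled cs E) (eps0 : 0 < eps).
Hypothesis bA : block_collection mu E eps A.

Let mA U : A U -> measurable U.
Proof. by case: bA => _ /(_ U) h /h[]. Qed.

Let AE U : A U -> U `*` U `<=` E.
Proof. by case: bA => _ /(_ U) h /h[]. Qed.

Let fA U : A U -> (mu U < +oo)%E.
Proof.
move=> AU; apply: (bounded_fin ub (mA AU)).
exact: controlled_subset (AE AU) cE.
Qed.

Let Apos U : A U -> 0 < fine (mu U).
Proof.
move=> AU; case: bA => _ /(_ U AU)[_ _ h].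
by rewrite fine_gt0// fA// andbT (lt_le_trans _ h)// lte_fin.
Qed.

Let tA U V x : A U -> A V -> U x -> V x -> U = V.
Proof. by case: bA => t _ AU AV Ux Vx; apply: t => //; exists x. Qed.

Lemma block_in U x : A U -> U x -> block A x = U.
Proof.
move=> AU Ux; apply/seteqP; split => [y [V [/= AV Vx] Vy]|y Uy]; last by exists U.
by rewrite (tA AU AV Ux Vx).
Qed.

Lemma block_out x : ~ blocks_union A x -> block A x = set0.
Proof.
move=> nAx; apply/seteqP; split => // y [V [/= AV Vx] _].
by apply: nAx; exists V.
Qed.

Lemma avgf_in u U x : A U -> U x -> avgf A u x = mean_on u U.
Proof. by move=> AU Ux; rewrite /avgf (block_in AU Ux). Qed.

Lemma avgf_out u x : ~ blocks_union A x -> avgf A u x = 0.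
Proof.
by move=> nAx; rewrite /avgf block_out// /mean_on ind_set0 (linear0r L2dot) mul0r.
Qed.

Lemma mean_onZD a u v U : mean_on (a *: u + v) U = a * mean_on u U + mean_on v U.
Proof.
by rewrite /mean_on (linearDl L2dot) (linearZl_LR L2dot) mulrDl mulrA.
Qed.

Let enumA : exists V : nat -> set X, [/\ trivIset setT V,
    forall n, V n = set0 \/ A (V n) & forall U, A U -> exists n, V n = U].
Proof.
apply: countable_trivIset_enum; last exact: bA.1.
exact: (countable_block_collection ub covered cE eps0 bA).
Qed.

Lemma measurable_blocks (B : set (set X)) : B `<=` A ->
  measurable (\bigcup_(U in B) U).
Proof.
move=> BA; have [V [_ VA AV]] := enumA.
rewrite (_ : \bigcup_(U in B) U = \bigcup_(n in [set n | B (V n)]) V n).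
  apply: bigcup_measurable => n _.
  by have [->|/mA] := VA n.
apply/seteqP; split => [x [U BU Ux]|x [n /= Bn Vx]]; last by exists (V n).
by have [n Vn] := AV _ (BA _ BU); exists n; rewrite /= Vn.
Qed.

Lemma measurable_blocks_union : measurable (blocks_union A).
Proof. exact: measurable_blocks. Qed.

Lemma fibre_blocks U :
  fibre (blocks_rel A) U = \bigcup_(V in [set V | A V /\ (V `&` U) !=set0]) V.
Proof.
apply/seteqP; split.
  by move=> y [x Ux [V AV [/= Vy Vx]]]; exists V => //=; split => //; exists x.
by move=> y [V [/= AV [x [Vx Ux]]] Vy]; exists x => //; exists V.
Qed.

Lemma measurable_blocks_rel : measurable_rel (blocks_rel A).
Proof. by move=> U mU; rewrite fibre_blocks; apply: measurable_blocks => V []. Qed.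

Lemma controlled_blocks_rel : controlled cs (blocks_rel A).
Proof. by apply: controlled_subset cE => z [U AU]; exact: AE. Qed.

Lemma measurable_blockwise (g : X -> R) :
  (forall U x y, A U -> U x -> U y -> g x = g y) ->
  (forall x, ~ blocks_union A x -> g x = 0) -> measurable_fun setT g.
Proof.
move=> gc g0 _ Y mY; rewrite setTI.
have -> : g @^-1` Y = \bigcup_(U in [set U | A U /\ (U `&` g @^-1` Y) !=set0]) U
    `|` ((~` blocks_union A) `&` [set x | Y 0]).
  apply/seteqP; split => x /=.
    have [[U AU Ux]|nAx] := pselect (blocks_union A x) => Yx.
      by left; exists U => //=; split => //; exists x.
    by right; rewrite -(g0 _ nAx).
  move=> [[U [/= AU [y [Uy Yy]]] Ux]|[nAx Y0]]; first by rewrite (gc U x y).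
  by rewrite g0.
apply: measurableU; first by apply: measurable_blocks => U [].
apply: measurableI; first exact/measurableC/measurable_blocks_union.
have [Y0|nY0] := pselect (Y 0).
  by rewrite (_ : [set _ | Y 0] = setT)//; apply/seteqP; split.
by rewrite (_ : [set _ | Y 0] = set0)//; apply/seteqP; split.
Qed.

Lemma cmeasurable_avgf u : cmeasurable (avgf A u).
Proof.
split; apply: measurable_blockwise => [U x y AU Ux Uy|x nAx].
- by rewrite !(avgf_in u AU).
- by rewrite avgf_out.
- by rewrite !(avgf_in u AU).
- by rewrite avgf_out.
Qed.

Lemma normc_mean_on u U : A U ->
  normc (mean_on u U) ^+ 2 * fine (mu U) <= hnorm L2dot (multop \1_U u) ^+ 2.
Proof.
move=> AU; have : normc (L2dot (multop \1_U u) (ind U)) <=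
    hnorm L2dot (multop \1_U u) * hnorm L2dot (ind U) by exact: cauchy_schwarz.
rewrite -(L2dot_restrict u (mA AU) (fA AU)) => h.
have m0 := Apos AU; have m1 := hnorm_ind (mA AU) (fA AU).
rewrite /mean_on; move: (L2dot u (ind U)) h => z h.
rewrite (normc_div_real _ m0).
have {}h : normc z ^+ 2 <= hnorm L2dot (multop \1_U u) ^+ 2 * fine (mu U).
  by rewrite -m1 -exprMn lerXn2r ?nnegrE ?normc_ge0 ?mulr_ge0 ?hnorm_ge0.
rewrite exprMn exprVn -(@ler_pM2r _ (fine (mu U)))// (le_trans _ h)//.
move: (fine _) m0 => m m0; suff -> : normc z ^+ 2 / m ^+ 2 * m * m = normc z ^+ 2 by [].
by field; rewrite gt_eqF.
Qed.

(** On each block the mean value is controlled by the Cauchy-Schwarz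
inequality. *)
Lemma sqr_integral_avgf u :
  (sqr_integral mu setT (avgf A u) <= sqr_integral mu setT (L2repr u))%E.
Proof.
have [V [tV VA AV]] := enumA.
have mV n : measurable (V n) by have [->|/mA] := VA n.
have VAE : blocks_union A = \bigcup_n V n.
  apply/seteqP; split => [x [U AU Ux]|x [n _ Vx]].
    by have [n Vn] := AV _ AU; exists n; rewrite ?Vn.
  by exists (V n) => //; have [V0|//] := VA n; rewrite V0 in Vx.
have mf := measurable_normc_sqr (cmeasurable_avgf u).
have mu2 := measurable_normc_sqr (L2repr_sqr_integrable u).1.
apply: (@le_trans _ _ (sqr_integral mu (\bigcup_n V n) (avgf A u))).
  rewrite /sqr_integral [leRHS]integral_mkcond le_eqVlt; apply/orP; left; apply/eqP.
  apply: eq_integral => x _; rewrite patchE; case: ifPn => // /negP.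
  rewrite inE -VAE => nAx; rewrite avgf_out// Normc.normc0 expr0n//.
apply: (@le_trans _ _ (sqr_integral mu (\bigcup_n V n) (L2repr u))); last first.
  apply: ge0_subset_integral => //; first exact: bigcup_measurable.
    exact/measurable_EFinP.
  by move=> x _; rewrite lee_fin sqr_ge0.
rewrite /sqr_integral !ge0_integral_bigcup//; last 4 first.
- exact/measurable_funTS/measurable_EFinP.
- by move=> x _; rewrite lee_fin sqr_ge0.
- exact/measurable_funTS/measurable_EFinP.
- by move=> x _; rewrite lee_fin sqr_ge0.
apply: lee_nneseries => n _.
  by move=> _; apply: integral_ge0 => x _; rewrite lee_fin sqr_ge0.
have [->|An] := VA n; first by rewrite !integral_set0.
rewrite -/(sqr_integral mu (V n) (L2repr u)) sqr_integral_restrict//.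
rewrite (eq_integral (fun=> (normc (mean_on u (V n)) ^+ 2)%:E)); last first.
  by move=> x; rewrite inE => Vx; rewrite (avgf_in u An Vx).
rewrite integral_cst// -[mu (V n)]fineK ?ge0_fin_numE ?fA//.
by rewrite -EFinM lee_fin normc_mean_on.
Qed.

Lemma sqr_integrable_avgf u : sqr_integrable mu (avgf A u).
Proof.
split; first exact: cmeasurable_avgf.
by apply: le_lt_trans (sqr_integral_avgf u) _; exact: (L2repr_sqr_integrable u).2.
Qed.

Lemma avgE u : \forall x \ae mu, L2repr (avg A u) x = avgf A u x.
Proof. exact: toL2K (sqr_integrable_avgf u). Qed.

Lemma avg_contr u : hnorm L2dot (avg A u) <= hnorm L2dot u.
Proof.
rewrite -ler_sqr ?nnegrE ?hnorm_ge0// -lee_fin hnorm_toL2; last first.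
  exact: sqr_integrable_avgf.
by rewrite -sqr_integral_L2repr; exact: sqr_integral_avgf.
Qed.

Lemma avg_linear : linear (avg A).
Proof.
move=> a u v; rewrite /avg -toL2ZD//; do ?exact: sqr_integrable_avgf.
by congr toL2; apply/funext => x; exact: mean_onZD.
Qed.

Lemma avg_bounded : bounded_op L2dot (avg A).
Proof. by split; [exact: avg_linear|exists 1 => u; rewrite mul1r avg_contr]. Qed.

Lemma opnorm_avg : opnorm L2dot (avg A) <= 1.
Proof. by apply: opnorm_le => // u; rewrite mul1r avg_contr. Qed.

Lemma multop_avg U u : A U -> multop \1_U (avg A u) = mean_on u U *: ind U.
Proof.
move=> AU; apply: L2_eqP; near=> x.
ae_rewrite (multopE (avg A u) (Linfty_indic mu (mA AU))) x.
ae_rewrite (L2scaleE (mean_on u U) (ind U)) x. ae_rewrite (avgE u) x.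
ae_rewrite (indE (mA AU) (fA AU)) x. rewrite indicE.
have [/set_mem Ux|_] := boolP (x \in U); first by rewrite mul1r mulr1 (avgf_in u AU Ux).
by rewrite mul0r mulr0.
Unshelve. all: by end_near. Qed.

Lemma mean_on_avg U u : A U -> mean_on (avg A u) U = mean_on u U.
Proof.
move=> AU; rewrite {1}/mean_on (L2dot_restrict _ (mA AU) (fA AU)) multop_avg//.
rewrite (linearZl_LR L2dot) /= (L2dot_ind (mA AU) (fA AU)) mulfK//.
exact: gt0_complex_neq0 (Apos AU).
Qed.

Lemma avgf_avg u x : avgf A (avg A u) x = avgf A u x.
Proof.
have [[U AU Ux]|nAx] := pselect (blocks_union A x); last by rewrite !avgf_out.
by rewrite !(avgf_in _ AU Ux) mean_on_avg.
Qed.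

Lemma avg_idem u : avg A (avg A u) = avg A u.
Proof. by congr toL2; apply/funext => x; exact: avgf_avg. Qed.

Lemma avg_selfadjoint : is_adjoint L2dot (avg A) (avg A).
Proof.
exact: (contractive_idempotent_selfadjoint avg_linear avg_contr avg_idem).
Qed.

Lemma supported_on_avg : supported_on cs (blocks_rel A) (avg A).
Proof.
split; [exact: controlled_blocks_rel|exact: measurable_blocks_rel|].
move=> U xi eta mU xiU.
have mGU := measurable_blocks_rel mU.
apply: L2dotE.
  by apply: cmeasurableMJ; exact: (L2repr_sqr_integrable _).1.
near=> x; rewrite [in LHS](near (avgE eta) x); last by [].
rewrite [in RHS](near (avgE (L2restrict (fibre (blocks_rel A) U) eta)) x); last by [].
have [Ux|nUx] := pselect (U x); last first.
  by rewrite (_ : L2repr xi x = 0) ?mul0r//; apply: (near xiU x).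
have [[V AV Vx]|nAx] := pselect (blocks_union A x); last by rewrite !avgf_out.
rewrite !(avgf_in _ AV Vx) /mean_on /L2restrict.
rewrite (multop_indic_adj eta (ind V) mGU).
rewrite (multop_ind mGU (mA AV) (fA AV)) (_ : _ `&` V = V)//.
apply/setIidPr => y Vy; exists x => //; exists V => //.
Unshelve. all: by end_near. Qed.

Lemma avg_Ccs : Ccs cs (avg A).
Proof.
by split; [exact: avg_bounded|exists (blocks_rel A); exact: supported_on_avg].
Qed.

Lemma avg_in_blocks : in_blocks cs E eps (avg A).
Proof.
split; first exact: avg_Ccs.
by exists A; [exact: bA|exact: supported_on_avg].
Qed.

(** [avg A] restricts the indicator of a set [V] that no block crosses. *)
Lemma avg_ind V : measurable V -> (mu V < +oo)%E ->
  (forall U, A U -> (U `&` V) !=set0 -> U `<=` V) ->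
  avg A (ind V) = ind (V `&` blocks_union A).
Proof.
move=> mV fV UV; have mVA : measurable (V `&` blocks_union A).
  by apply: measurableI => //; exact: measurable_blocks_union.
have fVA : (mu (V `&` blocks_union A) < +oo)%E.
  by apply: le_lt_trans fV; apply: le_measure; rewrite ?inE//; exact: subIsetl.
apply: L2_eqP; near=> x.
ae_rewrite (avgE (ind V)) x. ae_rewrite (indE mVA fVA) x.
have [[U AU Ux]|nAx] := pselect (blocks_union A x); last first.
  by rewrite avgf_out// indicE memNset// => -[].
rewrite (avgf_in _ AU Ux) /mean_on.
rewrite (L2dot_restrict (ind V) (mA AU) (fA AU)) (multop_ind (mA AU) mV fV).
have [Vx|nVx] := pselect (V x).
  rewrite (_ : U `&` V = U); last first.
    by apply/setIidPl; apply: UV => //; exists x.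
  rewrite (L2dot_ind (mA AU) (fA AU)) divff ?gt0_complex_neq0 ?Apos//.
  by rewrite indicE mem_set//; split => //; exists U.
rewrite (_ : U `&` V = set0) ?ind_set0 ?(linear0l L2dot)//.
  by rewrite mul0r indicE memNset// => -[].
apply/seteqP; split => // y [Uy Vy]; apply: nVx.
by apply: (UV U) => //; exists y.
Unshelve. all: by end_near. Qed.

Lemma avg_neq0 : A !=set0 -> avg A <> (fun=> 0).
Proof.
move=> [U AU] a0.
have : avg A (ind U) = ind U.
  rewrite (avg_ind (mA AU) (fA AU)); last first.
    by move=> V AV [x [Vx Ux]]; rewrite (tA AV AU Vx Ux).
  by congr ind; apply/setIidPl => x Ux; exists U.
rewrite a0 => /esym e0; have := hnorm_ind (mA AU) (fA AU).
by rewrite e0 hnorm0 expr0n /= => /esym/eqP; rewrite gt_eqF ?Apos.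
Qed.

Lemma Linfty_blocks : Linfty mu (\1_(blocks_union A) : X -> R[i]).
Proof. exact/Linfty_indic/measurable_blocks_union. Qed.

(** For [xi] supported in a bounded set [U] only the blocks that meet [U] matter.
Their union [V] is bounded, so its indicator is square integrable and takes the
place of the constant function 1 in the self-adjointness of [avg A]. *)
Lemma avg_is_Phi : is_Phi cs (avg A) \1_(blocks_union A).
Proof.
have mU := measurable_blocks_union.
split.
  split=> [|U mU' bU]; first exact: cmeasurable_indic.
  apply: (@le_lt_trans _ _ (\int[mu]_(x in U) cst 1 x)%E).
    apply: ge0_le_integral => //.
    - by move=> x _; rewrite lee_fin sqr_ge0.
    - apply/measurable_funTS/measurable_EFinP/measurable_normc_sqr.
      exact: cmeasurable_indic.
    - move=> x _; rewrite lee_fin indicE.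
      by case: (_ \in _); rewrite ?Normc.normc1 ?Normc.normc0 ?expr1n ?expr0n.
  by rewrite integral_cst// mul1e; exact: (bounded_fin ub).
exists (avg A); first exact: avg_selfadjoint.
move=> U xi mU' bU xiU.
pose V := fibre (blocks_rel A) U.
have mV : measurable V by exact: measurable_blocks_rel.
have fV : (mu V < +oo)%E.
  apply: (bounded_fin ub mV); apply: coarse_bounded_fibre => //.
  exact: controlled_blocks_rel.
have VA : V `<=` blocks_union A.
  by rewrite /V fibre_blocks => x [W [AW _] Wx]; exists W.
have UV W : A W -> (W `&` V) !=set0 -> W `<=` V.
  rewrite /V fibre_blocks => AW [x [Wx [W' [AW' W'U] W'x]]].
  by move=> y Wy; exists W' => //; rewrite -(tA AW AW' Wx W'x).
have aV : avg A (ind V) = ind V.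
  by rewrite (avg_ind mV fV UV); congr ind; apply/setIidPl.
transitivity (L2dot (ind V) xi).
  apply/esym; apply: L2dotE.
    apply: cmeasurableMJ; first exact: cmeasurable_indic.
    exact: (L2repr_sqr_integrable _).1.
  near=> x; ae_rewrite (indE mV fV) x.
  have [Ux|nUx] := pselect (U x); last first.
    by rewrite (_ : L2repr xi x = 0) ?rmorph0 ?mulr0//; apply: (near xiU x).
  congr (_ * _); rewrite !indicE; congr (_%:R); congr nat_of_bool.
  apply/idP/idP; rewrite !inE; first exact: VA.
  by move=> [W AW Wx]; exists x => //; exists W.
rewrite -aV avg_selfadjoint; apply: L2dotE.
  apply: cmeasurableMJ; first exact: cmeasurable_cst.
  exact: (L2repr_sqr_integrable _).1.
near=> x; ae_rewrite (indE mV fV) x. ae_rewrite (avgE xi) x. rewrite /=.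
have [Vx|nVx] := pselect (V x); first by rewrite indicE mem_set.
rewrite indicE memNset// mul0r mul1r.
have [[W AW Wx]|nAx] := pselect (blocks_union A x); last by rewrite avgf_out// rmorph0.
rewrite (avgf_in _ AW Wx) /mean_on (L2dot_restrict _ (mA AW) (fA AW)).
rewrite (_ : multop \1_W xi = 0) ?(linear0l L2dot) ?mul0r ?rmorph0//.
have WU y : W y -> ~ U y.
  by move=> Wy Uy; apply: nVx; exists y => //; exists W.
apply: L2_eqP; near=> y; ae_rewrite (L2repr0 mu) y.
ae_rewrite (multopE xi (Linfty_indic mu (mA AW))) y. rewrite indicE.
have [/set_mem Wy|_] := boolP (y \in W); last by rewrite mul0r.
by rewrite mul1r (near xiU y)//; exact: WU.
Unshelve. all: by end_near. Qed.

(** Compressing by [avg A] replaces [f] by its mean values on the blocks. *)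
Lemma avg_mult_avg f u : Linfty mu f -> (forall U, A U -> cintegral mu U f = 0) ->
  avg A (multop f (avg A u)) = 0.
Proof.
move=> hf f0; apply: L2_eqP; near=> x.
ae_rewrite (avgE (multop f (avg A u))) x. ae_rewrite (L2repr0 mu) x.
have [[U AU Ux]|nAx] := pselect (blocks_union A x); last by rewrite avgf_out.
rewrite (avgf_in _ AU Ux) /mean_on (_ : L2dot _ _ = 0) ?mul0r//.
have mU := mA AU; have fU := fA AU.
have h1 : cmeasurable (fun x => f x * \1_U x).
  by apply: cmeasurableM; [exact: hf.1|exact: cmeasurable_indic].
have h2 : cintegral mu setT (fun x => f x * \1_U x) = 0.
  rewrite -(f0 _ AU) /cintegral [in RHS]Rintegral_mkcond; congr (_ +i* _).
  - apply: eq_Rintegral => y _; rewrite patchE indicE.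
    by case: (_ \in _); rewrite ?mulr1 ?mulr0.
  - rewrite [in RHS]Rintegral_mkcond; apply: eq_Rintegral => y _.
    by rewrite patchE indicE; case: (_ \in _); rewrite ?mulr1 ?mulr0.
have hU := Linfty_indic mu mU.
rewrite (L2dot_restrict _ mU fU) -[multop \1_U _]/((multop \1_U \o multop f) _).
rewrite multop_comp//; under eq_fun do rewrite mulrC.
rewrite -multop_comp//= multop_avg// (linZ (multop_linear hf)).
rewrite (linearZl_LR L2dot) /= (L2dotE (f := fun x => f x * \1_U x))//.
  by rewrite h2 mulr0.
near=> y; ae_rewrite (multopE (ind U) hf) y. ae_rewrite (indE mU fU) y.
by rewrite indicE; case: (_ \in _); rewrite ?rmorph1 ?rmorph0 ?mulr0 ?mulr1.
Unshelve. all: by end_near. Qed.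

End averaging.

(** * Vector states of representations *)

Section supported_operators.
Context {R : realType} {d : measure_display} {X : measurableType d}.
Variables (cs : coarseStructure X) (mu : {measure set X -> \bar R}).
Local Notation L2 := (L2 mu).
Local Notation L2dot := (@L2dot R d X mu).

Lemma form_inj (V : lmodType R[i]) (form : {dot V for conjC}) (u v : V) :
  (forall w, form w u = form w v) -> u = v.
Proof.
move=> uv; apply/eqP; rewrite -subr_eq0 -(dnorm_eq0 form).
by rewrite linearBr /= subr_eq0; apply/eqP; exact: uv.
Qed.

(** The defining property of supports, tested against all vectors at once. *)
Lemma supported_on_restrict E (T : L2 -> L2) U eta :
  supported_on cs E T -> measurable U ->
  multop \1_U (T eta) = multop \1_U (T (multop \1_(fibre E U) eta)).
Proof.
move=> [_ _ ET] mU; have hU := Linfty_indic mu mU.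
suff key xi : L2dot xi (multop \1_U (T eta)) =
    L2dot xi (multop \1_U (T (multop \1_(fibre E U) eta))).
  exact: (form_inj (form := L2dot)).
rewrite -(multop_indic_adj xi (T eta) mU).
rewrite -(multop_indic_adj xi (T (multop \1_(fibre E U) eta)) mU).
apply: ET => //; apply: filterS (multopE xi hU) => x -> nUx.
by rewrite indicE memNset// mul0r.
Qed.

Lemma Ccs_comp (S T : L2 -> L2) : Ccs cs S -> Ccs cs T -> Ccs cs (S \o T).
Proof.
move=> [[linS [M SM]] [E sE]] [[linT [N TN]] [F sF]]; split.
  split; first by move=> a u v /=; rewrite linT linS.
  exists (Num.max M 0 * N) => u /=; apply: le_trans (SM _) _.
  apply: (@le_trans _ _ (Num.max M 0 * hnorm L2dot (T u))).
    by rewrite ler_wpM2r ?hnorm_ge0// le_max lexx.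
  by rewrite -mulrA ler_wpM2l// le_max lexx orbT.
have [cE mE ES] := sE; have [cF mF _] := sF.
have FE U : fibre (rcomp F E) U = fibre F (fibre E U).
  apply/seteqP; split => [z [x Ux [y [/= Fzy Eyx]]]|z [y [x Ux Eyx] Fzy]].
    by exists y => //; exists x.
  by exists x => //; exists y.
exists (rcomp F E); split; first exact: controlled_rcomp.
  by move=> U mU; rewrite FE; apply: mF; exact: mE.
move=> U xi eta mU xiU /=.
rewrite (ES U xi (T eta) mU xiU) (ES U xi (T (L2restrict _ eta)) mU xiU) FE.
by rewrite /L2restrict (supported_on_restrict eta sF (mE _ mU)).
Qed.

End supported_operators.

Section vector_states.
Context {R : realType} {d : measure_display} {X : measurableType d}.
Variables (cs : coarseStructure X) (mu : {measure set X -> \bar R}).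
Local Notation L2 := (L2 mu).
Local Notation L2dot := (@L2dot R d X mu).
Variables (H : hilbertSpace R) (rho : (L2 -> L2) -> (H -> H)).
Hypothesis rep : representation cs rho.
Local Notation hn := (hnorm (hdot H)).
Implicit Types (f g : X -> R[i]) (v w : H).

Lemma multop_Ccs f : Linfty mu f -> Ccs cs (@multop _ _ _ mu f).
Proof.
move=> hf; split; first exact: multop_bounded.
have fD U : fibre diagonal U = U.
  apply/seteqP; split => [y [x Ux]|y Uy]; last by exists y.
  by rewrite /diagonal /= => ->.
exists diagonal; split; first exact: controlled_diagonal.
  by move=> U mU; rewrite fD.
move=> U xi eta mU xiU; rewrite fD /L2restrict.
have hU := Linfty_indic mu mU.
apply: L2dotE.
  by apply: cmeasurableMJ; exact: (L2repr_sqr_integrable _).1.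
near=> x.
have [Ux|nUx] := pselect (U x); last first.
  by rewrite (_ : L2repr xi x = 0) ?mul0r//; apply: (near xiU x).
rewrite [in LHS](near (multopE eta hf) x); last by [].
rewrite [in RHS](near (multopE (multop \1_U eta) hf) x); last by [].
rewrite [in RHS](near (multopE eta hU) x); last by [].
by rewrite indicE mem_set// mul1r.
Unshelve. all: by end_near. Qed.

Definition vector_state v f : R[i] := hdot H (rho (multop f) v) v.

Let rho_lin f : Linfty mu f -> linear (rho (multop f)).
Proof. by move=> hf; apply: (rep_bounded rep _).1; exact: multop_Ccs. Qed.

Lemma rep_multop_adjoint f g v w : Linfty mu f -> Linfty mu g ->
  hdot H (rho (multop g) (rho (multop f) v)) w =
  hdot H (rho (multop f) v) (rho (multop (fun x => conjC (g x))) w).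
Proof.
move=> hf hg; apply: (rep_adjoint rep); [exact: multop_Ccs|apply: multop_Ccs|].
  exact: LinftyJ.
exact: multop_adjoint.
Qed.

Lemma rep_multopM f g v : Linfty mu f -> Linfty mu g ->
  rho (multop f) (rho (multop g) v) = rho (multop (fun x => f x * g x)) v.
Proof.
move=> hf hg; rewrite -multop_comp// (rep_comp rep)//; exact: multop_Ccs.
Qed.

Lemma hnorm_rep_multop f v : Linfty mu f ->
  (hn (rho (multop f) v) ^+ 2)%:C = vector_state v (fun x => conjC (f x) * f x).
Proof.
move=> hf; have hJ := LinftyJ hf; rewrite -form_self /vector_state -rep_multopM//.
rewrite rep_multop_adjoint//; congr (hdot H _ (rho (multop _) _)).
by apply/funext => x; rewrite conjCK.
Qed.

Lemma Linfty_sqrt f : Linfty mu f ->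
  Linfty mu (fun x => (Num.sqrt (complex.Re (f x)))%:C).
Proof.
move=> [[mf1 mf2] [M fM]]; split.
  apply: cmeasurable_real; apply: measurableT_comp mf1.
  by apply: continuous_measurable_fun; exact: sqrt_continuous.
exists (Num.sqrt M); apply: filterS fM => x fx.
rewrite normc_real ?sqrtr_ge0// ler_wsqrtr//.
exact: le_trans (Re_le_normc _) fx.
Qed.

Lemma vector_state_ae v f g : Linfty mu f -> Linfty mu g ->
  (\forall x \ae mu, f x = g x) -> vector_state v f = vector_state v g.
Proof. by move=> hf hg fg; rewrite /vector_state (multop_ae hf hg fg). Qed.

Lemma vector_stateZD v a f g : Linfty mu f -> Linfty mu g ->
  vector_state v (a *: f + g) = a * vector_state v f + vector_state v g.
Proof.
move=> hf hg; rewrite /vector_state multopZD// (rep_linear rep); last 2 first.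
- exact: multop_Ccs.
- exact: multop_Ccs.
by rewrite (linearDl (hdot H)) (linearZl_LR (hdot H)).
Qed.

Lemma vector_stateZ v a f : Linfty mu f ->
  vector_state v (a *: f) = a * vector_state v f.
Proof.
move=> hf; have h0 := Linfty_cst mu 0.
have s0 : vector_state v (cst 0) = 0.
  have := vector_stateZD v (-1) h0 h0; rewrite mulN1r addNr => {2}<-.
  by congr vector_state; apply/funext => x; rewrite !fctE scaler0 addr0.
rewrite -[RHS]addr0 -s0 -vector_stateZD//.
by congr vector_state; apply/funext => x; rewrite !fctE addr0.
Qed.

(** A nonnegative [f] is [conj g * g] for [g = sqrt f]. *)
Lemma vector_state_ge0 v f : Linfty mu f -> (\forall x \ae mu, 0 <= f x) ->
  0 <= vector_state v f.
Proof.
move=> hf f0; have hs := Linfty_sqrt hf.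
rewrite (@vector_state_ae v f (fun x => conjC (Num.sqrt (complex.Re (f x)))%:C *
   (Num.sqrt (complex.Re (f x)))%:C))//.
- by rewrite -(hnorm_rep_multop v hs) ler0c sqr_ge0.
- by apply: LinftyM => //; exact: LinftyJ.
- apply: filterS f0 => x fx; rewrite {1}(ge0_complexE fx) mulrC mulcJ.
  rewrite normc_real ?sqrtr_ge0// sqr_sqrtr//.
  by move: fx; rewrite lecE => /andP[].
Qed.

Lemma vector_state1 v : hn v = 1 -> vector_state v (cst 1) = 1.
Proof.
by move=> v1; rewrite /vector_state multop1 (rep_id rep) form_self v1 expr1n.
Qed.

Lemma vector_state_mean v : hn v = 1 -> mean mu (vector_state v).
Proof.
move=> v1; split; [exact: vector_state_ae|exact: vector_stateZD|
  exact: vector_state_ge0|exact: vector_state1].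
Qed.

(** Representations are not assumed continuous; the bound comes from the positivity
of the state of [v] at the function [M ^ 2 - |f| ^ 2]. *)
Lemma rep_multop_le f M v : Linfty mu f -> 0 <= M ->
  (\forall x \ae mu, normc (f x) <= M) -> hn (rho (multop f) v) <= M * hn v.
Proof.
move=> hf M0 fM; rewrite -ler_sqr ?nnegrE ?mulr_ge0 ?hnorm_ge0// exprMn.
have hff : Linfty mu (fun x => conjC (f x) * f x).
  by apply: LinftyM => //; exact: LinftyJ.
have h1 := Linfty_cst mu 1.
pose c : R[i] := (M ^+ 2)%:C.
have hc : Linfty mu (c *: cst 1).
  have := Linfty_cst mu c; congr Linfty.
  by apply/funext => x; rewrite !fctE /GRing.scale/= mulr1.
have s1 : vector_state v (cst 1) = (hn v ^+ 2)%:C.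
  by rewrite /vector_state multop1 (rep_id rep) form_self.
have : 0 <= vector_state v (-1 *: (fun x => conjC (f x) * f x) + c *: cst 1).
  apply: vector_state_ge0; first exact: LinftyZD.
  apply: filterS fM => x fx.
  rewrite !fctE scaleN1r mulrC mulcJ addrC /GRing.scale/= mulr1 -rmorphB ler0c.
  by rewrite subr_ge0 lerXn2r ?nnegrE ?normc_ge0.
rewrite vector_stateZD// vector_stateZ// -(hnorm_rep_multop v hf) s1.
by rewrite mulN1r addrC -rmorphM -rmorphB ler0c subr_ge0.
Qed.

(** The state annihilates functions of mean zero on the blocks as soon as [v] is
almost fixed by the averaging operator: compressed by [avg A] they vanish. *)
Lemma vector_state_blocking (E : set (X * X)) (eps gamma : R) (A : set (set X)) v f M :
  uniformly_bounded cs mu -> countably_covered cs ->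
  controlled cs E -> 0 < eps -> block_collection mu E eps A -> hn v = 1 ->
  hn (rho (avg A) v - rho (multop \1_(blocks_union A)) v) <= gamma ->
  Linfty mu f -> 0 <= M -> (\forall x \ae mu, normc (f x) <= M) ->
  (forall U, A U -> cintegral mu U f = 0) ->
  (\forall x \ae mu, ~ blocks_union A x -> f x = 0) ->
  normc (vector_state v f) <= 2 * gamma * M.
Proof.
move=> ub cov cE eps0 bA v1 vg hf M0 fM fA0 fA.
have hchi := Linfty_blocks ub cov cE eps0 bA.
have aC := avg_Ccs ub cov cE eps0 bA.
have fC := multop_Ccs hf.
set chi : X -> R[i] := \1_(blocks_union A) in vg hchi.
pose p := rho (avg A) v; pose q := rho (multop chi) v.
pose T := rho (multop f).
have q1 : hn q <= 1.
  rewrite -v1 -[leRHS]mul1r; apply: rep_multop_le => //.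
  apply: aeW => x; rewrite /chi indicE.
  by case: (_ \in _); rewrite ?Normc.normc1 ?Normc.normc0.
have aa : is_adjoint (hdot H) (rho (avg A)) (rho (avg A)).
  by apply: (rep_adjoint rep) => //; exact: (avg_selfadjoint ub cov cE eps0 bA).
have pp : rho (avg A) p = p.
  have e : avg A \o avg A = avg A :> (L2 -> L2).
    by apply/funext => u; exact: (avg_idem ub cov cE eps0 bA).
  by have := congr1 (fun G : H -> H => G v) (rep_comp rep aC aC); rewrite e /= => <-.
have p1 : hn p <= 1.
  have h : hn p ^+ 2 <= hn p.
    rewrite hnorm_sqr {2}/p aa pp.
    apply: le_trans (Re_le_normc _) _; rewrite formC normcJ.
    by apply: le_trans (cauchy_schwarz _ _ _) _; rewrite v1 mulr1.
  by have := hnorm_ge0 (hdot H) p; nra.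
have Tle w : hn (T w) <= M * hn w by exact: rep_multop_le.
have linT : linear T by exact: rho_lin.
have pTp : hdot H (T p) p = 0.
  have C1 := Ccs_comp fC aC.
  have h1 := congr1 (fun G : H -> H => G v) (rep_comp rep fC aC).
  have h2 := congr1 (fun G : H -> H => G v) (rep_comp rep aC C1).
  (* An operator [S] with [S = S - S] is represented by zero. *)
  have h0 : avg A \o (multop f \o avg A) = avg A \o (multop f \o avg A) +
      (-1 : R[i]) *: (avg A \o (multop f \o avg A)) :> (L2 -> L2).
    apply/funext => u; rewrite !fctE /= (avg_mult_avg ub cov cE eps0 bA)//.
    by rewrite scaler0 addr0.
  have z : rho (avg A) (T p) = 0.
    rewrite -[T p]h1 -[LHS]h2.
    have C2 := Ccs_comp aC C1.
    have := congr1 (fun G : H -> H => G v) (rep_linear rep (-1) C2 C2).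
    rewrite addrC -h0 fctE => ->.
    by rewrite !fctE scaleN1r addNr.
  by rewrite -[X in hdot H _ X]pp -aa z (linear0l (hdot H)).
(* [f = chi * f * chi] almost everywhere, as [f] vanishes off the blocks. *)
have -> : vector_state v f = hdot H (T q) q.
  rewrite /T /q rep_multopM//.
  have hfc : Linfty mu (fun x => f x * chi x) by exact: LinftyM.
  rewrite -[multop chi in RHS](_ : multop (fun x => conjC (chi x)) = _); last first.
    congr multop; apply/funext => x; rewrite /chi indicE.
    by case: (_ \in _); rewrite ?rmorph1 ?rmorph0.
  rewrite -rep_multop_adjoint// rep_multopM//.
  apply: vector_state_ae => //; first exact: LinftyM.
  apply: filterS fA => x fx; rewrite /chi indicE.
  have [/set_mem _|/negP nA] := boolP (x \in _); first by rewrite mul1r mulr1.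
  by rewrite mul0r fx// => Ax; apply: nA; rewrite inE.
have -> : hdot H (T q) q = hdot H (T (q - p)) q + hdot H (T p) (q - p).
  by rewrite (linB linT) linearBl linearBr /= pTp subr0 subrK.
have qp : hn (q - p) <= gamma by rewrite hnormBC.
apply: le_trans (le_normcD _ _) _.
have h1 : normc (hdot H (T (q - p)) q) <= gamma * M.
  apply: le_trans (cauchy_schwarz (hdot H) _ _) _.
  apply: le_trans (ler_piMr (hnorm_ge0 _ _) q1) _.
  by apply: le_trans (Tle _) _; rewrite mulrC ler_wpM2r.
have h2 : normc (hdot H (T p) (q - p)) <= gamma * M.
  apply: le_trans (cauchy_schwarz (hdot H) _ _) _.
  rewrite mulrC ler_pM ?hnorm_ge0//.
  by apply: le_trans (Tle _) _; rewrite ler_piMr.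
by lra.
Qed.

End vector_states.

(** * Limits of means *)

Lemma ultra_bounded_cvg (R : realType) (I : Type) (G : set_system I)
    (r : I -> R) (M : R) : UltraFilter G -> (forall i, `|r i| <= M) ->
  exists l : R, r i @[i --> G] --> l.
Proof.
move=> GU rM; have GP : ProperFilter G by exact: ultra_proper.
have rG : (r i @[i --> G]) `[- M, M]%classic.
  apply: (@filterS _ G _ setT); last exact: filterT.
  by move=> i _ /=; rewrite in_itv /= -ler_norml.
have [l [_ lr]] := @segment_compact R (- M) M (r i @[i --> G]) _ rG.
exists l => V Vl; have [//|GnV] := in_ultra_setVsetC (r @^-1` V) GU.
have [x [nVx Vx]] := lr (~` V) V GnV Vl.
by [].
Qed.

Section limit_of_means.
Context {R : realType} {d : measure_display} {X : measurableType d}.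
Variables (cs : coarseStructure X) (mu : {measure set X -> \bar R}).
Implicit Types (f g : X -> R[i]).

(** The directed set of pairs [(E, n)], where [E] is controlled and [n] stands
for the precision [1 / (n + 1)]. *)
Let tails : set_system (set (X * X) * nat) := fun S =>
  exists E n, controlled cs E /\ forall i, controlled cs i.1 -> E `<=` i.1 ->
    (n <= i.2)%N -> S i.

Let tails_proper : ProperFilter tails.
Proof.
apply: Build_ProperFilter_ex.
  by move=> S [E [n [cE h]]]; exists (E, n); apply: h.
split.
- by exists diagonal, 0%N; split => //; exact: controlled_diagonal.
- move=> S T [E [n [cE hS]]] [F [m [cF hT]]].
  exists (E `|` F), (maxn n m); split; first exact: controlled_setU.
  move=> i ci; rewrite subUset => -[Ei Fi]; rewrite geq_max => /andP[ni mi].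
  by split; [exact: hS|exact: hT].
- by move=> S T ST [E [n [cE hS]]]; exists E, n; split => // i *; exact/ST/hS.
Qed.

(** A mean that kills all blocking collections is a limit, along an ultrafilter,
of means that almost kill the [(E, eps)]-blocking ones. *)
Lemma amenable_of_approximate_means :
  (forall E (eps gamma : R), controlled cs E -> 0 < eps -> 0 < gamma ->
    exists phi, [/\ mean mu phi,
      forall f M, Linfty mu f -> 0 <= M -> (\forall x \ae mu, normc (f x) <= M) ->
        normc (phi f) <= M &
      forall A f M, block_collection mu E eps A -> Linfty mu f -> 0 <= M ->
        (\forall x \ae mu, normc (f x) <= M) ->
        (forall U, A U -> cintegral mu U f = 0) ->
        (\forall x \ae mu, ~ blocks_union A x -> f x = 0) ->
        normc (phi f) <= 2 * gamma * M]) ->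
  amenable_mean cs mu.
Proof.
move=> approx; pose q (n : nat) : R := n.+1%:R^-1.
have q0 n : 0 < q n by rewrite invr_gt0.
have /choice[phi phiP] : forall i : set (X * X) * nat, exists phi : (X -> R[i]) -> R[i],
    [/\ mean mu phi,
      forall f M, Linfty mu f -> 0 <= M -> (\forall x \ae mu, normc (f x) <= M) ->
        normc (phi f) <= M &
      controlled cs i.1 -> forall A f M, block_collection mu i.1 (q i.2) A ->
        Linfty mu f -> 0 <= M ->
        (\forall x \ae mu, normc (f x) <= M) ->
        (forall U, A U -> cintegral mu U f = 0) ->
        (\forall x \ae mu, ~ blocks_union A x -> f x = 0) ->
        normc (phi f) <= 2 * q i.2 * M].
  move=> [E n]; have [cE|nE] := pselect (controlled cs E).
    by have [phi [h1 h2 h3]] := approx E _ _ cE (q0 n) (q0 n); exists phi.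
  have [phi [h1 h2 h3]] := approx _ _ _ (controlled_diagonal cs) (q0 n) (q0 n).
  by exists phi.
have [G [GU tG]] := ultraFilterLemma tails_proper.
have GP : ProperFilter G by exact: ultra_proper.
pose L (r : set (X * X) * nat -> R) : R := lim (r i @[i --> G]).
have cvL r M : (forall i, `|r i| <= M) -> r i @[i --> G] --> L r.
  by move=> /(ultra_bounded_cvg GU)[l /cvgP].
have phiM f : Linfty mu f -> exists M, forall i, normc (phi i f) <= M.
  move=> hf; have [M M0 fM] := Linfty_bound hf; exists M => i.
  by have [_ h _] := phiP i; exact: h.
have Re_norm (z : R[i]) : `|complex.Re z| <= normc z.
  by have := normc_ge_Re z; rewrite normrE lecR.
have Im_norm (z : R[i]) : `|complex.Im z| <= normc z.
  rewrite -ler_sqr ?nnegrE ?normc_ge0// normc_sqr real_normK ?num_real//.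
  by rewrite lerDr sqr_ge0.
have cRe f : Linfty mu f ->
    complex.Re (phi i f) @[i --> G] --> L (fun i => complex.Re (phi i f)).
  by move=> /phiM[M hM]; apply: (@cvL _ M) => i; exact: le_trans (Re_norm _) _.
have cIm f : Linfty mu f ->
    complex.Im (phi i f) @[i --> G] --> L (fun i => complex.Im (phi i f)).
  by move=> /phiM[M hM]; apply: (@cvL _ M) => i; exact: le_trans (Im_norm _) _.
have LE r l : r i @[i --> G] --> l -> L r = l by move=> h; exact: cvg_lim.
pose Phi f : R[i] := L (fun i => complex.Re (phi i f)) +i* L (fun i => complex.Im (phi i f)).
exists Phi.
- split.
  + move=> f g hf hg fg; rewrite /Phi; congr (L _ +i* L _); apply/funext => i;
      by have [h _ _] := phiP i; rewrite (mean_ae h hf hg fg).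
  + move=> a f g hf hg; apply/eqP; rewrite eq_complex; apply/andP; split; apply/eqP.
    * transitivity (complex.Re a * L (fun i => complex.Re (phi i f)) -
        complex.Im a * L (fun i => complex.Im (phi i f)) + L (fun i => complex.Re (phi i g))).
        apply: LE; rewrite (_ : (fun i => _) = (fun i => complex.Re a * complex.Re (phi i f) -
          complex.Im a * complex.Im (phi i f) + complex.Re (phi i g))).
          apply: cvgD; last exact: cRe.
          by apply: cvgB; apply: cvgMr; [exact: cRe|exact: cIm].
        apply/funext => i; have [h _ _] := phiP i; rewrite (mean_linear h)//.
        by case: a (phi i f) (phi i g) => ? ? [? ?] [].
      by case: a => ? ? /=.
    * transitivity (complex.Re a * L (fun i => complex.Im (phi i f)) +
        complex.Im a * L (fun i => complex.Re (phi i f)) + L (fun i => complex.Im (phi i g))).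
        apply: LE; rewrite (_ : (fun i => _) = (fun i => complex.Re a * complex.Im (phi i f) +
          complex.Im a * complex.Re (phi i f) + complex.Im (phi i g))).
          apply: cvgD; last exact: cIm.
          by apply: cvgD; apply: cvgMr; [exact: cIm|exact: cRe].
        apply/funext => i; have [h _ _] := phiP i; rewrite (mean_linear h)//.
        by case: a (phi i f) (phi i g) => ? ? [? ?] [].
      by case: a => ? ? /=.
  + move=> f hf f0.
    have p0 i : 0 <= phi i f by have [h _ _] := phiP i; exact: (mean_ge0 h).
    rewrite lecE /=; apply/andP; split.
      rewrite (_ : L (fun i => complex.Im (phi i f)) = 0)//; apply: LE.
      rewrite (_ : (fun i => _) = cst 0); first exact: cvg_cst.
      by apply/funext => i; rewrite (ge0_complexE (p0 i)).
    apply: limr_ge; first by apply/cvg_ex; exists (L (fun i => complex.Re (phi i f))); exact: cRe.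
    by apply: nearW => i; have := p0 i; rewrite lecE => /andP[].
  + have e1 i : phi i (cst 1) = 1 by have [h _ _] := phiP i; exact: (mean1 h).
    have eR : L (fun i => complex.Re (phi i (cst 1))) = 1.
      by apply: LE; under eq_fun do rewrite e1; exact: cvg_cst.
    have eI : L (fun i => complex.Im (phi i (cst 1))) = 0.
      by apply: LE; under eq_fun do rewrite e1; exact: cvg_cst.
    by rewrite /Phi eR eI.
- move=> A f [E [eps [cE eps0 bA]]] hf fA0 fA.
  have [M M0 fM] := Linfty_bound hf.
  have small e : 0 < e -> \forall i \near G, normc (phi i f) <= e.
    move=> e0; pose n := maxn (Num.truncn (eps^-1)) (Num.truncn (2 * M / e)).
    apply: tG; exists E, n; split => // i ci Ei ni.
    have [_ _ /(_ ci A f M) h] := phiP i.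
    have qe x : x < n.+1%:R -> x * q i.2 <= 1.
      move=> xn; rewrite ler_pdivrMr// mul1r ltW// (lt_le_trans xn)//.
      by rewrite ler_nat ltnS.
    have : normc (phi i f) <= 2 * q i.2 * M.
      apply: h => //; split; first exact: bA.1.
      move=> U /(bA.2)[mU UE eU]; split => //; first exact: subset_trans Ei.
      apply: le_trans eU; rewrite lee_fin.
      have := @qe (eps^-1); rewrite mulrC ler_pdivrMr// mul1r; apply.
      by apply: lt_le_trans (truncnS_gt _) _; rewrite ler_nat ltnS leq_maxl.
    move=> /le_trans; apply.
    have h2 : 2 * M / e * q i.2 <= 1.
      apply: qe; apply: lt_le_trans (truncnS_gt _) _.
      by rewrite ler_nat ltnS leq_maxr.
    have -> : 2 * q i.2 * M = 2 * M / e * q i.2 * e by field; rewrite gt_eqF.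
    by rewrite ler_piMl// ltW.
  have eR : L (fun i => complex.Re (phi i f)) = 0.
    apply: LE; apply/cvgr0Pnorm_le => e /small; apply: filterS => i.
    exact: le_trans (Re_norm _).
  have eI : L (fun i => complex.Im (phi i f)) = 0.
    apply: LE; apply/cvgr0Pnorm_le => e /small; apply: filterS => i.
    exact: le_trans (Im_norm _).
  by rewrite /Phi eR eI.
Qed.

End limit_of_means.

(** * Amenability in the absence of property (T) *)

Section negation_of_property_T.
Context {R : realType} {d : measure_display} {X : measurableType d}.
Variables (cs : coarseStructure X) (mu : {measure set X -> \bar R}).
Local Notation L2 := (L2 mu).
Local Notation L2dot := (@L2dot R d X mu).
Hypotheses (ub : uniformly_bounded cs mu) (covered : countably_covered cs).

(** Without property (T) there are representations with unit vectors that are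
almost fixed by all averaging operators at any prescribed scale; their vector
states are the approximate means. *)
Lemma amenable_of_not_T : ~ geometric_property_T cs mu -> amenable_mean cs mu.
Proof.
move=> nT; apply: amenable_of_approximate_means => E eps gamma cE eps0 g0.
apply: contrapT => nphi; apply: nT; exists E, eps, gamma; split => //.
move=> H rho rep v v1 _; apply: contrapT => nex; apply: nphi.
have bound f M : Linfty mu f -> 0 <= M -> (\forall x \ae mu, normc (f x) <= M) ->
    normc (vector_state rho v f) <= M.
  move=> hf M0 fM; apply: le_trans (cauchy_schwarz _ _ _) _.
  by rewrite v1 mulr1; have := rep_multop_le rep v hf M0 fM; rewrite v1 mulr1.
exists (vector_state rho v); split => //; first exact: (vector_state_mean rep).
move=> A f M bA hf M0 fM fA0 fA.
have [A0|nA0] := pselect (A !=set0); last first.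
  have f0 : \forall x \ae mu, normc (f x) <= 0.
    apply: filterS fA => x -> ; first by rewrite Normc.normc0.
    by move=> [U AU _]; apply: nA0; exists U.
  by apply: le_trans (bound _ _ hf (lexx 0) f0) _; rewrite !mulr_ge0// ltW.
apply: (vector_state_blocking rep ub covered cE eps0 bA) => //.
rewrite leNgt; apply/negP => lt_g; apply: nex.
exists (avg A), \1_(blocks_union A); split.
- exact: (avg_in_blocks ub covered cE eps0 bA).
- exact: (avg_neq0 ub covered cE eps0 bA).
- exact: (avg_is_Phi ub covered cE eps0 bA).
- exact: (Linfty_blocks ub covered cE eps0 bA).
- apply: le_trans (ltW lt_g); rewrite ler_piMr//; first exact: ltW.
  exact: (opnorm_avg ub covered cE eps0 bA).
Qed.

End negation_of_property_T.

(** * The representation on square integrable functions *)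

Section regular_representation.
Context {R : realType} {d : measure_display} {X : measurableType d}.
Variables (cs : coarseStructure X) (mu : {measure set X -> \bar R}).
Local Notation L2 := (L2 mu).
Local Notation L2dot := (@L2dot R d X mu).
Local Notation ind := (ind mu).
Implicit Types (T : L2 -> L2) (U V : set X).

Lemma L2dot_injr (u v : L2) : (forall w, L2dot w u = L2dot w v) -> u = v.
Proof. exact: (form_inj (form := L2dot)). Qed.

Lemma L2dot_injl (u v : L2) : (forall w, L2dot u w = L2dot v w) -> u = v.
Proof. by move=> uv; apply: L2dot_injr => w; rewrite L2dotC uv -L2dotC. Qed.

Definition regular_rep : (L2 -> L2) -> (L2space mu -> L2space mu) := id.

Lemma regular_rep_representation : representation cs regular_rep.
Proof. by split => // T []. Qed.

Hypothesis ub : uniformly_bounded cs mu.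

(** The adjoint of [T] maps vectors supported in [V] to vectors supported in
[fibre E V].  Against such vectors the constant function 1, which need not be
square integrable, may be replaced by the indicator of [fibre E V]. *)
Lemma Phi_restrict E T f V : supported_on cs E T -> is_Phi cs T f -> Linfty mu f ->
  measurable V -> coarse_bounded cs V ->
  multop f (ind V) = multop \1_V (T (ind (fibre E V))).
Proof.
move=> sT [_ [S adjT PhiT]] hf mV bV.
have [cE mE _] := sT; have mEV := mE _ mV.
have fV := bounded_fin ub mV bV.
have fEV : (mu (fibre E V) < +oo)%E.
  by apply: (bounded_fin ub mEV); exact: coarse_bounded_fibre.
apply: L2dot_injl => xi.
pose xi' := multop \1_V xi.
have hV := Linfty_indic mu mV; have hEV := Linfty_indic mu mEV.
have xiV : supported_in V xi'.
  by apply: filterS (multopE xi hV) => x -> nVx; rewrite indicE memNset// mul0r.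
have SV : S xi' = multop \1_(fibre E V) (S xi').
  apply: L2dot_injr => eta.
  rewrite -(multop_indic_adj eta (S xi') mEV).
  rewrite -(adjT eta xi') -(adjT (multop _ eta) xi').
  rewrite (L2dotC (T eta) xi') (L2dotC (T _) xi'); congr (conjC _).
  by case: sT => _ _ h; exact: h.
rewrite (multop_indic_adj (T (ind (fibre E V))) xi mV) -/xi' adjT.
transitivity (cintegral mu setT (fun x => f x * conjC (L2repr xi' x))).
  apply: L2dotE.
    by apply: cmeasurableMJ; [exact: hf.1|exact: (L2repr_sqr_integrable _).1].
  near=> x.
  rewrite [in LHS](near (multopE (ind V) hf) x); last by [].
  rewrite [in LHS](near (indE mV fV) x); last by [].
  rewrite [in RHS](near (multopE xi hV) x); last by [].
  rewrite rmorphM /= -!mulrA; congr (_ * _).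
  by rewrite indicE; case: (_ \in _); rewrite ?rmorph1 ?rmorph0.
rewrite (PhiT V)//; apply/esym/L2dotE.
  by apply: cmeasurableMJ; [exact: cmeasurable_cst|exact: (L2repr_sqr_integrable _).1].
near=> x.
rewrite [in LHS](near (indE mEV fEV) x); last by [].
rewrite SV [in LHS](near (multopE (S xi') hEV) x); last by [].
rewrite [in RHS](near (multopE (S xi') hEV) x); last by [].
rewrite /= mul1r indicE.
by case: (_ \in _); rewrite ?mul1r ?mul0r ?rmorph0.
Unshelve. all: by end_near. Qed.

End regular_representation.

(** * Bounded spaces *)

Section bounded_case.
Context {R : realType} {d : measure_display} {X : measurableType d}.
Variables (cs : coarseStructure X) (mu : {measure set X -> \bar R}).
Local Notation L2 := (L2 mu).
Local Notation L2dot := (@L2dot R d X mu).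
Local Notation ind := (ind mu).
Hypotheses (ub : uniformly_bounded cs mu) (covered : countably_covered cs).

Lemma single_block_collection U : measurable U -> (mu U < +oo)%E ->
  block_collection mu (U `*` U) (fine (mu U)) [set U].
Proof.
move=> mU fU; split; first by move=> V W -> ->.
by move=> _ ->; split => //; rewrite fineK ?ge0_fin_numE.
Qed.

Lemma blocks_union1 (U : set X) : blocks_union [set U] = U.
Proof. exact: bigcup_set1. Qed.

Variable F : set (X * X).
Hypothesis gF : gordo cs mu F.

Lemma gordo_fibre_gt0 x : (0 < mu (fibre F [set x]))%E.
Proof.
case: gF => _ _ _ h; apply: lt_le_trans h _.
by apply: ereal_inf_lbound; exists x.
Qed.

Hypothesis m1 : forall x : X, measurable [set x].
Hypothesis bX : coarse_bounded cs [set: X].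

Let fX : (mu setT < +oo)%E.
Proof. exact: (bounded_fin ub measurableT bX). Qed.

Let X0 : 0 < fine (mu setT).
Proof.
rewrite fine_gt0// fX andbT; apply: lt_le_trans (gordo_fibre_gt0 point) _.
by apply: le_measure; rewrite ?inE//; case: gF => _ _ + _; apply; exact: m1.
Qed.

Lemma folner_of_bounded : amenable_folner cs mu.
Proof.
move=> E eps cE mE e0; exists setT; split => //; first by exists point.
apply: (@le_trans _ _ (1 * mu setT)%E).
  by rewrite mul1e; apply: le_measure; rewrite ?inE//; exact: mE.
by apply: lee_wpmul2r => //; rewrite lee_fin lerDl ltW.
Qed.

Let n := hnorm L2dot (ind setT).

Let n0 : 0 < n.
Proof.
rewrite lt_neqAle hnorm_ge0 andbT eq_sym -sqrf_eq0.
by rewrite hnorm_ind// gt_eqF.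
Qed.

(** The normalised constant function is fixed by all averaging operators. *)
Lemma mean_of_bounded : amenable_mean cs mu.
Proof.
have rep := regular_rep_representation cs mu.
pose v : L2 := (n^-1)%:C *: ind setT.
have v1 : hnorm L2dot v = 1 by exact: hnorm_normalize.
exists (vector_state (@regular_rep _ _ _ mu) (v : L2space mu)).
  exact: (vector_state_mean rep).
move=> A f [E [eps [cE eps0 bA]]] hf fA0 fA.
have [M M0 fM] := Linfty_bound hf.
have mA := measurable_blocks_union ub covered cE eps0 bA.
have avg_v : avg A v = multop \1_(blocks_union A) v.
  rewrite /v (linZ (avg_linear ub covered cE eps0 bA)).
  rewrite (linZ (multop_linear (Linfty_indic mu mA))).
  rewrite (avg_ind ub covered cE eps0 bA measurableT fX (fun U _ _ => @subsetT _ U)).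
  by rewrite (multop_ind mA measurableT fX) setIC.
apply: Normc.eq0_normc; apply/eqP; rewrite eq_le normc_ge0 andbT.
have := vector_state_blocking (gamma := 0) (v := (v : L2space mu)) rep ub covered cE eps0 bA v1 _ hf M0 fM fA0 fA.
rewrite mulr0 mul0r; apply.
by rewrite /regular_rep avg_v subrr hnorm0.
Qed.

Lemma Phi_constant T f : Ccs cs T -> is_Phi cs T f -> Linfty mu f ->
  T (ind setT) = multop f (ind setT).
Proof.
move=> [_ [E sT]] PhiT hf.
have mE : measurable (fibre E setT) by case: sT => _ + _; apply.
have id1 : multop \1_setT = idfun :> (L2 -> L2).
  by rewrite -multop1; congr multop; apply/funext => x; rewrite indicE in_setT.
rewrite (Phi_restrict ub sT PhiT hf measurableT bX).
rewrite -[T (ind setT)]/(idfun (T (ind setT))) -id1.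
rewrite (supported_on_restrict _ sT measurableT).
by rewrite (multop_ind mE measurableT fX) setIT.
Qed.

(** The projection [P] onto the constant functions is an averaging operator, with
[Phi P = 1]; all vectors [P v] are constant, so [P v = 0] for [v] orthogonal to
the constant vectors. *)
Lemma T_of_bounded : geometric_property_T cs mu.
Proof.
have cE : controlled cs (setT `*` setT) by exact: bX.
have bA := single_block_collection measurableT fX.
exists (setT `*` setT), (fine (mu setT)), 1; split => //.
move=> H rho rep v v1 vc.
pose P : L2 -> L2 := avg [set setT].
have id1 : multop \1_(blocks_union [set [set: X]]) = idfun :> (L2 -> L2).
  rewrite blocks_union1 -multop1; congr multop.
  by apply/funext => x; rewrite indicE in_setT.
have PC : Ccs cs P := avg_Ccs ub covered cE X0 bA.
have PE u : P u = mean_on u setT *: ind setT.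
  rewrite -(multop_avg ub covered cE X0 bA u erefl) -[LHS]/(idfun (P u)) -id1.
  by rewrite blocks_union1.
have TP T f : Ccs cs T -> is_Phi cs T f -> Linfty mu f -> T \o P = multop f \o P.
  move=> cT PhiT hf; apply/funext => u /=; rewrite PE.
  rewrite (linZ cT.1.1) (linZ (multop_linear hf)).
  by rewrite (Phi_constant cT PhiT hf).
pose w := rho P v.
have wc : constant_vector cs rho w.
  move=> T f cT PhiT hf.
  have h1 := congr1 (fun G : H -> H => G v) (rep_comp rep cT PC).
  have h2 := congr1 (fun G : H -> H => G v) (rep_comp rep (multop_Ccs cs hf) PC).
  by rewrite -[LHS]h1 -[RHS]h2 (TP _ _ cT PhiT hf).
have PP : rho P w = w.
  have e : P \o P = P by apply/funext => u; exact: (avg_idem ub covered cE X0 bA).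
  by have := congr1 (fun G : H -> H => G v) (rep_comp rep PC PC); rewrite e /= => <-.
have w0 : w = 0.
  apply: (hnorm_eq0 (form := hdot H)); apply/eqP; rewrite -sqrf_eq0 hnorm_sqr.
  have sa := rep_adjoint rep PC PC (avg_selfadjoint ub covered cE X0 bA).
  by rewrite {1}/w sa PP vc.
exists P, \1_(blocks_union [set [set: X]]); split.
- exact: (avg_in_blocks ub covered cE X0 bA).
- by apply: (avg_neq0 ub covered cE X0 bA); exists setT.
- exact: (avg_is_Phi ub covered cE X0 bA).
- exact: (Linfty_blocks ub covered cE X0 bA).
- rewrite id1 (rep_id rep) -/w w0 sub0r hnormN v1 mul1r.
  exact: (opnorm_avg ub covered cE X0 bA).
Qed.

End bounded_case.

(** * Unbounded spaces: the Folner condition excludes property (T) *)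

Section unbounded_regular_representation.
Context {R : realType} {d : measure_display} {X : measurableType d}.
Variables (cs : coarseStructure X) (mu : {measure set X -> \bar R}).
Local Notation L2 := (L2 mu).
Local Notation L2dot := (@L2dot R d X mu).
Local Notation ind := (ind mu).
Hypotheses (ub : uniformly_bounded cs mu) (covered : countably_covered cs).
Hypothesis connected : coarse_connected cs.
Variables (P : nat -> set X) (G : set (X * X)) (c : R).
Hypotheses (cG : controlled cs G) (c0 : 0 < c) (tP : trivIset setT P).
Hypotheses (PT : \bigcup_i P i = setT) (mP : forall i, measurable (P i)).
Hypotheses (PG : forall i, P i `*` P i `<=` G).
Hypothesis (Pc : forall i, (c%:E <= mu (P i))%E).

Let Y n := \big[setU/set0]_(i < n.+1) P i.

Let mY n : measurable (Y n).
Proof. exact: bigsetU_measurable. Qed.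

Let bY n : coarse_bounded cs (Y n).
Proof.
rewrite /Y -(bigcup_mkord n.+1 P); apply: coarse_bounded_bigcup => // i _.
exact: controlled_subset (@PG i) cG.
Qed.

Let fY n : (mu (Y n) < +oo)%E.
Proof. exact: (bounded_fin ub (mY n) (bY n)). Qed.

Let Yc n : n.+1%:R * c <= fine (mu (Y n)).
Proof.
rewrite -lee_fin fineK ?ge0_fin_numE// /Y measure_bigsetU//.
elim: n => [|n IH]; first by rewrite big_ord_recr big_ord0 /= add0e mul1r.
by rewrite big_ord_recr /= -addn1 natrD mulrDl mul1r EFinD leeD.
Qed.

Let Y0 n : 0 < fine (mu (Y n)).
Proof. by apply: lt_le_trans (Yc n); rewrite mulr_gt0. Qed.

(** Averaging over the single block [Y n] shows that a constant vector is a
constant function on [Y n].  The value does not depend on [n], and it is zero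
because the measure of [Y n] tends to infinity. *)
Lemma regular_rep_constant (v : L2) :
  constant_vector cs (@regular_rep _ _ _ mu) (v : L2space mu) -> v = 0.
Proof.
move=> vc.
have bA n := single_block_collection (mY n) (fY n).
have vY n : multop \1_(Y n) v = mean_on v (Y n) *: ind (Y n).
  have h := vc _ _ (avg_Ccs ub covered (bY n) (Y0 n) (bA n))
    (avg_is_Phi ub covered (bY n) (Y0 n) (bA n))
    (Linfty_blocks ub covered (bY n) (Y0 n) (bA n)).
  rewrite -(multop_avg ub covered (bY n) (Y0 n) (bA n) v erefl).
  rewrite [avg _ v]h blocks_union1 /regular_rep.
  have hY := Linfty_indic mu (mY n).
  have := congr1 (fun G : L2 -> L2 => G v) (multop_comp hY hY) => /= ->.
  by congr (multop _ v); apply/funext => x; rewrite -indic_setI setIid.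
have Y0n n : Y 0 `&` Y n = Y 0.
  apply/setIidPl; rewrite /Y -(bigcup_mkord n.+1 P) -(bigcup_mkord 1 P).
  by move=> x [i /= i1 Px]; exists i => //=; apply: leq_trans i1 _.
have m0 n : mean_on v (Y n) = mean_on v (Y 0).
  have h0 := Linfty_indic mu (mY 0).
  have := congr1 (fun G : L2 -> L2 => G v) (multop_comp h0 (Linfty_indic mu (mY n))).
  rewrite /= vY (linZ (multop_linear h0)) (multop_ind (mY 0) (mY n) (fY n)) Y0n.
  rewrite (_ : (fun x => _) = \1_(Y 0)); last first.
    by apply/funext => x; rewrite -indic_setI Y0n.
  rewrite vY => /eqP; rewrite -subr_eq0 -scalerBl scaler_eq0 subr_eq0.
  case/orP => [/eqP//|/eqP ind0].
  have := hnorm_ind (mY 0) (fY 0); rewrite ind0 hnorm0 expr0n /= => /esym/eqP.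
  by rewrite gt_eqF.
have mv0 : mean_on v (Y 0) = 0.
  apply: Normc.eq0_normc; apply/eqP; rewrite -sqrf_eq0; apply/negPn/negP => m_neq0.
  pose a := normc (mean_on v (Y 0)) ^+ 2.
  have a0 : 0 < a by rewrite lt_neqAle sqr_ge0 andbT eq_sym.
  have le n : a * (n.+1%:R * c) <= hnorm L2dot v ^+ 2.
    have le1 : hnorm L2dot (multop \1_(Y n) v) <= 1 * hnorm L2dot v.
      apply: multop_contr; [exact: Linfty_indic|exact: ler01|].
      apply: aeW => x; rewrite indicE.
      by case: (_ \in _); rewrite ?Normc.normc1 ?Normc.normc0.
    rewrite mul1r vY hnormZ m0 in le1.
    apply: (@le_trans _ _ ((normc (mean_on v (Y 0)) * hnorm L2dot (ind (Y n))) ^+ 2)).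
      by rewrite exprMn hnorm_ind// ler_wpM2l// sqr_ge0.
    by rewrite lerXn2r ?nnegrE ?mulr_ge0 ?normc_ge0 ?hnorm_ge0.
  have := le (Num.truncn (hnorm L2dot v ^+ 2 / (a * c))).
  have := truncnS_gt (hnorm L2dot v ^+ 2 / (a * c)).
  rewrite (ltr_pdivrMr _ _ (mulr_gt0 a0 c0)) => h1 h2.
  by move: h1; rewrite ltNge mulrCA h2.
apply: L2_eqP.
have vY0 n : \forall x \ae mu, \1_(Y n) x * L2repr v x = 0.
  have := multopE v (Linfty_indic mu (mY n)).
  rewrite vY m0 mv0 scale0r; apply: filterS2 (L2repr0 mu) => x -> ->.
  by [].
apply: filterS2 (ae_foralln vY0) (L2repr0 mu) => x vx ->.
have [i _ Pi] : (\bigcup_i P i) x by rewrite PT.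
have := vx i; rewrite indicE mem_set ?mul1r//.
by rewrite /Y -(bigcup_mkord i.+1 P); exists i => //=.
Qed.

End unbounded_regular_representation.

Section folner_not_T.
Context {R : realType} {d : measure_display} {X : measurableType d}.
Variables (cs : coarseStructure X) (mu : {measure set X -> \bar R}).
Local Notation L2 := (L2 mu).
Local Notation L2dot := (@L2dot R d X mu).
Local Notation ind := (ind mu).
Local Notation hn := (hnorm L2dot).
Hypotheses (ub : uniformly_bounded cs mu) (covered : countably_covered cs).

Lemma hnorm_ind_le U V : measurable U -> measurable V -> (mu V < +oo)%E ->
  U `<=` V -> hn (ind U) <= hn (ind V).
Proof.
move=> mU mV fV UV.
have UVm : (mu U <= mu V)%E by apply: le_measure; rewrite ?inE.
have fU := le_lt_trans UVm fV.
rewrite -ler_sqr; [|exact: hnorm_ge0|exact: hnorm_ge0].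
rewrite [leLHS](hnorm_ind mU fU) [leRHS](hnorm_ind mV fV).
by apply: fine_le; rewrite ?ge0_fin_numE.
Qed.

Lemma hnorm_multop_indic U (u : L2) : measurable U -> hn (multop \1_U u) <= hn u.
Proof.
move=> mU; rewrite -[leRHS]mul1r; apply: multop_contr; [exact: Linfty_indic|exact: ler01|].
apply: aeW => x; rewrite indicE.
by case: (_ \in _); rewrite ?Normc.normc1 ?Normc.normc0.
Qed.

(** An operator in blocks commutes with restriction to a set [U] up to the blocks
that cross the boundary of [U].  On the union [W] of these blocks the vector
[T 1_U - f 1_U] equals [T] of an indicator of a subset of [W], minus a truncation
of [T 1_W]; hence the factor 2. *)
Lemma block_operator_almost_constant (E : set (X * X)) (A : set (set X)) (eps : R)
    (T : L2 -> L2) f U :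
  block_collection mu E eps A -> bounded_op L2dot T ->
  supported_on cs (blocks_rel A) T -> is_Phi cs T f -> Linfty mu f ->
  measurable U -> coarse_bounded cs U ->
  hn (T (ind U) - multop f (ind U)) <= 2 * opnorm L2dot T *
    hn (ind (fibre (blocks_rel A) U `&` fibre (blocks_rel A) (~` U))).
Proof.
move=> bA bT sT PhiT hf mU bU; set W := _ `&` _.
pose G := blocks_rel A; have [cG mG _] := sT.
have fU := bounded_fin ub mU bU.
have linT := bT.1.
have mW : measurable W by apply: measurableI; apply: mG => //; exact: measurableC.
have bW : coarse_bounded cs W.
  by apply: (@coarse_boundedS _ _ _ (fibre G U)); [exact: subIsetl|exact: coarse_bounded_fibre].
have fW := bounded_fin ub mW bW.
have tA V V' x : A V -> A V' -> V x -> V' x -> V = V'.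
  by case: bA => t _ AV AV' Vx V'x; apply: t => //; exists x.
have GW : fibre G W `<=` W.
  move=> x [y [[u Uu [V AV [/= Vy Vu]]] [u' Uu' [V' AV' [/= V'y V'u']]]]].
  move=> [V'' AV'' [/= V''x V''y]].
  split; [exists u => //; exists V|exists u' => //; exists V'] => //; split => //=.
  - by rewrite (tA V V'' y).
  - by rewrite (tA V' V'' y).
pose V1 := U `\` W; pose V2 := ~` (U `|` W).
have mV1 : measurable V1 by exact: measurableD.
have mV2 : measurable V2 by apply/measurableC/measurableU.
have bV1 : coarse_bounded cs V1 by apply: coarse_boundedS bU; exact: subDsetl.
have GV1 : fibre G V1 `<=` U.
  move=> x [y [Uy nWy] [V AV [/= Vx Vy]]]; apply: contrapT => nUx.
  by apply: nWy; split; [exists y|exists x] => //; exists V.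
have GV2 : fibre G V2 `&` U = set0.
  apply/seteqP; split => // x [[y /not_orP[nUy nWy] [V AV [/= Vx Vy]]] Ux].
  by apply: nWy; split; [exists x|exists y] => //; exists V.
set z := T (ind U) - multop f (ind U).
have lin1 V : measurable V -> linear (@multop _ _ _ mu \1_V).
  by move=> mV; exact: multop_linear (Linfty_indic mu mV).
have fmult V : measurable V -> multop \1_V (multop f (ind U)) = multop f (ind (V `&` U)).
  move=> mV; rewrite -(multop_ind mV mU fU).
  have hV := Linfty_indic mu mV.
  have e1 := congr1 (fun S : L2 -> L2 => S (ind U)) (multop_comp hV hf).
  have e2 := congr1 (fun S : L2 -> L2 => S (ind U)) (multop_comp hf hV).
  rewrite /= in e1 e2; rewrite e1 e2; congr (multop _ _).
  by apply/funext => x; rewrite mulrC.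
have Tmult V : measurable V ->
    multop \1_V (T (ind U)) = multop \1_V (T (ind (fibre G V `&` U))).
  move=> mV; rewrite (supported_on_restrict (ind U) sT mV).
  by rewrite (multop_ind (mG _ mV) mU fU).
have z1 : multop \1_V1 z = 0.
  rewrite /z (linB (lin1 _ mV1)) (Tmult _ mV1) (fmult _ mV1).
  have -> : V1 `&` U = V1 by apply/setIidPl; exact: subDsetl.
  have -> : fibre G V1 `&` U = fibre G V1 by exact/setIidPl.
  by rewrite (Phi_restrict ub sT PhiT hf mV1 bV1) subrr.
have z2 : multop \1_V2 z = 0.
  rewrite /z (linB (lin1 _ mV2)) (Tmult _ mV2) (fmult _ mV2) GV2.
  have -> : V2 `&` U = set0.
    by apply/seteqP; split => // x [/not_orP[]].
  rewrite ind_set0 (lin0 linT) (lin0 (lin1 _ mV2)).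
  by rewrite (lin0 (multop_linear hf)) subrr.
have zW : z = multop \1_W z.
  apply: L2_eqP; near=> x.
  rewrite [in RHS](near (multopE z (Linfty_indic mu mW)) x); last by [].
  have e1 : \1_V1 x * L2repr z x = 0.
    rewrite -(near (multopE z (Linfty_indic mu mV1)) x); last by [].
    by rewrite z1; exact: (near (L2repr0 mu) x).
  have e2 : \1_V2 x * L2repr z x = 0.
    rewrite -(near (multopE z (Linfty_indic mu mV2)) x); last by [].
    by rewrite z2; exact: (near (L2repr0 mu) x).
  move: e1 e2; rewrite !indicE.
  have [Wx|nWx] := pselect (W x).
    by rewrite (mem_set Wx) mul1r.
  rewrite (memNset nWx) mul0r.
  have [Ux|nUx] := pselect (U x).
    by rewrite mem_set ?mul1r//.
  by move=> _; rewrite mem_set ?mul1r// => -[].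
have op0 := opnorm_ge0 bT.
have TW S : measurable S -> S `<=` W ->
    hn (multop \1_W (T (ind S))) <= opnorm L2dot T * hn (ind W).
  move=> mS SW; apply: le_trans (hnorm_multop_indic (T (ind S)) mW) _.
  have h := opnorm_bound (ind S) bT; apply: le_trans h _.
  by apply: (ler_wpM2l op0); exact: hnorm_ind_le.
rewrite zW /z (linB (lin1 _ mW)) (Tmult _ mW) (fmult _ mW).
apply: le_trans (hnormB _ _ _) _.
rewrite -mulrA mulrDl mul1r lerD//.
  apply: TW; first by apply: measurableI => //; exact: mG.
  by move=> x [/GW].
have -> : multop f (ind (W `&` U)) = multop \1_U (multop \1_W (T (ind (fibre G W)))).
  rewrite -(Phi_restrict ub sT PhiT hf mW bW) setIC -(multop_ind mU mW fW).
  have hU := Linfty_indic mu mU.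
  have e1 := congr1 (fun S : L2 -> L2 => S (ind W)) (multop_comp hU hf).
  have e2 := congr1 (fun S : L2 -> L2 => S (ind W)) (multop_comp hf hU).
  rewrite /= in e1 e2; rewrite e1 e2; congr (multop _ _).
  by apply/funext => x; rewrite mulrC.
apply: le_trans (hnorm_multop_indic (multop \1_W (T (ind (fibre G W)))) mU) _.
by apply: TW => //; exact: mG.
Unshelve. all: by end_near. Qed.

Hypothesis connected : coarse_connected cs.
Variables (P : nat -> set X) (G : set (X * X)) (c : R).
Hypotheses (cG : controlled cs G) (c0 : 0 < c) (tP : trivIset setT P).
Hypotheses (PT : \bigcup_i P i = setT) (mP : forall i, measurable (P i)).
Hypotheses (PG : forall i, P i `*` P i `<=` G).
Hypothesis (Pc : forall i, (c%:E <= mu (P i))%E).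

(** The normalised indicators of Folner sets are almost constant vectors of [L2],
which has no nonzero constant vector.  The Folner condition is used for the
square of a relation [E'] containing the blocks, at the set [U0]: the blocks that
cross the boundary of [E' U0] then lie in [E' (E' U0)] but not in [U0]. *)
Lemma not_T_of_folner : amenable_folner cs mu -> ~ geometric_property_T cs mu.
Proof.
move=> folner [E [eps [gamma [cE eps0 g0 propT]]]].
have [E' [cE' mE' EE' PE']] := measurable_hull cG mP PT PG cE.
(* Any [delta] with [4 * delta < gamma ^ 2] would do. *)
pose delta := gamma ^+ 2 / 8.
have d0 : 0 < delta by rewrite divr_gt0 ?exprn_gt0.
have fibre2 V : fibre (rcomp E' E') V = fibre E' (fibre E' V).
  apply/seteqP; split => [z [x Vx [y [/= Ezy Eyx]]]|z [y [x Vx Eyx] Ezy]].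
    by exists y => //; exists x.
  by exists x => //; exists y.
have mE2 : measurable_rel (rcomp E' E').
  by move=> V mV; rewrite fibre2; exact: mE' _ (mE' _ mV).
have [U0 [[x0 Ux0] mU0 bU0]] := folner _ _ (controlled_rcomp cE' cE') mE2 d0.
rewrite fibre2; set U := fibre E' U0; set U2 := fibre E' U => folnerU.
have sub V : V `<=` fibre E' V.
  move=> x Vx; exists x => //.
  have [i _ Pi] : (\bigcup_i P i) x by rewrite PT.
  exact: (@PE' i).
have mU : measurable U by exact: mE'.
have mU2 : measurable U2 by exact: mE'.
have bU : coarse_bounded cs U by exact: coarse_bounded_fibre.
have bU2 : coarse_bounded cs U2 by exact: coarse_bounded_fibre.
have fU0 := bounded_fin ub mU0 bU0.
have fU := bounded_fin ub mU bU; have fU2 := bounded_fin ub mU2 bU2.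
have U_gt0 : 0 < fine (mu U).
  rewrite fine_gt0// fU andbT.
  have [i _ Pi] : (\bigcup_i P i) x0 by rewrite PT.
  apply: (@lt_le_trans _ _ (mu (P i))).
    by apply: lt_le_trans (Pc i); rewrite lte_fin.
  apply: le_measure; rewrite ?inE// => y Py.
  by exists x0 => //; exact: (@PE' i).
pose n := hn (ind U).
have n0 : 0 < n.
  by rewrite lt_neqAle hnorm_ge0 andbT eq_sym -sqrf_eq0 /n (hnorm_ind mU fU) gt_eqF.
pose v : L2 := (n^-1)%:C *: ind U.
have v1 : hn v = 1 by exact: hnorm_normalize.
have [|T [f [[[bT _] [A bA sT]] Tne PhiT hf]]] :=
    propT (L2space mu) (@regular_rep _ _ _ mu) (regular_rep_representation cs mu) v v1.
  move=> w /(regular_rep_constant ub covered connected cG c0 tP PT mP PG Pc) ->.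
  exact: linear0r.
have op0 : 0 < opnorm L2dot T by exact: opnorm_gt0.
have := block_operator_almost_constant bA bT sT PhiT hf mU bU.
set W := _ `&` _ => /= zW.
have mW : measurable W.
  by case: sT => _ mG _; apply: measurableI; apply: mG => //; exact: measurableC.
have tA V V' x : A V -> A V' -> V x -> V' x -> V = V'.
  by case: bA => t _ AV AV' Vx V'x; apply: t => //; exists x.
have AE V x y : A V -> V x -> V y -> E' (x, y).
  by move=> AV Vx Vy; apply: EE'; case: bA => _ /(_ V AV)[_ h _]; exact: h.
have WU : W `<=` U2 `\` U0.
  move=> x [[u Uu [V AV [/= Vx Vu]]] [u' nUu' [V' AV' [/= V'x V'u']]]].
  split; first by exists u => //; exact: AE AV _ _.
  by move=> U0x; apply: nUu'; exists x => //; exact: AE AV' _ _.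
have muW : fine (mu W) <= delta * n ^+ 2.
  have h : (mu W + mu U0 <= (1 + delta)%:E * mu U0)%E.
    apply: le_trans folnerU; rewrite -measureU//; last first.
      by apply/seteqP; split => // x [/WU[]].
    apply: le_measure; rewrite ?inE//; first exact: measurableU.
    by move=> x [/WU[]//|/sub/sub].
  have fW : (mu W < +oo)%E.
    by apply: le_lt_trans fU2; apply: le_measure; rewrite ?inE// => x /WU[].
  have h2 : (mu U0 <= mu U)%E by apply: le_measure; rewrite ?inE//; exact: sub.
  rewrite /n (hnorm_ind mU fU).
  move: h h2; rewrite -(@fineK _ (mu W)) ?ge0_fin_numE// -(@fineK _ (mu U0)) ?ge0_fin_numE//.
  rewrite -[mu U](@fineK _ (mu U)) ?ge0_fin_numE// -EFinD -EFinM !lee_fin /=.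
  rewrite mulrDl mul1r addrC lerD2l => h1 h2.
  by apply: le_trans h1 _; rewrite ler_wpM2l// ltW.
move=> ineq.
have fW : (mu W < +oo)%E.
  by apply: le_lt_trans fU2; apply: le_measure; rewrite ?inE// => x /WU[].
have : gamma * opnorm L2dot T <= n^-1 * (2 * opnorm L2dot T * hn (ind W)).
  apply: le_trans ineq _.
  rewrite /regular_rep /v (linZ bT.1) (linZ (multop_linear hf)) -scalerBr hnormZ.
  have ni : 0 <= n^-1 by rewrite invr_ge0 ltW.
  by rewrite (normc_real ni); exact: (ler_wpM2l ni zW).
have w2 := hnorm_ind mW fW; have w0 := hnorm_ge0 L2dot (ind W).
move: (hn (ind W)) (opnorm L2dot T) op0 w0 w2 => s o op0 w0 w2; clear zW ineq v1.
move: n n0 muW @v => n n0 muW _.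
rewrite (mulrC n^-1) ler_pdivlMr// => h.
have {}h : gamma * n <= 2 * s.
  by rewrite -(ler_pM2l op0); move: h; rewrite (_ : 2 * o * s = o * (2 * s)) ?mulrA ?(mulrC o)// mulrAC.
have h2 : (gamma * n) ^+ 2 <= (2 * s) ^+ 2.
  by rewrite lerXn2r ?nnegrE ?mulr_ge0// ltW.
rewrite !exprMn w2 in h2.
have gn : 0 < gamma ^+ 2 * n ^+ 2 by rewrite mulr_gt0 ?exprn_gt0.
have : gamma ^+ 2 * n ^+ 2 <= 2 ^+ 2 * (gamma ^+ 2 / 8 * n ^+ 2).
  by apply: le_trans h2 _; rewrite ler_wpM2l.
move: gn; set t := _ * _ ^+ 2; rewrite (_ : gamma ^+ 2 / 8 * n ^+ 2 = t / 8); last by rewrite /t mulrAC.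
lra.
Qed.

End folner_not_T.

(** * Matchings in graphs of bounded degree *)

Section colouring.

(** Greedy colouring: if every vertex has at most [K] earlier neighbours, then
[K + 1] colours are enough. *)
Lemma greedy_colouring (adj : nat -> nat -> Prop) (K : nat) :
  (forall n (s : seq nat), uniq s ->
    (forall m, m \in s -> (m < n)%N /\ adj m n) -> (size s <= K)%N) ->
  exists c : nat -> 'I_K.+1, forall m n, (m < n)%N -> adj m n -> c m <> c n.
Proof.
move=> deg.
pose used (l : seq 'I_K.+1) := [seq nth ord0 l m | m <- iota 0 (size l) & `[< adj m (size l) >]].
pose new (l : seq 'I_K.+1) : 'I_K.+1 := odflt ord0 [pick k | k \notin used l].
have newP l : new l \notin used l.
  rewrite /new; case: pickP => //= all_used.
  pose nbrs := [seq m <- iota 0 (size l) | `[< adj m (size l) >]].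
  have le_K : (size nbrs <= K)%N.
    apply: (deg (size l)); first by rewrite filter_uniq ?iota_uniq.
    by move=> m; rewrite mem_filter mem_iota add0n => /andP[/asboolP].
  have lt_K : (K < size nbrs)%N.
    rewrite -(size_map (nth ord0 l)); have := size_enum_ord K.+1 => {1}<-.
    by apply: uniq_leq_size; [exact: enum_uniq|move=> k _; exact: negbFE (all_used k)].
  by move: lt_K; rewrite ltnNge le_K.
pose L := fix L n : seq 'I_K.+1 := if n is m.+1 then rcons (L m) (new (L m)) else [::].
have sizeL n : size (L n) = n by elim: n => //= n IH; rewrite size_rcons IH.
pose c n := new (L n).
have nthL n m : (m < n)%N -> nth ord0 (L n) m = c m.
  elim: n => // n IH; rewrite ltnS leq_eqVlt /= nth_rcons sizeL => /orP[/eqP->|mn].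
    by rewrite ltnn eqxx.
  by rewrite mn IH.
exists c => m n mn amn e; have := newP (L n); rewrite -/(c n) -e => /negP; apply.
apply/mapP; exists m; last by rewrite nthL.
by rewrite sizeL mem_filter mem_iota /= add0n mn andbT; apply/asboolP.
Qed.

(** A colouring that separates the neighbours of each vertex splits the edges
into matchings, one for each pair of colours; [s (a, b)] exchanges the ends of
the edges with colours [a] and [b]. *)
Lemma matching_involutions (adj : nat -> nat -> Prop) (C : eqType) (c : nat -> C) :
  (forall i j, adj i j -> adj j i) ->
  (forall i j, adj i j -> c i <> c j) ->
  (forall i j k, adj i j -> adj i k -> c j = c k -> j = k) ->
  exists s : C * C -> nat -> nat, [/\ forall k, involutive (s k),
    forall k i, s k i = i \/ adj i (s k i) & forall i j, adj i j -> exists k, s k i = j].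
Proof.
move=> sym proper sep.
(* The neighbour of [i] with colour [b], or [i] itself if there is none. *)
pose nb i b := xget i [set j | adj i j /\ c j = b].
have nbP i b : nb i b = i \/ (adj i (nb i b) /\ c (nb i b) = b).
  by rewrite /nb; case: xgetP => [j _ [? ?]|_]; [right|left].
have nbE i j : adj i j -> nb i (c j) = j.
  move=> aij; rewrite /nb; case: xgetP => [k _ [aik ckj]|/(_ j)].
    exact: sep aik aij ckj.
  by move=> /(_ _)/= []; split.
pose s (ab : C * C) i := if c i == ab.1 then nb i ab.2 else
  if c i == ab.2 then nb i ab.1 else i.
exists s; split => [[a b] i|[a b] i|i j aij].
- have [ca|ca] := eqVneq (c i) a.
    have sE : s (a, b) i = nb i b by rewrite /s /= ca eqxx.
    have [e|[aij cj]] := nbP i b; first by rewrite sE e sE e.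
    rewrite sE /s /= cj ifF; last first.
      by apply/negP => /eqP ba; apply: (proper _ _ aij); rewrite ca cj ba.
    by rewrite eqxx -ca nbE//; exact: sym.
  have [cb|cb] := eqVneq (c i) b; last by rewrite /s /= !(negbTE ca, negbTE cb).
  have sE : s (a, b) i = nb i a by rewrite /s /= (negbTE ca) cb eqxx.
  have [e|[aij cj]] := nbP i a; first by rewrite sE e sE e.
  by rewrite sE /s /= cj eqxx -cb nbE//; exact: sym.
- rewrite /s /=; case: ifP => _; first by have [->|[]] := nbP i b; [left|right].
  by case: ifP => _; [have [->|[]] := nbP i a; [left|right]|left].
- by exists (c i, c j); rewrite /s /= eqxx nbE.
Qed.

End colouring.

(** * Flows with prescribed divergence *)

Lemma continuous_sumr (R : realType) (S : topologicalType) (J : Type) (r : seq J)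
    (F : J -> S -> R) :
  (forall k, continuous (F k)) -> continuous (fun g => \sum_(k <- r) F k g).
Proof.
move=> cF; elim: r => [|k r IH].
  rewrite (_ : (fun _ => _) = cst 0); first exact: cst_continuous.
  by apply/funext => g; rewrite big_nil.
rewrite (_ : (fun _ => _) = (fun g => F k g + \sum_(k <- r) F k g)).
  by move=> g; apply: cvgD; [exact: cF|exact: IH].
by apply/funext => g; rewrite big_cons.
Qed.

Section flow.
Context {R : realType} {I : finType}.
Variables (s : I -> nat -> nat) (w : nat -> R) (B : R).
Hypothesis sK : forall k, involutive (s k).
Hypotheses (w0 : forall i, 0 <= w i) (B0 : 0 <= B).
Hypothesis isoperimetric : forall (N : nat) (A : pred nat),
  (forall i, A i -> (i < N)%N) ->
  \sum_(i < N | A i) w i <= B * \sum_k \sum_(i < N | A i) (~~ A (s k i))%:R.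

(** The inequality for functions follows from the inequality for sets by slicing
into superlevel sets.  The indicator of the support, times the smallest positive
value of [h], is split off; this lowers [max (h i - h (s k i)) 0] by that value
on the edges that leave the support and changes it on no other edge. *)
Lemma coarea_ge0 (N : nat) (h : nat -> R) : (forall i, 0 <= h i) ->
  (forall i, (N <= i)%N -> h i = 0) ->
  \sum_(i < N) w i * h i <= B * \sum_k \sum_(i < N) Num.max (h i - h (s k i)) 0.
Proof.
have [m] := ubnP #|[pred i : 'I_N | 0 < h i]|.
elim: m h => // m IH h /ltnSE cm h0 hN.
pose A : pred nat := fun i => 0 < h i.
have AN i : A i -> (i < N)%N.
  by rewrite ltnNge; apply: contraL => /hN Ni; rewrite /A Ni ltxx.
have [[i0 Ai0]|nA] := pselect (exists i, A i); last first.
  have hz i : h i = 0.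
    apply/eqP; rewrite eq_le h0 andbT leNgt; apply/negP => hi.
    by apply: nA; exists i.
  rewrite big1 => [|i _]; last by rewrite hz mulr0.
  by rewrite mulr_ge0// sumr_ge0// => k _; rewrite sumr_ge0// => i _; rewrite le_max lexx orbT.
pose i1 := [arg min_(i < Ordinal (AN _ Ai0) | A i) h i]%O.
have [i1A i1min] : A i1 /\ forall i, A i -> h i1 <= h i.
  rewrite /i1; case: arg_minP => // j Aj jmin; split=> // i Ai.
  exact: (jmin (Ordinal (AN _ Ai))).
pose h' i := h i - h i1 * (A i)%:R.
have h'0 i : 0 <= h' i.
  rewrite /h'; have [Ai|_] := boolP (A i); last by rewrite mulr0 subr0.
  by rewrite mulr1 subr_ge0; exact: i1min.
have h'N i : (N <= i)%N -> h' i = 0.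
  by move=> Ni; rewrite /h' /A (hN _ Ni) ltxx mulr0 subrr.
have card' : (#|[pred i : 'I_N | (0 < h' i)%R]| < m)%N.
  apply: leq_trans cm; apply: proper_card; apply/properP; split.
    apply/fintype.subsetP => i; rewrite !inE /h' => hi; apply: lt_le_trans hi _.
    by rewrite gerBl mulr_ge0.
  by exists i1; rewrite !inE// /h' i1A mulr1 subrr ltxx.
have hE i : h i = h' i + h i1 * (A i)%:R by rewrite /h' subrK.
have -> : \sum_(i < N) w i * h i =
    \sum_(i < N) w i * h' i + h i1 * \sum_(i < N | A i) w i.
  rewrite mulr_sumr [X in _ + X]big_mkcond -big_split /=; apply: eq_bigr => i _.
  rewrite (hE i) mulrDr; congr (_ + _).
  by case: (A i); rewrite ?mulr1 ?mulr0 1?mulrC.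
have -> : \sum_k \sum_(i < N) Num.max (h i - h (s k i)) 0 =
    \sum_k \sum_(i < N) Num.max (h' i - h' (s k i)) 0 +
    h i1 * \sum_k \sum_(i < N | A i) (~~ A (s k i))%:R.
  rewrite mulr_sumr -big_split; apply: eq_bigr => k _ /=.
  rewrite mulr_sumr [X in _ + X]big_mkcond -big_split /=; apply: eq_bigr => i _.
  have := h'0 i; have := h'0 (s k i); have := h0 i; have := h0 (s k i).
  have hz j : ~~ A j -> h j = 0.
    by rewrite /A -leNgt => hj; apply/eqP; rewrite eq_le hj h0.
  rewrite /h'; have [Ai|/hz nAi] := boolP (A i); have [As|/hz nAs] := boolP (A (s k i)).
  - by rewrite !mulr1 mulr0 addr0 => *; congr Num.max; ring.
  - rewrite nAs !mulr1 !mulr0 !subr0 => _ ? ? ?.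
    by rewrite !max_l// subrK.
  - by rewrite nAi !mulr0 !mulr1 !subr0 !sub0r addr0 => *; rewrite !max_r// oppr_le0.
  - by rewrite nAi nAs !mulr0 addr0 !subr0.
rewrite mulrDr lerD//; first exact: IH.
by rewrite mulrCA ler_wpM2l// isoperimetric.
Qed.

Lemma coarea (N : nat) (h : nat -> R) : (forall i, (N <= i)%N -> h i = 0) ->
  \sum_(i < N) w i * h i <= B * \sum_k \sum_(i < N) Num.max (h i - h (s k i)) 0.
Proof.
move=> hN; pose p i := Num.max (h i) 0.
have p0 i : 0 <= p i by rewrite le_max lexx orbT.
have pN i : (N <= i)%N -> p i = 0 by move=> Ni; rewrite /p hN// maxxx.
apply: le_trans (_ : \sum_(i < N) w i * p i <= _).
  by apply: ler_sum => i _; rewrite ler_wpM2l// le_max lexx.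
apply: le_trans (coarea_ge0 p0 pN) _; rewrite ler_wpM2l//.
apply: ler_sum => k _; apply: ler_sum => i _; rewrite /p.
by have [?|?] := leP (h i) 0; have [?|?] := leP (h (s k i)) 0; rewrite !(le_max, ge_max) ?lexx ?orbT ?andbT//; apply/orP; lra.
Qed.

Definition divergence (g : I * nat -> R) (i : nat) : R :=
  \sum_k (g (k, i) - g (k, s k i)).

(** Summation by parts.  Because [r] vanishes from [n] on, only the indices [i] with
[i < n] or [s k i < n] contribute; they lie below [N], and [s k] permutes them. *)
Lemma sum_divergence (g : I * nat -> R) (r : nat -> R) (n N : nat) :
  (n <= N)%N -> (forall k i, (i < n)%N -> (s k i < N)%N) ->
  (forall i, (n <= i)%N -> r i = 0) ->
  \sum_(i < n) r i * divergence g i =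
  \sum_k \sum_(i < N) g (k, i : nat) * (r i - r (s k i)).
Proof.
move=> nN sN rn.
have -> : \sum_(i < n) r i * divergence g i =
    \sum_k \sum_(i < N) r i * (g (k, i : nat) - g (k, s k i)).
  rewrite exchange_big /= (big_ord_widen_cond _ xpredT (fun i => r i * divergence g i) nN).
  rewrite big_mkcond; apply: eq_bigr => i _; rewrite -mulr_sumr /=.
  by case: ifPn => //; rewrite -leqNgt => /rn ->; rewrite mul0r.
apply: eq_bigr => k _.
case: N nN sN => [|N] nN sN; first by rewrite !big_ord0.
have swap : \sum_(i < N.+1) r i * g (k, s k i) = \sum_(i < N.+1) g (k, i : nat) * r (s k i).
  pose Q := [pred i : 'I_N.+1 | (i < n)%N || (s k i < n)%N].
  have sQ (i : 'I_N.+1) : Q i -> (s k i < N.+1)%N.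
    by move=> /orP[/sN//|h]; exact: leq_trans h _.
  pose t (i : 'I_N.+1) : 'I_N.+1 := inord (s k i).
  have tE i : Q i -> t i = s k i :> nat by move=> /sQ h; rewrite inordK.
  have tK i : Q i -> t (t i) = i.
    by move=> Qi; apply: val_inj; rewrite /= inordK tE ?sK.
  have tQ i : Q i -> Q (t i) by move=> Qi; rewrite /= tE// sK orbC.
  transitivity (\sum_(i : 'I_N.+1 | Q i) r i * g (k, s k i)).
    rewrite [RHS]big_mkcond /=; apply: eq_bigr => i _.
    case: ifPn => //; rewrite negb_or -leqNgt => /andP[/rn -> _]; exact: mul0r.
  transitivity (\sum_(i : 'I_N.+1 | Q i) g (k, i : nat) * r (s k i)); last first.
    rewrite [LHS]big_mkcond /=; apply: eq_bigr => i _.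
    by case: ifPn => //; rewrite negb_or -!leqNgt => /andP[_ /rn ->]; rewrite mulr0.
  rewrite (reindex_onto t t) //=.
  apply: eq_big => [i|i Qti]; last first.
    have [Qt /eqP e] := andP Qti; have Qi : Q i by rewrite -e; exact: tQ.
    by rewrite (tE i Qi) sK mulrC.
  apply/andP/idP => [[Qt /eqP e]|Qi]; first by rewrite -e; exact: (tQ (t i) Qt).
  by split; [exact: tQ|rewrite tK].
rewrite -[RHS](_ : \sum_(i < N.+1) (g (k, i : nat) * r i - g (k, i : nat) * r (s k i)) = _); last first.
  by apply: eq_bigr => i _; rewrite mulrBr.
rewrite sumrB -swap -sumrB; apply: eq_bigr => i _.
by rewrite mulrBr (mulrC (r i) (g (k, i : nat))).
Qed.

Let T := prod_topology (fun _ : I * nat => (R : topologicalType)).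

Let box : set T := [set g | forall e, `[0, B]%classic (g e)].

Let box_compact : compact box.
Proof.
apply: (@tychonoff _ (fun _ : I * nat => (R : topologicalType)) (fun=> `[0, B]%classic)).
by move=> e; exact: segment_compact.
Qed.

Let continuous_div i : continuous (fun g : T => divergence g i : R).
Proof.
apply: continuous_sumr => k g.
have ev e : h e @[h --> g] --> (g e : R).
  exact: (@proj_continuous _ (fun _ : I * nat => (R : topologicalType)) e g).
exact: cvgB (ev (k, i)) (ev (k, s k i)).
Qed.

(** A flow in the box minimising the square error [sum r_i ^ 2] over [i < n] has
error zero.  The box contains the flow that is [B] where [r] drops along an edge
and [0] elsewhere; moving towards it cannot decrease the square error, and
with the coarea inequality this says [sum r_i ^ 2 <= 0]. *)
Let exact_flow_upto n : exists2 g : T, box g & forall i, (i < n)%N -> divergence g i = w i.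
Proof.
pose err (g : T) : R := \sum_(i < n) (w i - divergence g i) ^+ 2.
have cerr : continuous err.
  apply: continuous_sumr => i g.
  have ci : w i - divergence g i @[g --> g] --> w i - divergence g i.
    exact: cvgB (cvg_cst _) (@continuous_div i g).
  exact: (cvgM ci (ci)).
have box0 : box !=set0.
  by exists (fun=> 0) => e /=; rewrite in_itv /= lexx.
have [g gbox gmin] := compact_EVT_min box0 box_compact (continuous_subspaceT cerr).
rewrite inE in gbox; exists g => //.
pose r i := if (i < n)%N then w i - divergence g i else 0.
have rn i : (n <= i)%N -> r i = 0 by rewrite /r ltnNge => ->.
pose N := (n + \max_k \max_(i < n) (s k i).+1)%N.
have nN : (n <= N)%N by exact: leq_addr.
have sN k i : (i < n)%N -> (s k i < N)%N.
  move=> i_n; apply: leq_trans (leq_addl _ _).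
  apply: leq_trans (leq_bigmax k); exact: (leq_bigmax (Ordinal i_n)).
pose b (e : I * nat) : R := if 0 < r e.2 - r (s e.1 e.2) then B else 0.
have bbox e : 0 <= b e <= B by rewrite /b; case: ifP; rewrite ?lexx ?B0.
have gb e : 0 <= g e <= B by have := gbox e; rewrite /= in_itv.
pose D i := divergence b i - divergence g i.
have quad t : 0 <= t <= 1 ->
    0 <= - (2 * t) * (\sum_(i < n) r i * D i) + t ^+ 2 * \sum_(i < n) D i ^+ 2.
  move=> /andP[t0 t1]; pose gt : T := fun e => g e + t * (b e - g e).
  have gtbox : gt \in box.
    rewrite inE => e /=; rewrite in_itv /= /gt; have := gb e; have := bbox e.
    by move=> /andP[? ?] /andP[? ?]; apply/andP; split; nra.
  have := gmin gt gtbox; rewrite /err -subr_ge0 -sumrB.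
  rewrite (_ : \sum_(i < n) _ = - (2 * t) * (\sum_(i < n) r i * D i) +
      t ^+ 2 * \sum_(i < n) D i ^+ 2)//.
  rewrite !mulr_sumr -big_split /=; apply: eq_bigr => i _.
  have -> : divergence gt i = divergence g i + t * D i.
    rewrite /D /divergence -sumrB mulr_sumr -big_split /=; apply: eq_bigr => k _.
    by rewrite /gt; ring.
  by rewrite /r ltn_ord; ring.
have rD : \sum_(i < n) r i * D i <= 0.
  set x := \sum_(i < n) _ in quad *; set y := \sum_(i < n) D i ^+ 2 in quad.
  have y0 : 0 <= y by rewrite sumr_ge0// => i _; exact: sqr_ge0.
  rewrite leNgt; apply/negP => x0.
  (* The quadratic function of [t] is negative at [t = x / (x + y)]. *)
  have xy : 0 < x + y by rewrite ltr_wpDr.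
  have t01 : 0 <= x / (x + y) <= 1.
    rewrite (divr_ge0 (ltW x0) (ltW xy)) /=.
    by rewrite ler_pdivrMr// mul1r lerDl.
  have := quad _ t01.
  rewrite (_ : _ + _ = (x / (x + y)) * (x * (y / (x + y) - 2))); last by field; rewrite gt_eqF.
  rewrite pmulr_rge0 ?divr_gt0// pmulr_rge0// subr_ge0 ler_pdivlMr//; lra.
have : \sum_(i < n) r i ^+ 2 <= 0.
  have cr := coarea rn.
  have e1 : \sum_(i < n) r i * divergence b i =
      B * \sum_k \sum_(i < N) Num.max (r i - r (s k i)) 0.
    rewrite (sum_divergence b nN sN rn) mulr_sumr; apply: eq_bigr => k _.
    rewrite mulr_sumr; apply: eq_bigr => i _; rewrite /b /=.
    by have [?|?] := ltP 0 (r i - r (s k i)); rewrite ?mul0r ?mulr0.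
  have e2 : \sum_k \sum_(i < n) Num.max (r i - r (s k i)) 0 <=
      \sum_k \sum_(i < N) Num.max (r i - r (s k i)) 0.
    apply: ler_sum => k _.
    rewrite (big_ord_widen_cond _ xpredT (fun i => Num.max (r i - r (s k i)) 0) nN).
    rewrite big_mkcond /=; apply: ler_sum => i _.
    by case: ifP; rewrite ?lexx// le_max lexx orbT.
  have e3 : \sum_(i < n) r i * D i = \sum_(i < n) r i * divergence b i -
      \sum_(i < n) w i * r i + \sum_(i < n) r i ^+ 2.
    rewrite -sumrB -big_split /=; apply: eq_bigr => i _.
    by rewrite /D /r ltn_ord; ring.
  have e4 := ler_wpM2l B0 e2.
  move: rD; rewrite e3 e1; lra.
move=> r0 i i_n; apply/eqP; rewrite eq_sym -subr_eq0 -sqrf_eq0.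
have rr : r i = w i - divergence g i by rewrite /r i_n.
rewrite -rr eq_le sqr_ge0 andbT; apply: le_trans r0.
by rewrite (bigD1 (Ordinal i_n))//= lerDl sumr_ge0// => j _; exact: sqr_ge0.
Qed.

(** A cluster point of the flows that are exact up to [n]. *)
Lemma exact_flow : exists2 g : I * nat -> R,
  (forall e, 0 <= g e <= B) & (forall i, divergence g i = w i).
Proof.
have /choice[G GP] : forall n, exists g : T, box g /\
    forall i, (i < n)%N -> divergence g i = w i.
  by move=> n; have [g ? ?] := exact_flow_upto n; exists g.
have boxG : (G n @[n --> \oo]) box by exists 0%N => // n _; exact: (GP n).1.
have [g [gbox gcl]] := box_compact _ boxG.
exists g; first by move=> e; have := gbox e; rewrite /= in_itv.
move=> i.
have cl : closed ((fun g : T => divergence g i : R) @^-1` [set x : R | x = w i]).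
  by apply: closed_comp => [x _|]; [exact: continuous_div|exact: closed_eq].
suff : ((fun g : T => divergence g i : R) @^-1` [set x : R | x = w i]) g by [].
apply: cl => V Vg; apply: gcl => //.
by exists i.+1 => // n /= i_n; apply: (GP n).2.
Qed.

End flow.

(** * Unbounded spaces: from means to Folner sets *)

Section folner_of_mean.
Context {R : realType} {d : measure_display} {X : measurableType d}.
Variables (cs : coarseStructure X) (mu : {measure set X -> \bar R}).
Hypothesis ub : uniformly_bounded cs mu.
Hypothesis connected : coarse_connected cs.
Variables (P : nat -> set X) (G : set (X * X)) (c C : R).
Hypotheses (cG : controlled cs G) (c0 : 0 < c) (tP : trivIset setT P).
Hypotheses (PT : \bigcup_i P i = setT) (mP : forall i, measurable (P i)).
Hypotheses (PG : forall i, P i `*` P i `<=` G).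
Hypothesis (Pc : forall i, (c%:E <= mu (P i))%E).
Hypothesis (PC : forall i, (mu (P i) <= C%:E)%E).

Let cell_of x : exists i, P i x.
Proof.
have [i _ Pi] : (\bigcup_i P i) x by rewrite PT.
by exists i.
Qed.

Let cell_inj i j x : P i x -> P j x -> i = j.
Proof. by move=> Pi Pj; apply: tP => //; exists x. Qed.

Let cell_neq0 i : P i !=set0.
Proof.
apply/set0P/eqP => P0; have := Pc i.
by rewrite P0 measure0 lee_fin leNgt c0.
Qed.

Let fP i : (mu (P i) < +oo)%E.
Proof. exact: le_lt_trans (PC i) (ltry _). Qed.

Let w i := fine (mu (P i)).

Let wE i : mu (P i) = (w i)%:E.
Proof. by rewrite fineK ?ge0_fin_numE. Qed.

Let w_gt0 i : 0 < w i.
Proof. by rewrite -lte_fin -wE (lt_le_trans _ (Pc i)). Qed.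

Let wc i : c <= w i.
Proof. by rewrite -lee_fin -wE. Qed.

Let wC i : w i <= C.
Proof. by rewrite -lee_fin -wE. Qed.

(** The cells form a graph of bounded degree: the cells near a given one are
disjoint, of measure at least [c], and jointly bounded. *)
Lemma cell_matchings E : controlled cs E -> (forall x y, E (x, y) -> E (y, x)) ->
  exists (I : finType) (s : I -> nat -> nat) (Q : set (X * X)),
    [/\ controlled cs Q, forall k, involutive (s k),
      forall k i, (P i `|` P (s k i)) `*` (P i `|` P (s k i)) `<=` Q &
      forall i j x y, i <> j -> P i x -> P j y -> E (x, y) ->
        exists k, s k i = j].
Proof.
move=> cE symE.
pose touch i j := exists x y, [/\ P i x, P j y & E (x, y)].
have touch_sym i j : touch i j -> touch j i.
  by move=> [x [y [Px Py Exy]]]; exists y, x; split => //; exact: symE.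
pose adj i j := i <> j /\ touch i j.
have adj_sym i j : adj i j -> adj j i.
  by move=> [ij tij]; split; [exact: nesym|exact: touch_sym].
pose adj2 i j := i <> j /\ (touch i j \/ exists2 k, touch i k & touch k j).
have adj2_sym i j : adj2 i j -> adj2 j i.
  move=> [ij [tij|[k tik tkj]]]; split; try exact: nesym.
    by left; exact: touch_sym.
  by right; exists k; exact: touch_sym.
pose Q := rcomp (rcomp G E) G.
have cQ : controlled cs Q by do 2![apply: controlled_rcomp => //].
have touchQ i j : touch i j -> P i `*` P j `<=` Q.
  move=> [x' [y' [Px' Py' Exy]]] [x y] [/= Px Py].
  exists y'; split; last by apply: (@PG j).
  by exists x'; split => //; apply: (@PG i).
pose D := Q `|` rcomp Q Q.
have cD : controlled cs D by apply: controlled_setU => //; exact: controlled_rcomp.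
have adj2D i j : adj2 i j -> P i `*` P j `<=` D.
  move=> [_ [tij|[k tik tkj]]] [x y] [/= Px Py]; first by left; apply: (touchQ i j).
  have [z Pz] := cell_neq0 k; right; exists z.
  by split; [apply: (touchQ i k)|apply: (touchQ k j)].
have [K HK] := disjoint_family_size ub (controlled_rcomp cD (controlled_inverse cD)) c0.
have [|col colP] := @greedy_colouring adj2 K.
  move=> n s us sn; apply: (HK nat P) => //.
    move=> i j /sn[_ ain] /sn[_ ajn] [x y] [/= Px Py].
    have [z Pz] := cell_neq0 n; exists z.
    by split; [exact: (adj2D _ _ ain)|exact: (adj2D _ _ ajn)].
  by move=> i j _ _; exact: tP.
have colN i j : adj2 i j -> col i <> col j.
  move=> aij; have [ij _] := aij.
  have [lt_ij|lt_ji|//] := ltngtP i j; first exact: colP.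
  by apply: nesym; apply: colP => //; exact: adj2_sym.
have [|i j k [ij tij] [ik tik] ecol|s [sK sadj scov]] :=
    matching_involutions adj_sym (c := col).
- by move=> i j [ij tij]; apply: colN; split => //; left.
- apply: contrapT => jk; apply: (colN j k) => //; split => //.
  by right; exists i => //; exact: touch_sym.
exists ('I_K.+1 * 'I_K.+1)%type, s, (G `|` Q); split => //.
- exact: controlled_setU.
- move=> k i [x y] [/=].
  have [->|[_ tis]] := sadj k i.
    by move=> Px Py; left; apply: (@PG i); split => /=; tauto.
  case=> Px; case=> Py.
  + by left; apply: (@PG i).
  + by right; apply: (touchQ i (s k i)).
  + by right; apply: (touchQ (s k i) i) => //; exact: touch_sym.
  + by left; apply: (@PG (s k i)).
- by move=> i j x y ij Px Py Exy; apply: scov; split => //; exists x, y.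
Qed.

Let measurable_cellwise (a : nat -> R) (idx : X -> nat) :
  (forall x, P (idx x) x) -> measurable_fun setT (fun x => a (idx x)).
Proof.
move=> idxP _ Y mY; rewrite setTI.
rewrite (_ : _ @^-1` _ = \bigcup_(i in [set i | Y (a i)]) P i).
  exact: bigcup_measurable.
apply/seteqP; split => [x /= Yx|x [i /= Yi Px]]; first by exists (idx x).
by rewrite (cell_inj (idxP x) Px).
Qed.

Let measure_bigsetU_le (J : Type) (r : seq J) (p : pred J) (F : J -> set X) :
  (forall j, measurable (F j)) ->
  (mu (\big[setU/set0]_(j <- r | p j) F j) <= \sum_(j <- r | p j) mu (F j))%E.
Proof.
move=> mF; elim: r => [|j r IH]; first by rewrite !big_nil measure0.
rewrite !big_cons; case: ifP => // _.
have mB : measurable (\big[setU/set0]_(j <- r | p j) F j) by exact: bigsetU_measurable.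
by apply: le_trans (measureU2 mu (mF j) mB) _; exact: leeD.
Qed.

Let mem_bigsetU (J : finType) (p : pred J) (F : J -> set X) x :
  (\big[setU/set0]_(j | p j) F j) x <-> exists2 j, p j & F j x.
Proof.
rewrite -bigcup_seq_cond; split => [[j /= /andP[_ pj] Fx]|[j pj Fx]]; exists j => //=.
by rewrite mem_index_enum.
Qed.

Section isoperimetry.
Variables (E0 : set (X * X)) (eps : R) (I : finType) (s : I -> nat -> nat).
Hypotheses (mE0 : measurable_rel E0) (eps0 : 0 < eps).
Hypothesis expanding : forall U, U !=set0 -> measurable U -> coarse_bounded cs U ->
  ((1 + eps)%:E * mu U < mu (fibre E0 U))%E.
Hypothesis scov : forall i j x y, i <> j -> P i x -> P j y -> E0 (y, x) ->
  exists k, s k i = j.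

(** A set of cells that violates the Folner condition has a large boundary, and
each boundary cell is reached along an edge. *)
Lemma cell_isoperimetric (N : nat) (A : pred nat) : (forall i, A i -> (i < N)%N) ->
  \sum_(i < N | A i) w i <=
  C / eps * \sum_k \sum_(i < N | A i) (~~ A (s k i))%:R.
Proof.
move=> AN.
have C0 : 0 <= C by apply: le_trans (wC 0%N); exact: ltW.
have [[i0 Ai0]|nA] := pselect (exists i, A i); last first.
  rewrite big_pred0 => [|i]; last by apply/negP => Ai; apply: nA; exists i.
  by rewrite mulr_ge0 ?divr_ge0 ?(ltW eps0)// sumr_ge0// => k _; rewrite sumr_ge0.
pose U := \big[setU/set0]_(i < N | A i) P i.
have UE x : U x <-> exists2 i, A i & P i x.
  split => [/mem_bigsetU[i Ai Px]|[i Ai Px]]; first by exists i.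
  by apply/mem_bigsetU; exists (Ordinal (AN _ Ai)).
have mU : measurable U by exact: bigsetU_measurable.
have bU : coarse_bounded cs U.
  apply: (@coarse_boundedS _ _ _ (\bigcup_(i in `I_N) P i)).
    by move=> x /UE[i Ai Px]; exists i => //=; exact: AN.
  apply: coarse_bounded_bigcup => // i _.
  exact: controlled_subset (@PG i) cG.
have U0 : U !=set0.
  by have [x Px] := cell_neq0 i0; exists x; apply/UE; exists i0.
have muU : mu U = (\sum_(i < N | A i) w i)%:E.
  rewrite /U measure_bigsetU_ord//; last first.
    move=> i j _ _ h; apply: val_inj; exact: tP h.
  by rewrite -sumEFin; apply: eq_bigr => i _; exact: wE.
pose V := \big[setU/set0]_k \big[setU/set0]_(i < N | A i && ~~ A (s k i)) P (s k i).
have mV : measurable V by apply: bigsetU_measurable => k _; exact: bigsetU_measurable.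
have sub : fibre E0 U `<=` U `|` V.
  move=> y [x /UE[i Ai Px] Eyx]; have [j Py] := cell_of y.
  have [Aj|nAj] := boolP (A j); first by left; apply/UE; exists j.
  right; have ij : i <> j by move=> ij; move: nAj; rewrite -ij Ai.
  have [k skj] := scov ij Px Py Eyx.
  apply/mem_bigsetU; exists k => //.
  by apply/mem_bigsetU; exists (Ordinal (AN _ Ai)); rewrite /= skj ?Ai.
have muV : (mu V <= (C * \sum_k \sum_(i < N | A i) (~~ A (s k i))%:R)%:E)%E.
  apply: le_trans (measure_bigsetU_le _ _ _) _ => [k|]; first exact: bigsetU_measurable.
  rewrite mulr_sumr -sumEFin; apply: lee_sum => k _.
  apply: le_trans (measure_bigsetU_le _ _ _) _ => [i|]; first exact: mP.
  rewrite mulr_sumr -sumEFin big_mkcondr /=; apply: lee_sum => i _.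
  by case: ifP => _; rewrite ?mulr1 ?mulr0.
have := expanding U0 mU bU; rewrite muU -EFinM => /ltW h.
have mEU : measurable (fibre E0 U) by exact: mE0.
have {}h : ((1 + eps) * \sum_(i < N | A i) w i <=
    \sum_(i < N | A i) w i + C * \sum_k \sum_(i < N | A i) (~~ A (s k i))%:R).
  rewrite -lee_fin EFinD -muU; apply: le_trans h _.
  apply: (@le_trans _ _ (mu (U `|` V))).
    by apply: le_measure; rewrite ?inE//; exact: measurableU.
  by apply: le_trans (measureU2 _ mU mV) _; rewrite leeD2l.
rewrite mulrAC ler_pdivlMr// mulrC; move: h; rewrite mulrDl mul1r lerD2l.
exact.
Qed.

End isoperimetry.

Lemma mean_sum (phi : (X -> R[i]) -> R[i]) (I : Type) (r : seq I) (f : I -> X -> R[i]) :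
  mean mu phi -> (forall k, Linfty mu (f k)) -> (forall k, phi (f k) = 0) ->
  Linfty mu (fun x => \sum_(k <- r) f k x) /\ phi (fun x => \sum_(k <- r) f k x) = 0.
Proof.
move=> mphi hf f0; elim: r => [|k r [hr phir]].
  rewrite (_ : (fun _ => _) = cst 0); last by apply/funext => x; rewrite big_nil.
  have h0 := Linfty_cst mu 0; split => //.
  have := mean_linear mphi (-1) h0 h0; rewrite mulN1r addNr => {2}<-.
  by congr phi; apply/funext => x; rewrite !fctE scaler0 addr0.
rewrite (_ : (fun _ => _) = 1 *: f k + (fun x => \sum_(k <- r) f k x)); last first.
  by apply/funext => x; rewrite big_cons !fctE scale1r.
split; first exact: LinftyZD.
by rewrite (mean_linear mphi)// f0 phir mulr0 addr0.
Qed.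

(** A bounded flow whose divergence is the measure of the cells writes the
constant function 1 as a finite sum, over the matchings, of functions that have
integral zero on each pair of matched cells. *)
Lemma no_mean_of_flow (I : finType) (s : I -> nat -> nat) (Q : set (X * X)) (B : R)
    (g : I * nat -> R) :
  controlled cs Q -> (forall k, involutive (s k)) ->
  (forall k i, (P i `|` P (s k i)) `*` (P i `|` P (s k i)) `<=` Q) ->
  (forall e, 0 <= g e <= B) -> (forall i, divergence s g i = w i) ->
  ~ amenable_mean cs mu.
Proof.
move=> cQ sK PQ gB gw [phi mphi null].
have /choice[idx idxP] := cell_of.
pose u k i := g (k, i) - g (k, s k i).
have uB k i : `|u k i| <= B.
  have /andP[? ?] := gB (k, i); have /andP[? ?] := gB (k, s k i).
  by rewrite ler_norml /u; apply/andP; split; lra.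
have B0 : 0 <= B.
  have e : w 0 != 0 by rewrite gt_eqF.
  have [k _|I0] := pickP (fun _ : I => true); first by have /andP[/le_trans] := gB (k, 0%N); apply.
  by move: e; rewrite -gw /divergence big1 ?eqxx// => k _; have := I0 k.
pose a k i := u k i / w i.
have aB k i : `|a k i| <= B / c.
  rewrite /a normrM ler_pM// normfV (gtr0_norm (w_gt0 i)).
  by rewrite lef_pV2 ?posrE.
pose f k (x : X) : R[i] := (a k (idx x))%:C.
have mf k : measurable_fun setT (fun x => a k (idx x)) by exact: measurable_cellwise.
have hf k : Linfty mu (f k).
  apply: (@Linfty_bounded _ _ _ _ _ (B / c)); first exact: cmeasurable_real.
  by move=> x; rewrite /f /= expr0n addr0 sqrtr_sqr; exact: aB.
have int_cell k i : \int[mu]_(x in P i) a k (idx x) = u k i.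
  rewrite (@eq_Rintegral _ _ _ mu (P i) (cst (a k i))); last first.
    by move=> x; rewrite inE => Px; rewrite (cell_inj (idxP x) Px).
  by rewrite Rintegral_cst// /a -/(w i) divfK// gt_eqF.
have f0 k : phi (f k) = 0.
  apply: (null (range (fun i => P i `|` P (s k i)))) => //.
  - exists Q, c; split => //; split.
      move=> _ _ [i _ <-] [j _ <-] [x [Px Px']].
      have orbit : j = i \/ j = s k i.
        case: Px => Px; case: Px' => Px'.
        + by left; exact: cell_inj Px' Px.
        + by right; rewrite (cell_inj Px Px') sK.
        + by right; exact: cell_inj Px' Px.
        + by left; rewrite -(sK k i) (cell_inj Px Px') sK.
      by case: orbit => ->; rewrite ?sK// setUC.
    move=> _ [i _ <-]; split; [exact: measurableU|exact: PQ|].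
    apply: le_trans (Pc i) _; apply: le_measure; rewrite ?inE//.
    exact: measurableU.
  - move=> _ [i _ <-]; rewrite /cintegral /f /=; congr (_ +i* _); last first.
      by rewrite Rintegral_cst ?mul0r//; exact: measurableU.
    have [si|si] := eqVneq (s k i) i; first by rewrite si setUid int_cell /u si subrr.
    rewrite Rintegral_setU//; last 2 first.
    + apply: measurable_bounded_integrable; first exact: measurableU.
      * by apply: le_lt_trans (measureU2 mu (mP i) (mP (s k i))) _; exact: lte_add_pinfty (fP i) (fP (s k i)).
      * exact: measurable_funTS.
      * exists (B / c); split; first exact: num_real.
        by move=> M BM x _; apply: le_trans (aB _ _) (ltW BM).
    + apply/disj_setPS => x [Px Psx].
      by move: si; rewrite -(cell_inj Px Psx) eqxx.
    by rewrite !int_cell /u sK; ring.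
  - apply: aeW => x nAx; exfalso; apply: nAx.
    by exists (P (idx x) `|` P (s k (idx x))); [exists (idx x)|left].
have [_] := mean_sum (index_enum I) mphi hf f0.
rewrite (_ : (fun _ => _) = cst 1); last first.
  apply/funext => x; rewrite /f -rmorph_sum /= /a -mulr_suml.
  by rewrite -/(divergence s g (idx x)) gw divff// gt_eqF.
by rewrite (mean1 mphi) => /eqP; rewrite oner_eq0.
Qed.

Lemma folner_of_mean : amenable_mean cs mu -> amenable_folner cs mu.
Proof.
move=> am; apply: contrapT => nfolner.
have [E [eps [cE mE eps0 expanding]]] : exists E (eps : R),
    [/\ controlled cs E, measurable_rel E, 0 < eps &
      forall U, U !=set0 -> measurable U -> coarse_bounded cs U ->
        ((1 + eps)%:E * mu U < mu (fibre E U))%E].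
  apply: contrapT => h; apply: nfolner => E eps cE mE eps0.
  apply: contrapT => nU; apply: h; exists E, eps; split => // U U0 mU bU.
  by rewrite ltNge; apply/negP => le; apply: nU; exists U.
have cE' := controlled_setU cE (controlled_inverse cE).
have [|I [s [Q [cQ sK PQ scov]]]] := cell_matchings cE'.
  by move=> x y [?|?]; [right|left].
have C0 : 0 <= C by apply: le_trans (wC 0%N); exact: ltW.
have [|i||N A AN|g gB gw] := @exact_flow R I s w (C / eps).
- exact: sK.
- by rewrite ltW.
- by rewrite divr_ge0// ltW.
- have scov' i j x y : i <> j -> P i x -> P j y -> E (y, x) -> exists k, s k i = j.
    by move=> ij Px Py Eyx; apply: (scov i j x y) => //; right.
  exact: (cell_isoperimetric mE eps0 expanding scov' AN).
exact: (no_mean_of_flow cQ sK PQ gB gw am).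
Qed.

End folner_of_mean.

(** * The theorem *)

Theorem theorem9p4 (R : realType) (d : measure_display) (X : measurableType d)
    (cs : coarseStructure X) (mu : {measure set X -> \bar R}) :
  (forall x : X, measurable [set x]) ->
  coarse_connected cs ->
  countably_covered cs ->
  uniformly_bounded cs mu ->
  (exists E, gordo cs mu E) ->
  (coarse_bounded cs [set: X] ->
     [/\ amenable_mean cs mu, amenable_folner cs mu &
         geometric_property_T cs mu]) /\
  (~ coarse_bounded cs [set: X] ->
     (geometric_property_T cs mu <-> ~ amenable_mean cs mu) /\
     (geometric_property_T cs mu <-> ~ amenable_folner cs mu)).
Proof.
move=> m1 conn cov ub [F gF]; split => [bX|unb].
  split; [exact: (mean_of_bounded ub cov gF m1 bX)|
    exact: (folner_of_bounded mu bX)|exact: (T_of_bounded ub cov gF m1 bX)].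
have [P [G [c [C [cG c0 tP PT PP]]]]] := measured_partition ub cov gF m1 conn unb.
have mP i : measurable (P i) by have [] := PP i.
have PG i : P i `*` P i `<=` G by have [] := PP i.
have Pc i : (c%:E <= mu (P i))%E by have [] := PP i.
have PC i : (mu (P i) <= C%:E)%E by have [] := PP i.
have mean_folner := folner_of_mean ub conn cG c0 tP PT mP PG Pc PC.
have folner_nT := not_T_of_folner ub cov conn cG c0 tP PT mP PG Pc.
have nT_mean := amenable_of_not_T ub cov.
(* Both equivalences follow from the cycle of three implications. *)
split; split => h.
- by move=> am; apply: folner_nT h; exact: mean_folner.
- by apply: contrapT => nT; apply: h; exact: nT_mean.
- by move=> fo; exact: folner_nT fo h.
- by apply: contrapT => nT; apply: h; exact: mean_folner (nT_mean nT).
Qed.
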